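(* Assume $d/p\le k$. (a) $U_p^k$ is a Banach space (in particular, the seminorm $\|\cdot\|_{U_p^k}$ on $(U_p^k)^0$ is a norm). (b) The closed unit ball $B(U_p^k)$ is the closure of the symmetric convex hull of the set $\{b_\pi\in(U_p^k)^0:\ [b_\pi]_{p'}\le1\}$. (c) The space $U_p^k$ is nonseparable and contains a separable subspace $\hat U_p^k$ such that $$\hat U_p^k\equiv U_{p\infty}^k\quad\text{and}\quad(U_p^k/\hat U_p^k)^*\cong\ell_p.$$
   Context: Fix $d,k\in\mathbb N$, $1\le p<\infty$, $\frac1p+\frac1{p'}=1$, and let $Q^d:=[0,1]^d$. A cube is a closed cube in $\mathbb R^d$ homothetic to $Q^d$. A packing is a family of cubes with pairwise disjoint interiors; $\Pi$ is the set of finite packings consisting of cubes contained in $Q^d$. $\ell_p=\ell_p(Q^d)$ is the Banach space of functions $f:Q^d\to\mathbb R$ with $\|f\|_p:=(\sum_{x\in Q^d}|f(x)|^p)^{1/p}<\infty$. A $(k,p)$-atom is a function $a\in\ell_1=\ell_1(Q^d)$ that is supported by some cube $Q\subset Q^d$, satisfies $\|a\|_1\le1$ and $\sum_{x\in Q^d}x^\alpha a(x)=0$ for all $|\alpha|\le k-1$; it is denoted $a_Q$. A $(k,p)$-chain subordinate to a packing $\pi\in\Pi$ is a function $b_\pi=\sum_{Q\in\pi}c_Qa_Q$, with $c_Q\in\mathbb R$ and $a_Q$ a $(k,p)$-atom supported by $Q$; for such a representation $[b_\pi]_{p'}:=\|\{c_Q\}_{Q\in\pi}\|_{p'}=\big(\sum_{Q\in\pi}|c_Q|^{p'}\big)^{1/p'}$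 (the maximum if $p'=\infty$). $(U_p^k)^0$ is the linear hull of all $(k,p)$-atoms (equivalently, of all $(k,p)$-chains), with the seminorm $\|f\|_{U_p^k}:=\inf\sum_\pi[b_\pi]_{p'}$, the infimum over all presentations of $f$ as a finite sum $f=\sum_\pi b_\pi$ of $(k,p)$-chains. $U_p^k$ is the completion of $((U_p^k)^0,\|\cdot\|_{U_p^k})$. $U_{p\infty}^k$ is defined by the same construction with $\ell_1$ replaced by $L_1(Q^d)$: atoms are $a_Q\in L_1(Q^d)$ supported by a cube $Q\subset Q^d$ with $\int_{Q^d}|a_Q|\,dx\le1$ and $\int_{Q^d}x^\alpha a_Q\,dx=0$ for $|\alpha|\le k-1$. $\equiv$ denotes isometric linear isomorphism, $\cong$ linear isomorphism of Banach spaces (bounded in both directions). *)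

(* Defs.v *)
From HB Require Import structures.
From mathcomp Require Import all_boot all_order all_algebra.
From mathcomp Require Import all_classical all_reals all_analysis.

Set Implicit Arguments.
Unset Strict Implicit.
Unset Printing Implicit Defensive.
Import Order.TTheory GRing.Theory Num.Theory.
Import numFieldNormedType.Exports.
Local Open Scope classical_set_scope.
Local Open Scope ring_scope.

Record seminorm (R : realType) (V : lmodType R) := Seminorm {
  sn_val :> V -> R;
  sn_triangle : forall x y, sn_val (x + y) <= sn_val x + sn_val y;
  sn_homog : forall (a : R) x, sn_val (a *: x) = `|a| * sn_val x }.

Section SeminormTheory.
Context (R : realType) (V : lmodType R) (N : seminorm V).

Lemma sn0 : N 0 = 0.
Proof. by rewrite -(scale0r (0 : V)) sn_homog normr0 mul0r. Qed.

Lemma snN x : N (- x) = N x.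
Proof. by rewrite -scaleN1r sn_homog normrN1 mul1r. Qed.

Lemma snB x y : N (x - y) = N (y - x).
Proof. by rewrite -opprB snN. Qed.

Lemma sn_ge0 x : 0 <= N x.
Proof.
have := sn_triangle N x (- x).
by rewrite subrr sn0 snN -mulr2n pmulrn_lge0.
Qed.

Lemma sn_dist x y : `|N x - N y| <= N (x - y).
Proof.
rewrite ler_norml lerBlDr lerBrDl; apply/andP; split.
  have := sn_triangle N (y - x) x; rewrite subrK snB => h.
  by rewrite lerBlDr addrC.
by have := sn_triangle N (x - y) y; rewrite subrK.
Qed.

End SeminormTheory.

(* [sep N]: the normed space V / {x | N x = 0} *)
Section Separation.
Context (R : realType) (V : lmodType R) (N : seminorm V).

Definition sn_equiv (x y : V) : bool := N (x - y) == 0.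

Let sn_equiv_refl : reflexive sn_equiv.
Proof. by move=> x; rewrite /sn_equiv subrr sn0. Qed.

Let sn_equiv_sym : symmetric sn_equiv.
Proof. by move=> x y; rewrite /sn_equiv snB. Qed.

Let sn_equiv_trans : transitive sn_equiv.
Proof.
move=> y x z /eqP xy /eqP yz; rewrite /sn_equiv eq_le sn_ge0 andbT.
by rewrite -(subrKA y) (le_trans (sn_triangle _ _ _))// xy yz addr0.
Qed.

Canonical sn_equiv_equiv :=
  EquivRel sn_equiv sn_equiv_refl sn_equiv_sym sn_equiv_trans.

Local Open Scope quotient_scope.

Definition sep : Type := {eq_quot sn_equiv}.
HB.instance Definition _ := Choice.on sep.
HB.instance Definition _ := EqQuotient.on sep.

Definition to_sep (x : V) : sep := \pi_sep x.

Lemma to_sepP x y : to_sep x = to_sep y <-> N (x - y) = 0.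
Proof.
split=> [/eqP|xy]; first by rewrite /to_sep eqmodE => /eqP.
by apply/eqP; rewrite /to_sep eqmodE; exact/eqP.
Qed.

Lemma to_sepK (x : sep) : to_sep (repr x) = x.
Proof. exact: reprK. Qed.

Lemma repr_to_sep x : N (repr (to_sep x) - x) = 0.
Proof. by apply/to_sepP; rewrite to_sepK. Qed.

Let add (x y : sep) : sep := to_sep (repr x + repr y).
Let opp (x : sep) : sep := to_sep (- repr x).
Let scale (a : R) (x : sep) : sep := to_sep (a *: repr x).

Let addE x y : add (to_sep x) (to_sep y) = to_sep (x + y).
Proof.
apply/to_sepP/eqP; rewrite eq_le sn_ge0 andbT opprD addrACA.
by rewrite (le_trans (sn_triangle _ _ _))// !repr_to_sep addr0.
Qed.

Let oppE x : opp (to_sep x) = to_sep (- x).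
Proof. by apply/to_sepP; rewrite -opprD snN repr_to_sep. Qed.

Let scaleE a x : scale a (to_sep x) = to_sep (a *: x).
Proof. by apply/to_sepP; rewrite -scalerBr sn_homog repr_to_sep mulr0. Qed.

Let sepW (P : sep -> Prop) : (forall x, P (to_sep x)) -> forall x, P x.
Proof. by move=> h x; rewrite -(to_sepK x). Qed.

Let addA : associative add.
Proof. by elim/sepW=> x; elim/sepW=> y; elim/sepW=> z; rewrite !addE addrA. Qed.
Let addC : commutative add.
Proof. by elim/sepW=> x; elim/sepW=> y; rewrite !addE addrC. Qed.
Let add0 : left_id (to_sep 0) add.
Proof. by elim/sepW=> x; rewrite addE add0r. Qed.
Let addN : left_inverse (to_sep 0) opp add.
Proof. by elim/sepW=> x; rewrite oppE addE addNr. Qed.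

HB.instance Definition _ := GRing.isZmodule.Build sep addA addC add0 addN.

Let sepD x y : to_sep x + to_sep y = to_sep (x + y).
Proof. exact: addE. Qed.

Let scaleA a b x : scale a (scale b x) = scale (a * b) x.
Proof. by elim/sepW: x => x; rewrite !scaleE scalerA. Qed.
Let scale1 : left_id 1 scale.
Proof. by elim/sepW=> x; rewrite scaleE scale1r. Qed.
Let scaleDr : right_distributive scale +%R.
Proof. by move=> a; elim/sepW=> x; elim/sepW=> y; rewrite sepD !scaleE sepD scalerDr. Qed.
Let scaleDl x : {morph scale^~ x : a b / a + b}.
Proof. by move=> a b; elim/sepW: x => x; rewrite !scaleE sepD scalerDl. Qed.

HB.instance Definition _ :=
  GRing.Zmodule_isLmodule.Build R sep scaleA scale1 scaleDr scaleDl.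

Let norm (x : sep) : R := N (repr x).

Let normE x : norm (to_sep x) = N x.
Proof.
apply/eqP; rewrite -subr_eq0 -normr_le0.
by rewrite (le_trans (sn_dist _ _ _))// repr_to_sep.
Qed.

Let normD x y : norm (x + y) <= norm x + norm y.
Proof.
elim/sepW: x => x; elim/sepW: y => y.
by rewrite sepD !normE sn_triangle.
Qed.

Let normZ a x : norm (a *: x) = `|a| * norm x.
Proof.
elim/sepW: x => x; have -> : a *: to_sep x = to_sep (a *: x) by exact: scaleE.
by rewrite !normE sn_homog.
Qed.

Let norm_eq0 x : norm x = 0 -> x = 0.
Proof.
elim/sepW: x => x; rewrite normE => x0.
by apply/to_sepP; rewrite subr0.
Qed.

HB.instance Definition _ := Lmodule_isNormed.Build R sep normD normZ norm_eq0.

Lemma to_sep_is_linear : linear to_sep.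
Proof.
move=> a x y; have -> : a *: to_sep x = to_sep (a *: x) by exact: scaleE.
by rewrite sepD.
Qed.

HB.instance Definition _ :=
  GRing.isLinear.Build R V sep *:%R to_sep to_sep_is_linear.

Lemma norm_to_sep x : `|to_sep x| = N x.
Proof. exact: normE. Qed.

End Separation.

(* [completion N]: N-Cauchy sequences modulo the sequences u with
   N (u n) --> 0, normed by lim N (u n) *)
Section Completion.
Context (R : realType) (V : lmodType R) (N : seminorm V).

Definition is_cauchy_seq (u : nat -> V) : Prop :=
  forall e, 0 < e ->
    exists n0, forall m n, (n0 <= m)%N -> (n0 <= n)%N -> N (u m - u n) < e.

Definition cauchy_pred : {pred nat -> V} := mem [set u | is_cauchy_seq u].

Lemma cauchy_submod_closed : submod_closed cauchy_pred.
Proof.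
split.
  by rewrite inE/= => e e0; exists 0%N => m n _ _; rewrite subrr sn0.
move=> a u v; rewrite !inE/= => cu cv e e0.
have a1 : 0 < `|a| + 1 by rewrite ltr_wpDl.
have e20 : 0 < e / 2 by rewrite divr_gt0.
have [n1 h1] := cu (e / 2 / (`|a| + 1)) (divr_gt0 e20 a1).
have [n2 h2] := cv (e / 2) e20.
exists (maxn n1 n2) => m n; rewrite !geq_max => /andP[m1 m2] /andP[k1 k2].
have -> : (a *: u + v) m - (a *: u + v) n = a *: (u m - u n) + (v m - v n).
  by rewrite scalerBr opprD addrACA.
rewrite (le_lt_trans (sn_triangle _ _ _))// sn_homog [ltRHS]splitr ltr_leD//.
  have := h1 _ _ m1 k1; rewrite ltr_pdivlMr// => h.
  rewrite (le_lt_trans _ h)// mulrC ler_wpM2l ?sn_ge0//.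
  by rewrite lerDl.
exact/ltW/h2.
Qed.

HB.instance Definition _ :=
  GRing.isSubmodClosed.Build R (nat -> V) cauchy_pred cauchy_submod_closed.

Definition cauchy_seq := {u : nat -> V | u \in cauchy_pred}.
HB.instance Definition _ := SubType.on cauchy_seq.
HB.instance Definition _ := Choice.on cauchy_seq.
HB.instance Definition _ := [SubChoice_isSubLmodule of cauchy_seq by <:].

Definition cauchy_norm (u : cauchy_seq) : R := limn (N \o val u).

Let cauchy_bound (u : cauchy_seq) : is_cauchy_seq (val u).
Proof. by have := valP u; rewrite inE. Qed.

Lemma cvg_cauchy_norm (u : cauchy_seq) :
  N (val u n) @[n --> \oo] --> cauchy_norm u.
Proof.
apply/cauchy_cvgP/cauchy_exP => e e0.
have [n0 h] := cauchy_bound u e0.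
exists (N (val u n0)); exists n0 => // n /= nn0.
by rewrite /ball/= (le_lt_trans (sn_dist _ _ _))// h.
Qed.

Let cauchy_normD u v : cauchy_norm (u + v) <= cauchy_norm u + cauchy_norm v.
Proof.
have h : N (val u n) + N (val v n) @[n --> \oo] --> cauchy_norm u + cauchy_norm v.
  by apply: cvgD; exact: cvg_cauchy_norm.
rewrite -(cvg_lim (@Rhausdorff R) h); apply: ler_lim.
- by apply/cvg_ex; eexists; exact: cvg_cauchy_norm.
- by apply/cvg_ex; eexists; exact: h.
- by apply: nearW => n; rewrite /= sn_triangle.
Qed.

Let cauchy_normZ (a : R) u : cauchy_norm (a *: u) = `|a| * cauchy_norm u.
Proof.
apply/cvg_lim => //.
have -> : N \o val (a *: u) = (fun n => `|a| * N (val u n)).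
  by apply/funext => n /=; rewrite sn_homog.
by apply: cvgMr; exact: cvg_cauchy_norm.
Qed.

Definition cauchy_seminorm := Seminorm cauchy_normD cauchy_normZ.

Definition completion : Type := sep cauchy_seminorm.
HB.instance Definition _ := NormedModule.on completion.

Let cst_cauchy (x : V) : (fun=> x : V) \in cauchy_pred.
Proof. by rewrite inE/= => e e0; exists 0%N => m n _ _; rewrite subrr sn0. Qed.

Definition to_completion (x : V) : completion :=
  to_sep cauchy_seminorm (exist _ (fun=> x) (cst_cauchy x)).

Lemma norm_to_completion x : `|to_completion x| = N x.
Proof.
rewrite [LHS]norm_to_sep; apply: (cvg_lim (@Rhausdorff R)).
exact: (@cvg_cst _ (N x)).
Qed.

End Completion.

Section Cubes.
Context (R : realType) (d : nat).

Definition unit_cube : set 'rV[R]_d := [set x : 'rV[R]_d | forall i, 0 <= x 0 i <= 1].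

Definition cube (Q : set 'rV[R]_d) : Prop :=
  exists (x : 'rV[R]_d) (r : R), 0 < r /\ Q = [set y : 'rV[R]_d | forall i, x 0 i <= y 0 i <= x 0 i + r].

Definition packing n (Q : 'I_n -> set 'rV[R]_d) : Prop :=
  (forall i, cube (Q i) /\ Q i `<=` unit_cube) /\
  trivIset setT (fun i => (Q i)°).

End Cubes.

Arguments unit_cube : clear implicits.

(* l^q norm for q in [1, +oo]; below q is [hoelder_conjugate p%:E], which is
   +oo for p = 1 *)
Definition lqnorm (R : realType) (q : \bar R) n (c : 'I_n -> R) : R :=
  if q is r%:E then (\sum_i `|c i| `^ r) `^ r^-1
  else \big[Num.max/0]_i `|c i|.

(* The atomic construction, in a vector space [E], from a family of sets
   [atom Q] of atoms supported by the cube [Q]. *)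
Section AtomicSpace.
Context (R : realType) (d : nat) (p : R) (E : lmodType R).
Variable atom : set 'rV[R]_d -> set E.

(* [b] has a representation as a chain with [b]_{p'} = w *)
Definition chain_repr (b : E) (w : R) : Prop :=
  exists n (Q : 'I_n -> set 'rV[R]_d) (c : 'I_n -> R) (a : 'I_n -> E),
    [/\ packing Q, forall i, atom (Q i) (a i), b = \sum_i c i *: a i
      & w = lqnorm (hoelder_conjugate p%:E) c].

Definition is_atom : set E :=
  [set a | exists Q, [/\ cube Q, Q `<=` unit_cube R d & atom Q a]].

Definition hull_pred : {pred E} :=
  mem [set f | exists n (c : 'I_n -> R) (a : 'I_n -> E),
    (forall i, is_atom (a i)) /\ f = \sum_i c i *: a i].

Lemma hull_submod_closed : submod_closed hull_pred.
Proof.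
split.
  rewrite inE/=; exists 0%N, (fun=> 0), (fun=> 0).
  by split=> [[]//|]; rewrite big_ord0.
move=> t f g; rewrite !inE/= => -[n [c [a [Ha ->]]]] [m [c' [a' [Ha' ->]]]].
exists (n + m)%N,
  (fun i => match fintype.split i with inl j => t * c j | inr j => c' j end),
  (fun i => match fintype.split i with inl j => a j | inr j => a' j end).
split=> [i|]; first by case: (fintype.split i).
rewrite big_split_ord/= scaler_sumr; congr (_ + _); apply: eq_bigr => i _.
  by rewrite (unsplitK (inl i)) scalerA.
by rewrite (unsplitK (inr i)).
Qed.

HB.instance Definition _ :=
  GRing.isSubmodClosed.Build R E hull_pred hull_submod_closed.

Definition hull := {f : E | f \in hull_pred}.
HB.instance Definition _ := SubType.on hull.
HB.instance Definition _ := Choice.on hull.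
HB.instance Definition _ := [SubChoice_isSubLmodule of hull by <:].

Definition presentation (f : E) : set R :=
  [set s | exists m (b : 'I_m -> E) (w : 'I_m -> R),
    [/\ forall i, chain_repr (b i) (w i), f = \sum_i b i & s = \sum_i w i]].

Definition atomic_norm (f : hull) : R := inf (presentation (val f)).

Section AtomicNormTheory.
Hypothesis p1 : 1 <= p.

Let conj_cases : let q := hoelder_conjugate p%:E in
  q = +oo%E \/ exists2 r, q = r%:E & 0 < r.
Proof.
rewrite /hoelder_conjugate /= eqe (gt_eqF (lt_le_trans ltr01 p1)).
have [->|pn1] := eqVneq p 1; first by left; rewrite EFinN subee// inve0 mul1e.
right; exists (p / (p - 1)).
  by rewrite -EFinD inver subr_eq0 (negbTE pn1).
apply: divr_gt0; first exact: lt_le_trans ltr01 p1.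
by rewrite subr_gt0 lt_neqAle eq_sym pn1.
Qed.

Let lqnorm_ge0 q n (c : 'I_n -> R) : 0 <= lqnorm q c.
Proof.
case: q => [r||] /=; first exact: powR_ge0.
- by elim/big_ind: _ => // x y x0 y0; rewrite le_max x0.
- by elim/big_ind: _ => // x y x0 y0; rewrite le_max x0.
Qed.

Let lqnormZ n t (c : 'I_n -> R) :
  lqnorm (hoelder_conjugate p%:E) (fun i => t * c i) =
  `|t| * lqnorm (hoelder_conjugate p%:E) c.
Proof.
case: conj_cases => /= [->|[r -> r0]] /=.
  elim/big_rec2: _ => [|i x y _ ->]; first by rewrite mulr0.
  by rewrite maxr_pMr// normrM.
under eq_bigr do rewrite normrM powRM//.
rewrite -mulr_sumr powRM ?powR_ge0//; last first.
  by apply: sumr_ge0 => i _; exact: powR_ge0.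
by rewrite -powRrM mulfV ?gt_eqF// powRr1.
Qed.

Let chain_ge0 b w : chain_repr b w -> 0 <= w.
Proof. by move=> [n [Q [c [a [_ _ _ ->]]]]]; exact: lqnorm_ge0. Qed.

Let chainZ t b w : chain_repr b w -> chain_repr (t *: b) (`|t| * w).
Proof.
move=> [n [Q [c [a [pQ aQ -> ->]]]]]; exists n, Q, (fun i => t * c i), a.
split=> //.
by rewrite scaler_sumr; apply: eq_bigr => i _; rewrite scalerA.
Qed.

Let presentation_ge0 f s : presentation f s -> 0 <= s.
Proof.
move=> [m [b [w [bw _ ->]]]]; apply: sumr_ge0 => i _.
exact: chain_ge0 (bw i).
Qed.

Let presentation_lb f : has_lbound (presentation f).
Proof. by exists 0 => s; exact: presentation_ge0. Qed.

Let presentationD f g s t :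
  presentation f s -> presentation g t -> presentation (f + g) (s + t).
Proof.
move=> [n [b [w [bw -> ->]]]] [m [b' [w' [bw' -> ->]]]].
exists (n + m)%N,
  (fun i => match fintype.split i with inl j => b j | inr j => b' j end),
  (fun i => match fintype.split i with inl j => w j | inr j => w' j end).
split=> [i||]; first by case: (fintype.split i).
- by rewrite big_split_ord/=; congr (_ + _); apply: eq_bigr => i _;
    rewrite ?(unsplitK (inl i)) ?(unsplitK (inr i)).
- by rewrite big_split_ord/=; congr (_ + _); apply: eq_bigr => i _;
    rewrite ?(unsplitK (inl i)) ?(unsplitK (inr i)).
Qed.

Let presentationZ t f s :
  presentation f s -> presentation (t *: f) (`|t| * s).
Proof.
move=> [n [b [w [bw -> ->]]]].
exists n, (fun i => t *: b i), (fun i => `|t| * w i).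
by split; [move=> i; exact: chainZ | rewrite scaler_sumr | rewrite mulr_sumr].
Qed.

Let presentation_n0 (f : hull) : presentation (val f) !=set0.
Proof.
have := valP f; rewrite inE/= => -[n [c [a [aa ->]]]].
exists (\sum_i lqnorm (hoelder_conjugate p%:E) (fun _ : 'I_1 => c i)).
exists n, (fun i => c i *: a i),
  (fun i => lqnorm (hoelder_conjugate p%:E) (fun _ : 'I_1 => c i)).
split=> // i; have [Q [cQ Q1 aQ]] := aa i.
exists 1%N, (fun=> Q), (fun=> c i), (fun=> a i); split=> //.
- by split=> // j k _ _ _; rewrite (ord1 j) (ord1 k).
- by rewrite big_ord1.
Qed.

Let presentation_inf (f : hull) : has_inf (presentation (val f)).
Proof. by split; [exact: presentation_n0 | exact: presentation_lb]. Qed.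

Let atomic_normD f g : atomic_norm (f + g) <= atomic_norm f + atomic_norm g.
Proof.
apply/ler_addgt0Pr => e e0.
have e20 : 0 < e / 2 by rewrite divr_gt0.
have [s fs sl] := inf_adherent e20 (presentation_inf f).
have [t gt tl] := inf_adherent e20 (presentation_inf g).
rewrite (@le_trans _ _ (s + t))//.
  by apply: ge_inf => //; exact: presentationD.
rewrite [e in leRHS]splitr addrACA.
by rewrite lerD// ltW.
Qed.

Let atomic_normZ_le t f : atomic_norm (t *: f) <= `|t| * atomic_norm f.
Proof.
apply/ler_addgt0Pr => e e0.
have t1 : 0 < `|t| + 1 by rewrite ltr_wpDl.
have [s fs sl] := inf_adherent (divr_gt0 e0 t1) (presentation_inf f).
rewrite (@le_trans _ _ (`|t| * s))//.
  by apply: ge_inf => //; exact: presentationZ.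
rewrite (@le_trans _ _ (`|t| * (atomic_norm f + e / (`|t| + 1))))//.
  by rewrite ler_wpM2l// ltW.
rewrite mulrDr lerD2l mulrCA ler_piMr ?ltW//.
by rewrite ltr_pdivrMr// mul1r ltrDl.
Qed.

Let atomic_normZ t f : atomic_norm (t *: f) = `|t| * atomic_norm f.
Proof.
apply/eqP; rewrite eq_le atomic_normZ_le/=.
have [->|t0] := eqVneq t 0.
  rewrite normr0 mul0r; apply: lb_le_inf; first exact: presentation_n0.
  by move=> s; exact: presentation_ge0.
have := atomic_normZ_le t^-1 (t *: f).
rewrite scalerA mulVf// scale1r normfV mulrC.
by rewrite ler_pdivlMr ?normr_gt0// mulrC.
Qed.

Definition atomic_seminorm := Seminorm atomic_normD atomic_normZ.

End AtomicNormTheory.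

End AtomicSpace.

Record closed_subspace (R : realType) (X : normedModType R) := ClosedSubspace {
  cs_val :> set X;
  cs0 : cs_val 0;
  cs_linear : forall (a : R) x y,
    cs_val x -> cs_val y -> cs_val (a *: x + y);
  cs_closed : closed cs_val }.

(* The quotient norm: dist_to W vanishes exactly on the closed subspace W, so
   that [quotient W] is X / W. *)
Section Quotient.
Context (R : realType) (X : normedModType R) (W : closed_subspace X).

Definition dist_to (x : X) : R := inf [set `|x - w| | w in W].

Let dist_lb x : lbound [set `|x - w| | w in W] 0.
Proof. by move=> _ [w _ <-]. Qed.

Let dist_has_inf x : has_inf [set `|x - w| | w in W].
Proof.
split; last by exists 0; exact: dist_lb.
by exists `|x - 0|; exists 0 => //; exact: cs0.
Qed.

Let dist_le x w : cs_val W w -> dist_to x <= `|x - w|.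
Proof. by move=> Ww; apply: ge_inf; [exists 0; exact: dist_lb | exists w]. Qed.

Let dist_adherent x e : 0 < e -> exists2 w, cs_val W w & `|x - w| < dist_to x + e.
Proof.
by move=> /inf_adherent/(_ (dist_has_inf x))[_ [w Ww <-] h]; exists w.
Qed.

Let distD x y : dist_to (x + y) <= dist_to x + dist_to y.
Proof.
apply/ler_addgt0Pr => e e0.
have e20 : 0 < e / 2 by rewrite divr_gt0.
have [v Wv hv] := dist_adherent x e20.
have [w Ww hw] := dist_adherent y e20.
have Wvw : cs_val W (v + w) by rewrite -(scale1r v); exact: cs_linear.
rewrite (le_trans (dist_le _ Wvw))// opprD addrACA.
rewrite (le_trans (ler_normD _ _))// [e in leRHS]splitr addrACA.
by rewrite lerD// ltW.
Qed.

Let distZ_le (a : R) x : dist_to (a *: x) <= `|a| * dist_to x.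
Proof.
apply/ler_addgt0Pr => e e0.
have a1 : 0 < `|a| + 1 by rewrite ltr_wpDl.
have [w Ww hw] := dist_adherent x (divr_gt0 e0 a1).
have Waw : cs_val W (a *: w).
  by rewrite -[a *: w]addr0; apply: cs_linear => //; exact: cs0.
rewrite (le_trans (dist_le _ Waw))// -scalerBr normrZ.
rewrite (@le_trans _ _ (`|a| * (dist_to x + e / (`|a| + 1))))//.
  by rewrite ler_wpM2l// ltW.
rewrite mulrDr lerD2l mulrCA ler_piMr ?ltW//.
by rewrite ltr_pdivrMr// mul1r ltrDl.
Qed.

Let distZ (a : R) x : dist_to (a *: x) = `|a| * dist_to x.
Proof.
apply/eqP; rewrite eq_le distZ_le/=.
have [->|a0] := eqVneq a 0.
  rewrite normr0 mul0r; apply: lb_le_inf; last exact: dist_lb.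
  by case: (dist_has_inf (0 *: x)).
have := distZ_le a^-1 (a *: x).
rewrite scalerA mulVf// scale1r normfV mulrC.
by rewrite ler_pdivlMr ?normr_gt0// mulrC.
Qed.

Definition quotient_seminorm := Seminorm distD distZ.

Definition quotient : Type := sep quotient_seminorm.
HB.instance Definition _ := NormedModule.on quotient.

End Quotient.

Section Dual.
Context (R : realType) (X : normedModType R).

Definition dual_pred : {pred X -> R} :=
  mem [set f : X -> R | linear f /\ continuous f].

Lemma dual_submod_closed : submod_closed dual_pred.
Proof.
split.
  rewrite inE/=; split; last exact: cst_continuous.
  by move=> a x y /=; rewrite scaler0 addr0.
move=> a f g; rewrite !inE/= => -[lf cf] [lg cg]; split.
  move=> b x y /=.
  rewrite !fctE lf lg !scalerDr addrACA; congr (_ + _); congr (_ + _).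
  by rewrite !scalerA mulrC.
move=> x; apply: cvgD; last exact: cg.
by apply: cvgZr; exact: cf.
Qed.

HB.instance Definition _ :=
  GRing.isSubmodClosed.Build R (X -> R) dual_pred dual_submod_closed.

Definition dual := {f : X -> R | f \in dual_pred}.
HB.instance Definition _ := SubType.on dual.
HB.instance Definition _ := Choice.on dual.
HB.instance Definition _ := [SubChoice_isSubLmodule of dual by <:].

Let unit_image (f : X -> R) : set R :=
  [set `|f x| | x in [set x : X | `|x| <= 1]].

Definition dual_norm (f : dual) : R := sup (unit_image (val f)).

Let dual_linear (f : dual) : linear (val f).
Proof. by have := valP f; rewrite inE => -[]. Qed.

Let dual_continuous (f : dual) : continuous (val f).
Proof. by have := valP f; rewrite inE => -[]. Qed.

Let dual_has_sup (f : dual) : has_sup (unit_image (val f)).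
Proof.
split.
  by exists `|val f 0|; exists 0 => //=; rewrite normr0.
pose g := GRing.isLinear.Build R X R *:%R (val f) (dual_linear f).
pose h : {linear X -> R} := HB.pack (val f) g.
have /linear_boundedP[M [_ /(_ (`|M| + 1))]] :=
  @continuous_linear_bounded _ _ _ 0 h (@dual_continuous f 0).
rewrite (le_lt_trans (ler_norm M)) ?ltrDl// => /(_ isT) hM.
exists (`|M| + 1) => _ [x /= x1 <-].
by rewrite (le_trans (hM x))// ler_piMr// addr_ge0.
Qed.

Let dual_normD f g : dual_norm (f + g) <= dual_norm f + dual_norm g.
Proof.
apply: ge_sup; first by case: (dual_has_sup (f + g)).
move=> _ [x x1 <-]; rewrite (le_trans (ler_normD _ _))//.
by apply: lerD; apply: ub_le_sup;
  [case: (dual_has_sup f)|exists x|case: (dual_has_sup g)|exists x].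
Qed.

Let dual_normZ_le (a : R) f : dual_norm (a *: f) <= `|a| * dual_norm f.
Proof.
apply: ge_sup; first by case: (dual_has_sup (a *: f)).
move=> _ [x x1 <-] /=; rewrite normrM ler_wpM2l//.
by apply: ub_le_sup; [case: (dual_has_sup f)|exists x].
Qed.

Let dual_norm0_eq0 f : dual_norm f = 0 -> f = 0.
Proof.
move=> f0; apply/val_inj/funext => x /=.
have vZ (a : R) y : val f (a *: y) = a * val f y.
  have := dual_linear f a y 0; rewrite addr0 => ->.
  have := dual_linear f 1 0 0; rewrite !scale1r addr0 => /eqP.
  by rewrite -subr_eq0 opprD addNKr oppr_eq0 => /eqP ->; rewrite addr0.
have [->|x0] := eqVneq x 0; first by rewrite -(scale0r (0 : X)) vZ mul0r.
have nx : `|x| != 0 by rewrite normr_eq0.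
have : `|val f (`|x|^-1 *: x)| <= 0.
  rewrite -f0; apply: ub_le_sup; first by case: (dual_has_sup f).
  by exists (`|x|^-1 *: x) => //=; rewrite normrZ normfV normr_id mulVf.
by rewrite vZ normr_le0 mulf_eq0 invr_eq0 (negbTE nx) => /eqP.
Qed.

Let dual_normZ (a : R) f : dual_norm (a *: f) = `|a| * dual_norm f.
Proof.
apply/eqP; rewrite eq_le dual_normZ_le/=.
have [->|a0] := eqVneq a 0.
  rewrite normr0 mul0r (@le_trans _ _ `|val (0 *: f : dual) 0|)//.
  apply: ub_le_sup; first by case: (dual_has_sup (0 *: f)).
  by exists 0 => //=; rewrite normr0.
have := dual_normZ_le a^-1 (a *: f).
rewrite scalerA mulVf// scale1r normfV mulrC.
by rewrite ler_pdivlMr ?normr_gt0// mulrC.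
Qed.

HB.instance Definition _ :=
  Lmodule_isNormed.Build R dual dual_normD dual_normZ dual_norm0_eq0.

End Dual.

(* Borel sets of R^n: the sigma-algebra generated by the coordinates *)
Section MeasurableRow.
Context (R : realType) (n : nat).

Let coord : 'I_n -> 'rV[R]_n -> R := fun i x => x 0 i.

Let row_set0 : g_sigma_preimage coord set0.
Proof. exact: sigma_algebra0. Qed.

Let row_setC A : g_sigma_preimage coord A -> g_sigma_preimage coord (~` A).
Proof. exact: sigma_algebraC. Qed.

Let row_bigcup (F : _^nat) : (forall i, g_sigma_preimage coord (F i)) ->
  g_sigma_preimage coord (\bigcup_i (F i)).
Proof. exact: sigma_algebra_bigcup. Qed.

HB.instance Definition _ := @isMeasurable.Build default_measure_display
  'rV[R]_n (g_sigma_preimage coord) row_set0 row_setC row_bigcup.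

Lemma measurable_coord (i : 'I_n) :
  measurable_fun [set: 'rV[R]_n] (fun x : 'rV[R]_n => x 0 i).
Proof.
move=> _ Y mY; rewrite setTI; apply: sub_sigma_algebra => /=.
rewrite -bigcup_seq/=; exists i => /=; first by rewrite mem_index_enum.
by exists Y => //; rewrite setTI.
Qed.

Lemma measurable_fun_rowP d (T : measurableType d) (f : T -> 'rV[R]_n) :
  (forall i, measurable_fun [set: T] (fun x => f x 0 i)) ->
  measurable_fun [set: T] f.
Proof.
move=> mf.
suff : g_sigma_preimage (fun i => coord i \o f) `<=` measurable.
  rewrite g_sigma_preimage_comp => h _ A mA.
  by apply: h; exists A.
apply: smallest_sub; first exact: sigma_algebra_measurable.
rewrite -bigcup_seq/= => A [i _ [B mB <-]].
exact: mf.
Qed.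

End MeasurableRow.

Lemma product_sigma_finite (R : realType) d1 d2 (T1 : measurableType d1)
    (T2 : measurableType d2) (m1 : {sigma_finite_measure set T1 -> \bar R})
    (m2 : {sigma_finite_measure set T2 -> \bar R}) :
  sigma_finite [set: T1 * T2] (m1 \x m2)%E.
Proof.
have /sigma_finiteP[F [TF ndF Foo]] := sigma_finiteT m1.
have /sigma_finiteP[G [TG ndG Goo]] := sigma_finiteT m2.
exists (fun n => F n `*` G n).
  rewrite -setXTT TF TG predeqE => -[x y]; split.
    move=> [/= [n _ Fnx] [k _ Gky]]; exists (maxn n k) => //; split.
    - by move: x Fnx; exact/subsetPset/ndF/leq_maxl.
    - by move: y Gky; exact/subsetPset/ndG/leq_maxr.
  by move=> [n _ []/= ? ?]; split; exists n.
move=> k; have [? ?] := Foo k; have [? ?] := Goo k.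
split; first exact: measurableX.
by rewrite product_measure1E// lte_mul_pinfty// ge0_fin_numE.
Qed.

(* Lebesgue measure on R^n, as an iterated product *)
Section LebesgueRow.
Context (R : realType).

Definition row_cons n (x : measurableTypeR R * 'rV[R]_n) : 'rV[R]_n.+1 :=
  \row_i oapp (fun j => x.2 0 j) x.1 (unlift ord0 i).

Lemma measurable_row_cons n : measurable_fun setT (@row_cons n).
Proof.
apply: measurable_fun_rowP => i.
case: (unliftP ord0 i) => [j ->|->].
  rewrite (_ : (fun _ => _) = (fun y : 'rV[R]_n => y 0 j) \o snd).
    by apply: measurableT_comp; [exact: measurable_coord|exact: measurable_snd].
  by apply/funext => x /=; rewrite mxE liftK.
rewrite (_ : (fun _ => _) = fst); first exact: measurable_fst.
by apply/funext => x /=; rewrite mxE unlift_none.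
Qed.

Definition row_uncons n (x : 'rV[R]_n.+1)  : measurableTypeR R * 'rV[R]_n :=
  (x 0 ord0, \row_j x 0 (lift ord0 j)).

Lemma measurable_row_uncons n : measurable_fun setT (@row_uncons n).
Proof.
apply/measurable_fun_pairP; split; first exact: measurable_coord.
apply: measurable_fun_rowP => i.
rewrite (_ : (fun _ => _) = (fun x : 'rV[R]_n.+1 => x 0 (lift ord0 i))).
  exact: measurable_coord.
by apply/funext => x /=; rewrite mxE.
Qed.

Lemma row_consK n : cancel (@row_cons n) (@row_uncons n).
Proof.
move=> [a x]; rewrite /row_uncons mxE unlift_none; congr pair.
by apply/rowP => j; rewrite !mxE liftK.
Qed.

Section Step.
Context (n : nat) (mu : {sigma_finite_measure set 'rV[R]_n -> \bar R}).

Definition lebesgue_step : set 'rV[R]_n.+1 -> \bar R :=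
  pushforward (@lebesgue_measure R \x mu)%E (@row_cons n).

HB.instance Definition _ := Measure.copy lebesgue_step
  (measure_function_pushforward__canonical__measure_function_Measure
    (@lebesgue_measure R \x mu)%E (@measurable_row_cons n)).

Let lebesgue_step_sigma_finite : sigma_finite setT lebesgue_step.
Proof.
have [F FT Foo] := product_sigma_finite (@lebesgue_measure R) mu.
exists (fun k => @row_uncons n @^-1` F k).
  by rewrite -preimage_bigcup -FT preimage_setT.
move=> k; have [mF Fk] := Foo k; split.
  by rewrite -[X in measurable X]setTI; exact: measurable_row_uncons.
rewrite /lebesgue_step /pushforward -comp_preimage.
by rewrite (_ : _ \o _ = id)//; apply/funext => x; exact: row_consK.
Qed.

HB.instance Definition _ :=
  Measure_isSigmaFinite.Build _ _ _ lebesgue_step lebesgue_step_sigma_finite.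

End Step.

Let dirac0_sigma_finite : sigma_finite setT (\d_(0 : 'rV[R]_0) : set _ -> \bar R).
Proof.
apply: fin_num_fun_sigma_finite; first by rewrite measure0.
exact: fin_num_measure.
Qed.

Fixpoint lebesgue n : {sigma_finite_measure set 'rV[R]_n -> \bar R} :=
  if n is m.+1 then lebesgue_step (lebesgue m) else \d_(0 : 'rV[R]_0).

End LebesgueRow.

Section LOne.
Context (R : realType) (d : nat).

Lemma measurable_unit_cube : measurable (unit_cube R d).
Proof.
have -> : unit_cube R d =
    \bigcap_(i in [set: 'I_d]) [set x : 'rV[R]_d | x 0 i \in `[0, 1]].
  apply/seteqP; split=> x /= h i; first by move=> _; have := h i; rewrite ?in_itv.
  by have /= := h i I; rewrite ?in_itv.
apply: fin_bigcap_measurable => // i _.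
rewrite (_ : [set x | _] = (fun x : 'rV[R]_d => x 0 i) @^-1` `[0, 1]%classic)//.
rewrite -[X in measurable X]setTI; apply: measurable_coord => //.
Qed.

(* Lebesgue measure on the unit cube, as a measure on R^d *)
Definition cube_measure : {measure set 'rV[R]_d -> \bar R} :=
  mrestr (lebesgue R d) measurable_unit_cube.

Local Notation Lfun1 := (LfunType cube_measure (lexx 1%E)).

Let L1_norm (f : Lfun1) : R := fine ('N[cube_measure]_1[EFin \o f])%E.

Let L1_normD f g : L1_norm (f + g) <= L1_norm f + L1_norm g.
Proof. exact: ler_LnormD. Qed.

Let L1_normZ (a : R) f : L1_norm (a *: f) = `|a| * L1_norm f.
Proof.
apply: EFin_inj; rewrite finite_norm_fine EFinM finite_norm_fine.
exact: LnormZ.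
Qed.

Definition L1_seminorm := Seminorm L1_normD L1_normZ.

(* L_1(Q^d): integrable functions modulo equality almost everywhere *)
Definition L1 : Type := sep L1_seminorm.
HB.instance Definition _ := NormedModule.on L1.

Definition monomial (alpha : 'I_d -> nat) (x : 'rV[R]_d) : R :=
  \prod_i x 0 i ^+ alpha i.

(* a representative; [L1_atom] depends only on its a.e. class *)
Definition L1_fun (a : L1) : 'rV[R]_d -> R := repr a.

Definition L1_atom (k : nat) (Q : set 'rV[R]_d) : set L1 :=
  [set a : L1 |
    [/\ {ae cube_measure, forall x, ~ Q x -> L1_fun a x = 0},
        `|a| <= 1 &
        forall alpha : 'I_d -> nat, (\sum_i alpha i < k)%N ->
          \int[cube_measure]_x (monomial alpha x * L1_fun a x) = 0]].

End LOne.

Section EllOne.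
Context (R : realType) (d : nat).

Definition lp_mass (p : R) (f : unit_cube R d -> R) : \bar R :=
  (\esum_(x in [set: unit_cube R d]) (`|f x| `^ p)%:E)%E.

Definition lp_norm (p : R) (f : unit_cube R d -> R) : R :=
  fine (lp_mass p f) `^ p^-1.

Definition lp (p : R) : set (unit_cube R d -> R) :=
  [set f | (lp_mass p f < +oo)%E].

(* sum of an absolutely summable family *)
Definition lsum (f : unit_cube R d -> R) : R :=
  fine (\esum_(x in [set: unit_cube R d]) ((EFin \o f)^\+ x))%E -
  fine (\esum_(x in [set: unit_cube R d]) ((EFin \o f)^\- x))%E.

Definition l1_atom (k : nat) (Q : set 'rV[R]_d) : set (unit_cube R d -> R) :=
  [set a |
    [/\ lp 1 a,
        forall x : unit_cube R d, ~ Q (set_val x) -> a x = 0,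
        lp_norm 1 a <= 1 &
        forall alpha : 'I_d -> nat, (\sum_i alpha i < k)%N ->
          lsum (fun x => monomial alpha (set_val x) * a x) = 0]].

End EllOne.

Section Spaces.
Context (R : realType) (d k : nat) (p : R) (p1 : 1 <= p).

Definition U0 := hull (@l1_atom R d k).
Definition U0_norm : seminorm U0 := atomic_seminorm (@l1_atom R d k) p1.
Definition U : normedModType R := completion U0_norm.

Definition Uinf : normedModType R :=
  completion (atomic_seminorm (@L1_atom R d k) p1).

Definition unit_chains : set U0 :=
  [set b | exists2 w, chain_repr p (@l1_atom R d k) (val b) w & w <= 1].

End Spaces.

Arguments U0 : clear implicits.
Arguments U0_norm {R} d k {p} p1.
Arguments U {R} d k {p} p1.
Arguments Uinf {R} d k {p} p1.
Arguments unit_chains {R} d k p.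

Definition convex_hull (R : realType) (V : lmodType R) (A : set V) : set V :=
  [set x | exists n (t : 'I_n -> R) (a : 'I_n -> V),
    [/\ forall i, 0 <= t i /\ A (a i), \sum_i t i = 1
      & x = \sum_i t i *: a i]].

Definition sym_convex_hull (R : realType) (V : lmodType R) (A : set V) :
  set V := convex_hull (A `|` [set - x | x in A]).

Definition separable (T : topologicalType) (A : set T) : Prop :=
  exists D : set T, [/\ countable D, D `<=` A & A `<=` closure D].

Definition isometric_onto (R : realType) (X Y : normedModType R) (W : set Y) :
  Prop := exists f : {linear X -> Y}, (forall x, `|f x| = `|x|) /\ range f = W.

(* linear isomorphism, bounded in both directions, of X onto l_p(Q^d) *)
Definition isomorphic_lp (R : realType) (d : nat) (p : R)
    (X : normedModType R) : Prop :=
  exists T : {linear X -> (unit_cube R d -> R)}, range T = lp p /\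
    exists c C : R, 0 < c /\
      forall x, c * `|x| <= lp_norm p (T x) <= C * `|x|.

(* Main.v *)
Require Import Defs.
From HB Require Import structures.
From mathcomp Require Import all_boot all_order all_algebra.
From mathcomp Require Import all_classical all_reals all_analysis.
From mathcomp Require Import measurable_realfun ring lra.

(* For a density [a] in L_1, placing the mass of each cell of a fine grid at a
   node of the cell gives sums of point masses. Two such discretisations differ by
   a chain over a coarse grid, up to small moment corrections, and the coefficients
   of this chain are at most the masses of the coarse cells; since p' > 1, its
   norm is small. Hence the discretisations converge in U_p^k, to [Jt a]. On
   functions with vanishing moments, [Jt] does not increase the atomic norm, since
   the discretisation respects supports, nor does it decrease it: smearing the
   point masses into small boxes gives back the averages of [a]. So [Jt] extends
   to an isometry of U_{p infinity}^k onto a closed separable subspace W.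

   A functional on U_p^k that vanishes on W is determined by its values phi(x) on
   point masses compensated by densities with the same moments. A point lies in at
   most 2^d cubes of a packing, so Hoelder's inequality bounds the functional by
   2^(d/p) times the l_p norm of phi; conversely, concentrating the densities near
   finitely many points gives a chain over disjoint cubes, which bounds the l_p norm
   of phi. Every phi in l_p occurs, because the sums of phi against discretisations
   tend to 0. Nonseparability and the norm property follow by taking for phi the
   indicators of single points. *)

Set Implicit Arguments.
Unset Strict Implicit.
Unset Printing Implicit Defensive.
Import Order.TTheory GRing.Theory Num.Theory.
Import numFieldNormedType.Exports.
Local Open Scope classical_set_scope.
Local Open Scope ring_scope.

(** * Completions *)

(** The estimates depend on an order of choices. Repairing moments inside a cube costs a constant
    that may blow up as the cube shrinks. So a coarse grid is fixed first, with cell masses already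
    small; its finitely many correction constants then dictate how fine the discretisation must be.
    Dyadic grids make the fine cells nest in the coarse ones.

    Smearing meets another obstacle: boxes of one fixed side do not fit into small cubes of a chain,
    yet the side may not depend on the chain if the result is to be compared with averages of [a].
    Shrinking everything by [1 - h] frees a margin in which boxes of side [h / L] are translated;
    each translate stays a chain, and the average over translates is the smearing at side [h].
    Moments of degree below [k] stay zero under affine changes of variable, so only truncation to
    finitely many points has to be repaired.

    Thus [Jt] and the point masses are treated separately, although only differences with matching
    moments are independent of [kap]. *)

Section CompletionTheory.
Context (R : realType) (V : lmodType R) (N : seminorm V).

Lemma cauchy_seqP (u : cauchy_seq N) : is_cauchy_seq N (val u).
Proof. by have := valP u; rewrite inE. Qed.

Definition mk_cauchy (u : nat -> V) (h : is_cauchy_seq N u) : cauchy_seq N :=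
  exist _ u (mem_set h).

Lemma norm_completion (u : cauchy_seq N) :
  N (val u n) @[n --> \oo] --> `|to_sep (cauchy_seminorm N) u : completion N|.
Proof. by rewrite norm_to_sep; exact: cvg_cauchy_norm. Qed.

Lemma to_completion_is_linear : linear (to_completion N).
Proof.
move=> a x y; rewrite /to_completion -linearP; congr (to_sep _ _).
exact/val_inj.
Qed.

HB.instance Definition _ := GRing.isLinear.Build R V (completion N) *:%R
  (to_completion N) to_completion_is_linear.

Lemma norm_completion_sub (u : cauchy_seq N) e : 0 < e ->
  exists n0, forall n, (n0 <= n)%N ->
    `|(to_sep (cauchy_seminorm N) u : completion N) - to_completion N (val u n)| <= e.
Proof.
move=> e0; have [n0 h] := cauchy_seqP u e0; exists n0 => n n0n.
rewrite /to_completion -linearB.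
apply: (@closed_cvg _ _ \oo _ (fun m => N (val u m - val u n)) [set y | y <= e]).
- exact: closed_le.
- by exists n0 => // m /= n0m; exact/ltW/h.
- exact: norm_completion.
Qed.

Lemma completion_dense (x : completion N) e : 0 < e ->
  exists v, `|x - to_completion N v| <= e.
Proof.
rewrite -(to_sepK x) => e0.
have [n h] := norm_completion_sub (repr x) e0.
by exists (val (repr x) n); exact: h.
Qed.

End CompletionTheory.

Definition mk_linear (R : realType) (X Y : lmodType R) (f : X -> Y)
    (lf : linear f) : {linear X -> Y} :=
  HB.pack f (GRing.isLinear.Build R X Y *:%R f lf).

Definition complete_space (R : realType) (Y : normedModType R) :=
  forall F : set_system Y, ProperFilter F -> cauchy F -> cvg F.

(** A Cauchy filter contains balls of radius tending to 0 whose centres come from [V], by density.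
    The centres form an [N]-Cauchy sequence, and its class is the limit of the filter. *)
Lemma completion_complete (R : realType) (V : lmodType R) (N : seminorm V) :
  complete_space (completion N).
Proof.
move=> F FF /cauchyP cF.
have eps0 n : 0 < n.+1%:R^-1 :> R by rewrite invr_gt0.
(* The filter gives a ball of radius [1/(n+1)]; moving its centre to an element of [V] doubles the
   radius. *)
have hx n : exists v, F (ball (to_completion N v) (2 * n.+1%:R^-1)).
  have [x Fx] := cF _ (eps0 n).
  have [v xv] := completion_dense x (eps0 n).
  exists v; apply: filterS Fx => y; rewrite -!ball_normE /= => xy.
  rewrite distrC in xv; rewrite -(subrKA x) mulr2n mulrDl mul1r.
  by rewrite (le_lt_trans (ler_normD _ _))// ler_ltD.
have [v hv] := choice hx.
have small e : 0 < e -> exists n0, forall n, (n0 <= n)%N -> 2 * n.+1%:R^-1 < e :> R.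
  move=> e0; have e20 : 0 < e / 2 by rewrite divr_gt0.
  have [n0 _ h] := near_infty_natSinv_lt (PosNum e20).
  exists n0 => n n0n; have := h n n0n; rewrite /= ltr_pdivlMr// mulrC.
  by [].
have cv : is_cauchy_seq N v.
  move=> e e0; have e20 : 0 < e / 2 by rewrite divr_gt0.
  have [n0 h] := small _ e20; exists n0 => m n n0m n0n.
  rewrite -norm_to_completion linearB.
  have [y [ym yn]] := filter_ex (filterI (hv m) (hv n)).
  move: ym yn; rewrite -!ball_normE /= => ym yn.
  rewrite -(subrKA y) (le_lt_trans (ler_normD _ _))// [ltRHS]splitr ltrD//.
    exact: lt_trans ym (h _ n0m).
  by rewrite distrC; exact: lt_trans yn (h _ n0n).
apply/cvg_ex; exists (to_sep (cauchy_seminorm N) (mk_cauchy cv)).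
apply/cvgrPdist_le => e e0; have e20 : 0 < e / 2 by rewrite divr_gt0.
have [n0 h] := norm_completion_sub (mk_cauchy cv) e20.
have [n1 h1] := small _ e20.
have := hv (maxn n0 n1); apply: filterS => y; rewrite -ball_normE /= => ym.
rewrite -(subrKA (to_completion N (v (maxn n0 n1)))).
rewrite (le_trans (ler_normD _ _))// [leRHS]splitr lerD//.
  by apply: h; exact: leq_maxl.
by apply/ltW/(lt_trans ym)/h1; exact: leq_maxr.
Qed.

Lemma complete_cvgn (R : realType) (Y : normedModType R) (u : nat -> Y) :
  complete_space Y ->
  (forall e, 0 < e ->
    exists n0, forall m n, (n0 <= m)%N -> (n0 <= n)%N -> `|u m - u n| <= e) ->
  exists l : Y, u @ \oo --> l.
Proof.
move=> cY cu; apply/cvg_ex; apply: cY; apply/cauchy_exP => e e0.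
have [n0 h] := cu (e / 2) (divr_gt0 e0 (ltr0n _ 2)).
exists (u n0); exists n0 => // n /= n0n; rewrite -ball_normE /=.
rewrite (le_lt_trans (h _ _ _ _))// ltr_pdivrMr// mulr2n mulrDr mulr1.
by rewrite ltrDl.
Qed.

Section Extension.
Context (R : realType) (V : lmodType R) (N : seminorm V) (Y : normedModType R).
Variables (cY : complete_space Y) (j : {linear V -> Y}) (C : R).
Hypotheses (C0 : 0 <= C) (jC : forall v, `|j v| <= C * N v).

(** The value at [x] is pinned down by this estimate against every [v]. Linearity, agreement with
    [j] and boundedness are all derived from it by density, without returning to representatives. *)
Lemma completion_extend_subproof (x : completion N) :
  exists y : Y, forall v, `|y - j v| <= C * `|x - to_completion N v|.
Proof.
rewrite -(to_sepK x); set u := repr x.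
have [y uy] : exists y : Y, (j \o val u) @ \oo --> y.
  apply: complete_cvgn => // e e0.
  have C1 : 0 < C + 1 by rewrite ltr_wpDl.
  have [n0 h] := cauchy_seqP u (divr_gt0 e0 C1).
  exists n0 => m n n0m n0n /=; rewrite -linearB (le_trans (jC _))//.
  have := h _ _ n0m n0n; rewrite ltr_pdivlMr// mulrC => /ltW; apply: le_trans.
  by rewrite ler_wpM2r ?sn_ge0// lerDl.
exists y => v.
rewrite /to_completion -linearB; set w := (X in C * `| _ X |).
have h1 : `|j (val u n) - j v| @[n --> \oo] --> `|y - j v|.
  by apply: cvg_norm; apply: cvgB => //; exact: cvg_cst.
have h2 : C * N (val w n) @[n --> \oo] --> C * `|to_sep (cauchy_seminorm N) w : completion N|.
  by apply: cvgMr; exact: norm_completion.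
rewrite -(cvg_lim _ h1)// -(cvg_lim _ h2)//; apply: ler_lim.
- by apply/cvg_ex; eexists; exact: h1.
- by apply/cvg_ex; eexists; exact: h2.
- by apply: nearW => n; rewrite -linearB jC.
Qed.

Lemma completion_extend : exists J : {linear completion N -> Y},
  (forall v, J (to_completion N v) = j v) /\ forall x, `|J x| <= C * `|x|.
Proof.
have [J hJ] := choice completion_extend_subproof.
have small (y : Y) (D : R) : 0 <= D -> (forall e, 0 < e -> `|y| <= D * e) -> y = 0.
  move=> D0 h; apply/eqP; rewrite -normr_le0; apply/ler_addgt0Pr => e e0.
  rewrite add0r; have D1 : 0 < D + 1 by rewrite ltr_wpDl.
  rewrite (le_trans (h _ (divr_gt0 e0 D1)))// mulrA ler_pdivrMr// mulrC.
  by rewrite ler_wpM2l ?lerDl// ltW.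
have Jj v : J (to_completion N v) = j v.
  apply/eqP; rewrite -subr_eq0 -normr_le0 (le_trans (hJ _ _))//.
  by rewrite subrr normr0 mulr0.
have lJ : linear J.
  move=> a x y; apply/eqP; rewrite -subr_eq0; apply/eqP.
  apply: (@small _ (C * (`|a| + 1) + (C * `|a| + C))).
    by rewrite !(addr_ge0, mulr_ge0).
  move=> e e0; have [v hv] := completion_dense x e0.
  have [w hw] := completion_dense y e0.
  rewrite (le_trans (ler_distD (j (a *: v + w)) _ _))// mulrDl lerD//.
    rewrite (le_trans (hJ _ _))// -mulrA ler_wpM2l// linearP/= opprD addrACA.
    rewrite -scalerBr (le_trans (ler_normD _ _))// normrZ mulrDl mul1r.
    by rewrite lerD// ler_wpM2l.
  rewrite linearP/= opprD addrACA -scalerBr (le_trans (ler_normD _ _))//.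
  rewrite normrZ mulrDl lerD// 1?distrC.
    by rewrite [C * _]mulrC -mulrA ler_wpM2l// (le_trans (hJ _ _))// ler_wpM2l.
  by rewrite (le_trans (hJ _ _))// ler_wpM2l.
exists (mk_linear lJ).
split=> [v|x /=]; first exact: Jj.
apply/ler_addgt0Pr => e e0; have D1 : 0 < C + C + 1 by rewrite ltr_wpDl ?addr_ge0.
have [v hv] := completion_dense x (divr_gt0 e0 D1).
have -> : J x = (J x - j v) + j v by rewrite subrK.
rewrite (le_trans (ler_normD _ _))//.
have h1 := hJ x v; have h2 := jC v; have h3 : N v <= `|x| + e / (C + C + 1).
  rewrite -norm_to_completion -lerBlDl (le_trans _ hv)// distrC.
  by rewrite (le_trans _ (ler_dist_dist _ _))// ler_norm.
have h4 : C * `|x - to_completion N v| <= C * (e / (C + C + 1)) by rewrite ler_wpM2l.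
have h5 : C * N v <= C * (`|x| + e / (C + C + 1)) by rewrite ler_wpM2l.
rewrite (le_trans (lerD h1 h2))// (le_trans (lerD h4 h5))//.
rewrite mulrDr addrCA lerD2l -mulrDl mulrA ler_pdivrMr// mulrC ler_wpM2l ?ltW//.
by rewrite ltrDl.
Qed.

End Extension.

Lemma completion_extend_isometry (R : realType) (V : lmodType R) (N : seminorm V)
    (Y : normedModType R) (j : {linear V -> Y}) :
  complete_space Y -> (forall v, `|j v| = N v) ->
  exists J : {linear completion N -> Y},
  (forall v, J (to_completion N v) = j v) /\ forall x, `|J x| = `|x|.
Proof.
move=> cY jN; have jC v : `|j v| <= 1 * N v by rewrite jN mul1r.
have [J [Jj JC]] := completion_extend cY ler01 jC.
exists J; split=> // x; apply/eqP; rewrite eq_le.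
have := JC x; rewrite mul1r => -> /=.
apply/ler_addgt0Pr => e e0; have e20 : 0 < e / 2 by rewrite divr_gt0.
have [v hv] := completion_dense x e20.
have h1 : `|x| <= e / 2 + N v.
  rewrite -[x](subrK (to_completion N v)) (le_trans (ler_normD _ _))//.
  by rewrite norm_to_completion lerD2r.
have h2 : N v <= `|J x| + e / 2.
  rewrite -jN -Jj -[to_completion N v](subrK x) linearD addrC.
  rewrite (le_trans (ler_normD _ _))// lerD2l (le_trans (JC _))// mul1r distrC//.
lra.
Qed.

(** Preimages of a sequence converging to [y] are again Cauchy, since [J] preserves distances. *)
Lemma isometry_range_closed (R : realType) (X Y : normedModType R)
    (J : {linear X -> Y}) :
  complete_space X -> (forall x, `|J x| = `|x|) -> closed (range J).
Proof.
move=> cX iJ y cy.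
have hx n : exists x, `|y - J x| <= n.+1%:R^-1.
  have p : 0 < n.+1%:R^-1 :> R by rewrite invr_gt0.
  have [_ [[x _ <-] h]] := cy _ (nbhsx_ballx y _ p).
  by exists x; apply/ltW; rewrite -ball_normE in h.
have [u hu] := choice hx.
have small (e : R) : 0 < e -> exists n0, forall n, (n0 <= n)%N -> `|y - J (u n)| <= e.
  move=> e0; have [n0 _ h] := near_infty_natSinv_lt (PosNum e0).
  by exists n0 => n n0n; apply: le_trans (hu n) _; exact/ltW/(h n n0n).
have [x ux] : exists x : X, u @ \oo --> x.
  apply: complete_cvgn => // e e0; have [n0 h] := small _ (divr_gt0 e0 (ltr0n _ 2)).
  exists n0 => m n n0m n0n; rewrite -iJ linearB -(subrKA y).
  rewrite (le_trans (ler_normD _ _))// [leRHS]splitr lerD//; last exact: h.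
  by rewrite distrC h.
exists x => //; apply/eqP; rewrite eq_sym -subr_eq0 -normr_le0.
apply/ler_addgt0Pr => e e0; rewrite add0r.
have [n0 h] := small _ (divr_gt0 e0 (ltr0n _ 2)).
move/cvgrPdist_le : ux => /(_ _ (divr_gt0 e0 (ltr0n _ 2)))[n1 _ h1].
rewrite -(subrKA (J (u (maxn n0 n1)))) (le_trans (ler_normD _ _))//.
rewrite [leRHS]splitr lerD ?h ?leq_maxl// -linearB iJ distrC.
by apply: h1; exact: leq_maxr.
Qed.

(** * The norms l_q *)

Section LqNorm.
Context (R : realType) (p : R) (p1 : 1 <= p).
Local Notation pc := (hoelder_conjugate p%:E).
Local Notation "n .-norm c" := (@lqnorm R pc n c) (at level 2, format "n .-norm  c").

Lemma p_gt0 : 0 < p. Proof. exact: lt_le_trans ltr01 p1. Qed.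

(** The two shapes of p': infinite for [p = 1], otherwise [r = p / (p - 1)]. The last identity makes
    [|b|^(p-1)] the extremal sequence in [lqnorm_dual]. *)
Lemma conj_exponent :
  (p = 1 /\ pc = +oo%E) \/
  exists r, [/\ pc = r%:E, 1 < p, 1 < r, p^-1 + r^-1 = 1 & (p - 1) * r = p].
Proof.
have p0 := p_gt0.
have [->|pn1] := eqVneq p 1; first by left; rewrite hoelder_conjugate1.
have p1' : 1 < p by rewrite lt_neqAle eq_sym pn1.
have pB : 0 < p - 1 by rewrite subr_gt0.
right; exists (p / (p - 1)); split => //.
- rewrite /hoelder_conjugate /= eqe (gt_eqF p0) -EFinD inver subr_eq0.
  by rewrite (negbTE pn1).
- by rewrite ltr_pdivlMr// mul1r; lra.
- by field; rewrite ?gt_eqF// subr_eq0 gt_eqF.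
- by rewrite mulrC divfK// gt_eqF.
Qed.

Lemma sumr_powR_ge0 n (c : 'I_n -> R) s : 0 <= \sum_i `|c i| `^ s.
Proof. by apply: sumr_ge0 => i _; exact: powR_ge0. Qed.

Lemma lqnorm_ge0 n (c : 'I_n -> R) : 0 <= n.-norm c.
Proof.
case: conj_exponent => [[_ ->]|[r [-> _ _ _ _]]] /=; last exact: powR_ge0.
by elim/big_ind: _ => // x y x0 y0; rewrite le_max x0.
Qed.

Lemma lqnorm1 (c : R) : 1.-norm (fun=> c) = `|c|.
Proof.
case: conj_exponent => [[_ ->]|[r [-> _ r1 _ _]]] /=.
  by rewrite big_ord_recl big_ord0 (elimT max_idPl).
rewrite big_ord_recl big_ord0 addr0.
by rewrite -powRrM mulfV ?powRr1// gt_eqF// (lt_trans ltr01).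
Qed.

(** Interpolation between the sup norm and the l_1 norm: [|c|^r <= M^(r-1) |c|] and
    [(r - 1) / r = 1/p]. Since the exponent of [M] is positive, small coefficients of bounded total
    mass have a small norm. *)
Lemma lqnorm_le n (c : 'I_n -> R) (M B : R) : 0 <= M -> (forall i, `|c i| <= M) ->
  \sum_i `|c i| <= B -> n.-norm c <= M `^ p^-1 * B `^ (1 - p^-1).
Proof.
move=> M0 cM cB; have p0 := p_gt0.
have B0 : 0 <= B by apply: le_trans cB; exact: sumr_ge0.
case: conj_exponent => [[-> ->]|[r [-> p1' r1 pr _]]] /=.
  rewrite invr1 subrr powRr0 mulr1 powRr1//.
  by elim/big_ind: _ => // x y x0 y0; rewrite ge_max x0.
have r0 : 0 < r by exact: lt_trans r1.
have -> : 1 - p^-1 = r^-1 by rewrite -pr addrC addKr.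
have -> : p^-1 = (r - 1) / r.
  by rewrite mulrBl divff ?gt_eqF// mul1r -pr addrK.
rewrite powRrM -powRM// ?powR_ge0//.
rewrite ge0_ler_powR ?invr_ge0 ?(ltW r0)// ?nnegrE ?mulr_ge0 ?powR_ge0 ?sumr_powR_ge0//.
rewrite (@le_trans _ _ (\sum_i M `^ (r - 1) * `|c i|))//; last first.
  by rewrite -mulr_sumr ler_wpM2l ?powR_ge0.
apply: ler_sum => i _; rewrite -mulr_powRB1// mulrC ler_wpM2r//.
by rewrite ge0_ler_powR ?nnegrE// subr_ge0 ltW.
Qed.

Lemma hoelder_lqnorm n (c b : 'I_n -> R) :
  \sum_i `|c i| * `|b i| <= n.-norm c * (\sum_i `|b i| `^ p) `^ p^-1.
Proof.
have p0 := p_gt0.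
case: conj_exponent => [[-> ->]|[r [-> p1' r1 pr _]]] /=.
  rewrite invr1 powRr1 ?sumr_powR_ge0// mulr_sumr ler_sum// => i _.
  rewrite powRr1// ler_wpM2r//; exact: (le_bigmax _ (fun i => `|c i|)).
have r0 : 0 < r by exact: lt_trans r1.
have [A AE] : exists A, A = (\sum_i `|c i| `^ r) `^ r^-1 by exact: (ex_intro _ _ erefl).
have [B BE] : exists B, B = (\sum_i `|b i| `^ p) `^ p^-1 by exact: (ex_intro _ _ erefl).
rewrite -AE -BE.
have z s (d : 'I_n -> R) i : 0 < s -> (\sum_i `|d i| `^ s) `^ s^-1 = 0 -> d i = 0.
  move=> s0 /powR_eq0_eq0/eqP; rewrite psumr_eq0; last by move=> *; exact: powR_ge0.
  by move=> /allP/(_ i (mem_index_enum i))/= /eqP/powR_eq0_eq0/eqP; rewrite normr_eq0 => /eqP.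
have [A0|A0] := eqVneq A 0.
  have c0 i : c i = 0 by apply: (z r c i r0); rewrite -AE; exact: A0.
  by rewrite A0 mul0r big1// => i _; rewrite c0 normr0 mul0r.
have [B0|B0] := eqVneq B 0.
  have b0 i : b i = 0 by apply: (z p b i p0); rewrite -BE; exact: B0.
  by rewrite B0 mulr0 big1// => i _; rewrite b0 normr0 mulr0.
have Ap : 0 < A by rewrite lt_neqAle eq_sym A0 AE powR_ge0.
have Bp : 0 < B by rewrite lt_neqAle eq_sym B0 BE powR_ge0.
have normalize s (d : 'I_n -> R) D : 0 < s -> 0 < D ->
    D = (\sum_i `|d i| `^ s) `^ s^-1 -> \sum_i (`|d i| / D) `^ s = 1.
  move=> s0 Dp DE.
  rewrite (eq_bigr (fun i => `|d i| `^ s * D^-1 `^ s)); last first.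
    by move=> i _; rewrite powRM// invr_ge0 ltW.
  rewrite -mulr_suml -[D^-1]powR_inv1 ?(ltW Dp)// powRAC [X in _ * X]powR_inv1 ?powR_ge0//.
  have -> : D `^ s = \sum_i `|d i| `^ s.
    by rewrite DE -powRrM (mulVf (lt0r_neq0 s0)) (powRr1 (sumr_powR_ge0 _ _)).
  rewrite divff//; apply: contraTneq Dp => S0; rewrite DE S0.
  by rewrite (powR0 (invr_neq0 (lt0r_neq0 s0))) ltxx.
have -> : \sum_i `|c i| * `|b i| = A * B * \sum_i (`|c i| / A) * (`|b i| / B).
  rewrite mulr_sumr; apply: eq_bigr => i _.
  by rewrite mulrACA [A * _]mulrC [B * _]mulrC !divfK.
rewrite ler_piMr ?mulr_ge0 ?(ltW Ap) ?(ltW Bp)//.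
rewrite (@le_trans _ _ (\sum_i ((`|c i| / A) `^ r / r + (`|b i| / B) `^ p / p)))//.
  apply: ler_sum => i _; apply: conjugate_powR => //.
  - by rewrite divr_ge0// ltW.
  - by rewrite divr_ge0// ltW.
  - by rewrite addrC.
rewrite big_split/= -!mulr_suml (normalize r c A r0 Ap AE) (normalize p b B p0 Bp BE).
by rewrite !mul1r addrC pr.
Qed.

(** The extremal choice is [c = sg(b) |b|^(p-1)], which is just the sign for [p = 1]. Writing [S]
    for the sum of the [|b|^p], this gives [S <= K S^(1/r)]. *)
Lemma lqnorm_dual n (b : 'I_n -> R) (K : R) : 0 <= K ->
  (forall c : 'I_n -> R, \sum_i c i * b i <= K * n.-norm c) ->
  \sum_i `|b i| `^ p <= K `^ p.
Proof.
move=> K0 h; have p0 := p_gt0.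
case: conj_exponent => [[p_1 pE]|[r [pE p1' r1 pr pBr]]].
  have := h (fun i => Num.sg (b i)); rewrite pE p_1 /= powRr1//.
  rewrite (eq_bigr (fun i => `|b i| `^ 1)); last first.
    by move=> i _; rewrite powRr1// -normrEsg.
  move=> /le_trans; apply; rewrite ler_piMr//.
  elim/big_ind: _ => // [x y x0 y0|i _]; first by rewrite ge_max x0.
  by rewrite normr_sg lern1; case: eqP.
have r0 : 0 < r by exact: lt_trans r1.
set S := \sum_i _; have S0 : 0 <= S by exact: sumr_powR_ge0.
have := h (fun i => Num.sg (b i) * `|b i| `^ (p - 1)); rewrite pE /=.
rewrite (eq_bigr (fun i => `|b i| `^ p)); last first.
  by move=> i _; rewrite mulrAC -normrEsg mulr_powRB1.
rewrite [X in _ <= K * X `^ _](_ : _ = S); last first.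
  apply: eq_bigr => i _; have [->|bi0] := eqVneq (b i) 0.
    by rewrite sgr0 mul0r normr0 !powR0// gt_eqF.
  by rewrite normrM normr_sg bi0 mul1r ger0_norm ?powR_ge0// -powRrM pBr.
rewrite -/S; move: S0; rewrite le_eqVlt => /predU1P[<- _|Sp]; first exact: powR_ge0.
move=> SK; have : S `^ p^-1 <= K.
  rewrite -(@ler_pM2r _ (S `^ r^-1)) ?powR_gt0// -powRD.
    by rewrite pr powRr1// ltW.
  by rewrite (gt_eqF Sp) implybT.
move=> /(@ge0_ler_powR _ p (ltW p0) _ _); rewrite !nnegrE powR_ge0 => /(_ isT K0).
by rewrite -powRrM mulVf ?gt_eqF// powRr1// ltW.
Qed.

End LqNorm.

(** * Atomic spaces: moments, corrections and chains *)

Definition mnorm (R : realType) M (v : 'rV[R]_M) : R := \sum_j `|v 0 j|.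

Section MNorm.
Context (R : realType) (M : nat).
Implicit Types v w : 'rV[R]_M.

Lemma mnorm_ge0 v : 0 <= mnorm v. Proof. exact: sumr_ge0. Qed.

Lemma mnorm0 : mnorm (0 : 'rV[R]_M) = 0.
Proof. by rewrite /mnorm big1// => j _; rewrite mxE normr0. Qed.

Lemma mnormN v : mnorm (- v) = mnorm v.
Proof. by apply: eq_bigr => j _; rewrite mxE normrN. Qed.

Lemma mnormD v w : mnorm (v + w) <= mnorm v + mnorm w.
Proof. by rewrite -big_split ler_sum// => j _; rewrite mxE ler_normD. Qed.

Lemma mnorm_eq0 v : mnorm v = 0 -> v = 0.
Proof.
move=> /eqP; rewrite psumr_eq0// => /allP h; apply/rowP => j; rewrite mxE.
by apply/eqP; rewrite -normr_eq0; exact: (h j (mem_index_enum j)).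
Qed.

Lemma mnorm_small v C : (forall e, 0 < e -> mnorm v <= C * e) -> v = 0.
Proof.
move=> h; apply/mnorm_eq0/eqP; rewrite eq_le mnorm_ge0 andbT.
apply/ler_addgt0Pr => e e0; rewrite add0r.
have C1 : 0 < `|C| + 1 by rewrite ltr_wpDl.
rewrite (le_trans (h _ (divr_gt0 e0 C1)))// mulrA ler_pdivrMr// mulrC.
by rewrite ler_wpM2l ?(ltW e0)// (le_trans (ler_norm C))// lerDl.
Qed.

Lemma mnorm_mulmx N v (P : 'M[R]_(M, N)) :
  mnorm (v *m P) <= (\sum_i \sum_j `|P i j|) * mnorm v.
Proof.
rewrite /mnorm (@le_trans _ _ (\sum_j \sum_i `|v 0 i| * `|P i j|))//.
  apply: ler_sum => j _; rewrite mxE (le_trans (ler_norm_sum _ _ _))//.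
  by apply: ler_sum => i _; rewrite normrM.
rewrite exchange_big /= mulr_sumr ler_sum// => i _.
rewrite -mulr_sumr mulrC ler_wpM2r// [leRHS](bigD1 i)//= lerDl.
by apply: sumr_ge0 => i' _; exact: sumr_ge0.
Qed.

End MNorm.

(* Both spaces of the theorem fit this pattern: [am_sup Q] consists of the
   elements supported by Q, and [am_mom] collects the moments of degree < k. *)
Record atomic_model (R : realType) (d M : nat) (E : lmodType R)
    (atom : set 'rV[R]_d -> set E) := AtomicModel {
  am_sup : set 'rV[R]_d -> set E;
  am_nu : E -> R;
  am_mom : E -> 'rV[R]_M;
  am_sup0 : forall Q, am_sup Q 0;
  am_supP : forall Q a x y, am_sup Q x -> am_sup Q y -> am_sup Q (a *: x + y);
  am_supS : forall Q Q', Q `<=` Q' -> am_sup Q `<=` am_sup Q';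
  am_nuD : forall x y, am_sup (unit_cube R d) x -> am_sup (unit_cube R d) y ->
    am_nu (x + y) <= am_nu x + am_nu y;
  am_nuZ : forall a x, am_sup (unit_cube R d) x -> am_nu (a *: x) = `|a| * am_nu x;
  am_momP : forall a x y, am_sup (unit_cube R d) x -> am_sup (unit_cube R d) y ->
    am_mom (a *: x + y) = a *: am_mom x + am_mom y;
  am_atomP : forall Q a, Q `<=` unit_cube R d ->
    atom Q a <-> [/\ am_sup Q a, am_nu a <= 1 & am_mom a = 0] }.

(** Grid cubes are indexed by finite functions, whereas [packing] expects ordinals. *)
Definition fpacking (R : realType) (d : nat) (T : finType) (Q : T -> set 'rV[R]_d) :=
  (forall t, cube (Q t) /\ Q t `<=` unit_cube R d) /\
  trivIset setT (fun t => (Q t)°).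

Lemma fpackingP (R : realType) (d : nat) (T : finType) (Q : T -> set 'rV[R]_d) :
  fpacking Q -> packing (fun i : 'I_#|T| => Q (enum_val i)).
Proof.
move=> [Q1 Q2]; split=> [i|i j _ _ ij]; first exact: Q1.
by apply/enum_val_inj/Q2.
Qed.

Section Atomic.
Context (R : realType) (d M : nat) (p : R) (p1 : 1 <= p) (E : lmodType R)
  (atom : set 'rV[R]_d -> set E) (A : atomic_model M atom).
Local Notation K := (unit_cube R d).
Local Notation sup_ := (am_sup A).
Local Notation nu := (am_nu A).
Local Notation mom := (am_mom A).
Local Notation N := (atomic_seminorm atom p1).

Lemma am_supZ Q a x : sup_ Q x -> sup_ Q (a *: x).
Proof. by move=> h; rewrite -[_ *: _]addr0; apply: am_supP => //; exact: am_sup0. Qed.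

Lemma am_supD Q x y : sup_ Q x -> sup_ Q y -> sup_ Q (x + y).
Proof. by move=> h h'; rewrite -[x]scale1r; exact: am_supP. Qed.

Lemma am_supB Q x y : sup_ Q x -> sup_ Q y -> sup_ Q (x - y).
Proof. by move=> h h'; rewrite addrC -scaleN1r; exact: am_supP. Qed.

Lemma am_sup_sum Q (I : Type) (r : seq I) (P : pred I) (f : I -> E) :
  (forall i, P i -> sup_ Q (f i)) -> sup_ Q (\sum_(i <- r | P i) f i).
Proof.
move=> h; elim/big_ind: _ => //; [exact: am_sup0|exact: am_supD].
Qed.

Lemma am_mom0 : mom 0 = 0.
Proof.
have := am_momP 1 (am_sup0 A K) (am_sup0 A K).
by rewrite scaler0 addr0 scale1r => /eqP; rewrite -subr_eq0 opprD addNKr oppr_eq0 => /eqP.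
Qed.

Lemma am_momZ a x : sup_ K x -> mom (a *: x) = a *: mom x.
Proof.
by move=> h; rewrite -[a *: x]addr0 am_momP// ?am_mom0 ?addr0//; exact: am_sup0.
Qed.

Lemma am_momD x y : sup_ K x -> sup_ K y -> mom (x + y) = mom x + mom y.
Proof. by move=> h h'; rewrite -[in LHS](scale1r x) am_momP// scale1r. Qed.

Lemma am_momB x y : sup_ K x -> sup_ K y -> mom (x - y) = mom x - mom y.
Proof. by move=> h h'; rewrite addrC -scaleN1r am_momP// scaleN1r addrC. Qed.

Lemma am_mom_sum (I : Type) (r : seq I) (P : pred I) (f : I -> E) :
  (forall i, P i -> sup_ K (f i)) ->
  mom (\sum_(i <- r | P i) f i) = \sum_(i <- r | P i) mom (f i).
Proof.
move=> h; suff [//] : sup_ K (\sum_(i <- r | P i) f i) /\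
  mom (\sum_(i <- r | P i) f i) = \sum_(i <- r | P i) mom (f i).
elim/big_rec2: _ => [|i x y Pi [sy my]]; first by split; [exact: am_sup0|exact: am_mom0].
by split; [apply: am_supD => //; exact: h|rewrite am_momD ?my//; exact: h].
Qed.

Lemma am_nu0 : nu 0 = 0.
Proof. by rewrite -(scale0r (0 : E)) am_nuZ ?normr0 ?mul0r//; exact: am_sup0. Qed.

Lemma am_nuN x : sup_ K x -> nu (- x) = nu x.
Proof. by move=> h; rewrite -scaleN1r am_nuZ// normrN1 mul1r. Qed.

Lemma am_nu_ge0 x : sup_ K x -> 0 <= nu x.
Proof.
move=> h; have := am_nuD h (am_supZ (-1) h).
rewrite scaleN1r subrr am_nu0 am_nuN//; lra.
Qed.

Lemma am_nuB x y : sup_ K x -> sup_ K y -> nu (x - y) <= nu x + nu y.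
Proof.
by move=> h h'; rewrite -(am_nuN h') am_nuD// -scaleN1r; exact: am_supZ.
Qed.

Lemma am_nu_sum (I : Type) (r : seq I) (P : pred I) (f : I -> E) :
  (forall i, P i -> sup_ K (f i)) ->
  nu (\sum_(i <- r | P i) f i) <= \sum_(i <- r | P i) nu (f i).
Proof.
move=> h; suff [//] : sup_ K (\sum_(i <- r | P i) f i) /\
  nu (\sum_(i <- r | P i) f i) <= \sum_(i <- r | P i) nu (f i).
elim/big_rec2: _ => [|i x y Pi [sy my]]; first by split; [exact: am_sup0|rewrite am_nu0].
split; first by apply: am_supD => //; exact: h.
by rewrite (le_trans (am_nuD _ _))// ?lerD2l//; exact: h.
Qed.

(** Joins membership in the hull to a norm bound, so that elements of [E] can be added and estimated
    without handling elements of the subtype. *)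
Definition hull_le (e : E) (w : R) := exists2 f : hull atom, val f = e & N f <= w.

Lemma hull_le_weaken e w w' : w <= w' -> hull_le e w -> hull_le e w'.
Proof. by move=> ww' [f fe fw]; exists f => //; exact: le_trans ww'. Qed.

Lemma hull_leP (f : hull atom) w : hull_le (val f) w -> N f <= w.
Proof. by move=> [g /val_inj ->]. Qed.

Lemma hull_leD e e' w w' : hull_le e w -> hull_le e' w' -> hull_le (e + e') (w + w').
Proof.
move=> [f <- fw] [g <- gw]; exists (f + g) => //.
by rewrite (le_trans (sn_triangle _ _ _))// lerD.
Qed.

Lemma hull_leZ a e w : hull_le e w -> hull_le (a *: e) (`|a| * w).
Proof.
by move=> [f <- fw]; exists (a *: f) => //; rewrite sn_homog ler_wpM2l.
Qed.

Lemma hull_le_sum (I : Type) (r : seq I) (P : pred I) (f : I -> E) (w : I -> R) :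
  (forall i, P i -> hull_le (f i) (w i)) ->
  hull_le (\sum_(i <- r | P i) f i) (\sum_(i <- r | P i) w i).
Proof.
move=> h; elim/big_rec2: _ => [|i x y Pi hx].
  by exists 0 => //; rewrite sn0.
by apply: hull_leD => //; exact: h.
Qed.

Lemma chain_ge0 b w : chain_repr p atom b w -> 0 <= w.
Proof. by move=> [n [Q [c [a [_ _ _ ->]]]]]; exact: lqnorm_ge0. Qed.

Lemma presentation_lb e : has_lbound (presentation p atom e).
Proof.
exists 0 => _ [m [b [w [bw _ ->]]]]; apply: sumr_ge0 => i _.
exact: chain_ge0 (bw i).
Qed.

Lemma hull_le_chain b w : chain_repr p atom b w -> hull_le b w.
Proof.
move=> bw; have hb : b \in hull_pred atom.
  move: bw => [n [Q [c [a [[Q1 _] aQ -> _]]]]]; rewrite inE /=.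
  by exists n, c, a; split=> // i; exists (Q i); split => //; case: (Q1 i).
exists (exist _ b hb) => //; apply: ge_inf; first exact: presentation_lb.
by exists 1%N, (fun=> b), (fun=> w); split=> //; rewrite big_ord1.
Qed.

Lemma hull_presentation (f : hull atom) e : 0 < e ->
  exists m (b : 'I_m -> E) (w : 'I_m -> R),
    [/\ forall i, chain_repr p atom (b i) (w i), val f = \sum_i b i
      & \sum_i w i <= N f + e].
Proof.
move=> e0; have hi : has_inf (presentation p atom (val f)).
  split; last exact: presentation_lb.
  have := valP f; rewrite inE/= => -[n [c [a [aa ->]]]].
  exists (\sum_i `|c i|), n, (fun i => c i *: a i), (fun i => `|c i|); split=> // i.
  have [Q [cQ Q1 aQ]] := aa i.
  exists 1%N, (fun=> Q), (fun=> c i), (fun=> a i); split=> //.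
  - by split=> // j k _ _ _; rewrite (ord1 j) (ord1 k).
  - by rewrite big_ord1.
  - by rewrite lqnorm1.
have [s [m [b [w [bw fb ->]]]] sl] := inf_adherent e0 hi.
by exists m, b, w; split=> //; exact: ltW.
Qed.

Lemma hull_in (f : hull atom) : sup_ K (val f) /\ mom (val f) = 0.
Proof.
have := valP f; rewrite inE/= => -[n [c [a [aa ->]]]].
have aK i : sup_ K (a i) /\ mom (a i) = 0.
  by have [Q [cQ QK /(am_atomP A _ QK)[/(am_supS QK)]]] := aa i.
split; first by apply: am_sup_sum => i _; apply: am_supZ; case: (aK i).
rewrite am_mom_sum => [|i _]; last by apply: am_supZ; case: (aK i).
rewrite big1// => i _; have [h1 h2] := aK i.
by rewrite am_momZ// h2 scaler0.
Qed.

Lemma unit_cubeE : K = [set y : 'rV[R]_d | forall i, (0 : 'rV[R]_d) 0 i <= y 0 i <= (0 : 'rV[R]_d) 0 i + 1].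
Proof. by apply/seteqP; split=> y h i; have := h i; rewrite mxE add0r. Qed.

Lemma cube_unit_cube : cube K.
Proof. by exists 0, 1; split=> //; exact: unit_cubeE. Qed.

(** Dividing [g t] by [mu t] gives an atom on [Q t], so the sum is one chain with coefficients
    [mu t]; positivity of [mu t] permits the division. *)
Lemma hull_le_fchain (T : finType) (Q : T -> set 'rV[R]_d) (g : T -> E) (mu : T -> R) :
  fpacking Q ->
  (forall t, [/\ sup_ (Q t) (g t), mom (g t) = 0, nu (g t) <= mu t & 0 < mu t]) ->
  hull_le (\sum_t g t)
    (@lqnorm R (hoelder_conjugate p%:E) #|T| (fun i => mu (enum_val i))).
Proof.
move=> pQ h; apply: hull_le_chain.
exists #|T|, (fun i => Q (enum_val i)), (fun i => mu (enum_val i)),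
  (fun i => (mu (enum_val i))^-1 *: g (enum_val i)); split => //.
- exact: fpackingP.
- move=> i; have [h1 h2 h3 h4] := h (enum_val i).
  have QK : Q (enum_val i) `<=` K by case: pQ => /(_ (enum_val i))[].
  have gK := am_supS QK h1.
  apply/(am_atomP A _ QK); split; first exact: am_supZ.
  + by rewrite am_nuZ// ger0_norm ?invr_ge0 ?(ltW h4)// mulrC ler_pdivrMr// mul1r.
  + by rewrite am_momZ// h2 scaler0.
- rewrite (reindex _ (onW_bij _ (@enum_val_bij T)))/=; apply: eq_bigr => i _.
  by have [_ _ _ h4] := h (enum_val i); rewrite scalerA mulfV ?gt_eqF// scale1r.
Qed.

(** Up to scaling, a moment-free element is a single atom on the whole cube. The scaling factor is
    [nu g + e] because [nu g] may vanish. This crude bound serves for small leftovers. *)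
Lemma hull_le_nu g : sup_ K g -> mom g = 0 -> hull_le g (nu g).
Proof.
move=> gK g0; suff h e : 0 < e -> hull_le g (nu g + e).
  have [f fg _] := h 1 ltr01; exists f => //; apply/ler_addgt0Pr => e e0.
  by apply: hull_leP; rewrite fg; exact: h.
move=> e0; have g0' := am_nu_ge0 gK; have c0 : 0 < nu g + e by rewrite ltr_wpDl.
apply: hull_le_chain.
exists 1%N, (fun=> K), (fun=> nu g + e), (fun=> (nu g + e)^-1 *: g); split.
- split=> [_|i j _ _ _]; last by rewrite (ord1 i) (ord1 j).
  by split=> //; exact: cube_unit_cube.
- move=> _; apply/(am_atomP A _ (@subset_refl _ _)); split; first exact: am_supZ.
  + by rewrite am_nuZ// ger0_norm ?invr_ge0 ?(ltW c0)// mulrC ler_pdivrMr// mul1r lerDl ltW.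
  + by rewrite am_momZ// g0 scaler0.
- by rewrite big_ord1 scalerA mulfV ?gt_eqF// scale1r.
- by rewrite lqnorm1// gtr0_norm.
Qed.

(* The moments of a finite family realising the maximal rank span those of all
   elements of [P]. *)
Lemma mom_span (P : set E) : exists n (e : 'I_n -> E), (forall i, P (e i)) /\
  forall x, P x -> (mom x <= (\matrix_i mom (e i)))%MS.
Proof.
pose Pr r := `[< exists n (e : 'I_n -> E), (forall i, P (e i)) /\
  \rank (\matrix_i mom (e i)) = r >].
have P0 : exists r, Pr r.
  by exists 0%N; apply/asboolP; exists 0%N, (fun=> 0); split=> [[]//|]; rewrite flatmx0 mxrank0.
have PM r : Pr r -> (r <= M)%N.
  by move=> /asboolP[n [e [_ <-]]]; exact: rank_leq_col.
have [r /asboolP[n [e [eQ er]]] rmax] := ex_maxnP P0 PM.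
exists n, e; split=> // x xQ.
pose e' (i : 'I_(n + 1)) := match fintype.split i with inl j => e j | inr _ => x end.
have e'Q i : P (e' i) by rewrite /e'; case: (fintype.split i).
have e'E : \matrix_i mom (e' i) = col_mx (\matrix_i mom (e i)) (mom x).
  apply/row_matrixP => i; rewrite rowK /e'.
  case: (split_ordP i) => j ->.
    by rewrite rowKu rowK.
  by rewrite rowKd row_id.
have : (\rank (\matrix_i mom (e' i)) <= r)%N.
  by apply: rmax; apply/asboolP; exists (n + 1)%N, e'.
rewrite e'E -er -addsmxE => h.
have /eqmxP/eqmx_sym/eqmxP/andP[h' _] : (\matrix_i mom (e i) == \matrix_i mom (e i) + mom x)%MS.
  by rewrite -(geq_leqif (mxrank_leqif_eq (addsmxSl _ _))).
by apply: submx_trans h'; exact: addsmxSr.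
Qed.

(* [kappa] realises given moments by elements supported by [Q], at a cost
   controlled by the size of the moments. *)
Definition corrector Q (kappa : 'rV[R]_M -> E) (C : R) :=
  [/\ linear kappa, 0 < C,
    forall v, sup_ Q (kappa v) /\ nu (kappa v) <= C * mnorm v,
    forall x, sup_ Q x -> mom (kappa (mom x)) = mom x &
    forall v, (forall e, 0 < e -> exists2 x, sup_ Q x & mnorm (v - mom x) <= e) ->
      mom (kappa v) = v].

(** The pseudo-inverse of the matrix of a spanning family gives a linear choice of coefficients. The
    last property of [corrector] says that the attained moments form a closed set: the matrix
    [pinvmx B *m B] fixes them and is Lipschitz, so it also fixes their limits. *)
Lemma corrector_ex Q : Q `<=` K -> exists kappa C, corrector Q kappa C.
Proof.
move=> QK; have [n [e [eP espan]]] := mom_span (sup_ Q).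
set B := \matrix_i mom (e i) in espan.
pose kappa (v : 'rV[R]_M) := \sum_i (v *m pinvmx B) 0 i *: e i.
have eK i : sup_ K (e i) by exact: (am_supS QK).
have kl : linear kappa.
  move=> a v w; rewrite /kappa scaler_sumr -big_split; apply: eq_bigr => i _.
  by rewrite mulmxDl -scalemxAl !mxE scalerDl scalerA.
have km v : mom (kappa v) = v *m pinvmx B *m B.
  rewrite /kappa am_mom_sum => [|i _]; last exact: am_supZ.
  rewrite [RHS]mulmx_sum_row; apply: eq_bigr => i _.
  by rewrite am_momZ// rowK.
have kx x : sup_ Q x -> mom (kappa (mom x)) = mom x.
  by move=> xQ; rewrite km mulmxKpV//; exact: espan.
pose C := (\sum_i \sum_j `|pinvmx B i j|) * (\sum_i nu (e i)) + 1.
have nue i : 0 <= nu (e i) by exact: am_nu_ge0.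
have C0 : 0 < C by rewrite ltr_wpDl// mulr_ge0// sumr_ge0// => i _; exact: sumr_ge0.
exists kappa, C; split=> //.
- move=> v; split; first by apply: am_sup_sum => i _; exact: am_supZ.
  rewrite (le_trans (am_nu_sum _ _))// => [i _|]; first exact: am_supZ.
  rewrite (@le_trans _ _ (\sum_i mnorm (v *m pinvmx B) * nu (e i)))//.
    apply: ler_sum => i _; rewrite am_nuZ// ler_wpM2r//.
    by rewrite /mnorm (bigD1 i)//= lerDl sumr_ge0.
  rewrite -mulr_sumr mulrDl mul1r (@le_trans _ _ ((\sum_i \sum_j `|pinvmx B i j|) * (\sum_i nu (e i)) * mnorm v))//.
    by rewrite mulrAC ler_wpM2r ?sumr_ge0// mnorm_mulmx.
  by rewrite lerDl mnorm_ge0.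
- move=> v h; apply/eqP; rewrite -subr_eq0; apply/eqP.
  pose D := \sum_i \sum_j `|(pinvmx B *m B) i j|.
  apply: (@mnorm_small _ _ _ (D + 1)) => eps eps0.
  have [x xQ vx] := h _ eps0.
  have -> : mom (kappa v) - v = (v - mom x) *m (pinvmx B *m B) - (v - mom x).
    have km' w : w *m (pinvmx B *m B) = mom (kappa w) by rewrite mulmxA km.
    by rewrite mulmxBl !km' (kx _ xQ) opprB addrA subrK.
  rewrite (le_trans (mnormD _ _))// mnormN mulrDl mul1r lerD//.
  rewrite (le_trans (mnorm_mulmx _ _))// ler_wpM2l//.
  by rewrite sumr_ge0// => i _; exact: sumr_ge0.
Qed.

(* Once its moments are corrected on each cube, the sum is a single chain with
   coefficients at most [2 dlt], whose l_{p'} norm is at most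
   [(2 dlt)^(1/p) (B + 1)^(1 - 1/p)]. *)
Lemma coarse_chain (B eps : R) : 0 <= B -> 0 < eps -> exists2 dlt, 0 < dlt &
  forall (T : finType) (Q : T -> set 'rV[R]_d), fpacking Q ->
  exists2 eta, 0 < eta & forall (g : T -> E) (mu : T -> R) s,
    (forall t, [/\ sup_ (Q t) (g t), nu (g t) <= mu t, mu t <= dlt &
      mnorm (mom (g t)) <= eta]) ->
    \sum_t mu t <= B -> sup_ K s -> nu s <= eta ->
    mom (\sum_t g t + s) = 0 -> hull_le (\sum_t g t + s) eps.
Proof.
move=> B0 e0; have p0 := p_gt0 p1.
pose L := (B + 1) `^ (1 - p^-1); have L0 : 0 < L by rewrite powR_gt0// ltr_wpDl.
pose dlt := (eps / 2 / L) `^ p / 2.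
have d0 : 0 < dlt by rewrite divr_gt0// powR_gt0// !divr_gt0.
exists dlt => // T Q pQ.
have /choice[kc kcP] : forall t, exists kc, corrector (Q t) kc.1 kc.2.
  move=> t; have [k [C h]] := corrector_ex (proj2 (proj1 pQ t)).
  by exists (k, C).
pose C := \sum_t (kc t).2; pose n : R := #|T|%:R.
have Ct t : (kc t).2 <= C.
  rewrite /C (bigD1 t)//= lerDl sumr_ge0// => i _.
  by have [_ /ltW] := kcP i.
have C0 : 0 <= C by rewrite sumr_ge0// => i _; have [_ /ltW] := kcP i.
(* The three terms keep each correction below [dlt], the sum of all corrections below 1, and the
   leftover atom below [eps / 2]. Unlike [dlt], they depend on the family [Q], through [C] and the
   number of cubes. *)
pose eta := Num.min (Num.min (dlt / (C + 1)) ((n * (C + 1) + 1)^-1)) (eps / 2 / (n * C + 1)).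
have C1 : 0 < C + 1 by rewrite ltr_wpDl.
have nC1 : 0 < n * (C + 1) + 1 by rewrite ltr_wpDl// mulr_ge0// ltW.
have nC : 0 < n * C + 1 by rewrite ltr_wpDl// mulr_ge0.
have nC1' : 0 < (n * (C + 1) + 1)^-1 by rewrite invr_gt0.
have dC : 0 < dlt / (C + 1) by exact: divr_gt0 d0 C1.
have eC : 0 < eps / 2 / (n * C + 1) by exact: divr_gt0 (divr_gt0 e0 (ltr0n _ 2)) nC.
have eta0 : 0 < eta by rewrite /eta !lt_min nC1' dC eC.
exists eta => // g mu s hg hmu sK seta mom0.
have h1 : (C + 1) * eta <= dlt.
  by rewrite mulrC -ler_pdivlMr// !ge_min lexx.
have h2 : n * (C + 1) * eta <= 1.
  rewrite (@le_trans _ _ ((n * (C + 1) + 1) * eta))//.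
    by rewrite ler_wpM2r ?(ltW eta0)// lerDl.
  by rewrite mulrC -ler_pdivlMr// mul1r !ge_min lexx orbT.
have h3 : (n * C + 1) * eta <= eps / 2.
  by rewrite mulrC -ler_pdivlMr// !ge_min lexx orbT.
have QK t : Q t `<=` K by case: (proj1 pQ t).
pose k t := (kc t).1 (mom (g t)).
have kP t : [/\ sup_ (Q t) (k t), nu (k t) <= C * eta & mom (k t) = mom (g t)].
  have [_ k0 kb km _] := kcP t; have [gs _ _ ge] := hg t.
  split; [by case: (kb (mom (g t)))| |exact: km].
  rewrite (le_trans (proj2 (kb _)))// (@le_trans _ _ ((kc t).2 * eta))//.
    by rewrite ler_wpM2l// ltW.
  by rewrite ler_wpM2r// ltW.
have gK t : sup_ K (g t) by have [gs _ _ _] := hg t; exact: am_supS (QK t) _ gs.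
have kK t : sup_ K (k t) by have [gs _ _] := kP t; exact: am_supS (QK t) _ gs.
have mu0 t : 0 <= mu t.
  by have [_ h _ _] := hg t; apply: le_trans h; exact: am_nu_ge0.
(* The corrected pieces form a chain over [Q]; the corrections and [s] together are moment-free and
   small, hence one cheap atom on the whole cube. *)
have -> : \sum_t g t + s = \sum_t (g t - k t) + (\sum_t k t + s).
  by rewrite sumrB addrA subrK.
have ksK : sup_ K (\sum_t k t + s) by apply: am_supD => //; exact: am_sup_sum.
have -> : eps = eps / 2 + eps / 2 by rewrite -splitr.
apply: hull_leD; last first.
  apply: (@hull_le_weaken _ (nu (\sum_t k t + s))).
    rewrite (le_trans _ h3)// mulrDl mul1r (le_trans (am_nuD _ _))//.
      exact: am_sup_sum.
    rewrite lerD// (le_trans (am_nu_sum _ _))//.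
    rewrite -mulrA /n -[#|T|]/(#|{: T}|) mulr_natl -sumr_const.
    by apply: ler_sum => t _; case: (kP t).
  apply: hull_le_nu => //.
  rewrite -mom0 !am_momD//; try exact: am_sup_sum.
  rewrite !am_mom_sum//; congr (_ + _); apply: eq_bigr => t _.
  by case: (kP t).
(* The correction costs at most [C * eta]; taking [C + 1] makes the coefficient strictly positive,
   as [hull_le_fchain] requires. *)
pose mu' t := mu t + (C + 1) * eta.
have := @hull_le_fchain T Q (fun t => g t - k t) mu' pQ.
set w := lqnorm _ _ => hw; apply: (@hull_le_weaken _ w); last first.
  apply: hw => t; have [g1 g2 g3 g4] := hg t; have [k1 k2 k3] := kP t; split.
  - exact: am_supB.
  - by rewrite am_momB// k3 subrr.
  - rewrite (le_trans (am_nuB _ _))// lerD// (le_trans k2)//.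
    by rewrite ler_wpM2r ?lerDl// ltW.
  - by rewrite ltr_wpDl// mulr_gt0.
have mu'0 t : 0 <= mu' t by rewrite addr_ge0// mulr_ge0// ltW.
rewrite /w (le_trans (@lqnorm_le _ _ p1 _ _ (2 * dlt) (B + 1) _ _ _))//.
- by rewrite mulr_ge0// ltW.
- move=> i; rewrite ger0_norm// mulr2n mulrDl mul1r lerD//.
  by have [] := hg (enum_val i).
- under eq_bigr do rewrite ger0_norm//.
  rewrite -(reindex _ (onW_bij _ (@enum_val_bij T)) (F := mu') (P := xpredT))/=.
  rewrite /mu' big_split/= lerD// sumr_const -mulr_natl mulrA.
  exact: h2.
- have -> : 2 * dlt = (eps / 2 / L) `^ p.
    by rewrite /dlt mulrC divfK ?pnatr_eq0.
  rewrite -/L -powRrM (mulfV (lt0r_neq0 p0)) powRr1.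
    by rewrite (divfK (lt0r_neq0 L0)).
  exact/ltW/(divr_gt0 (divr_gt0 e0 (ltr0n _ 2)) L0).
Qed.

End Atomic.

(** * Absolutely summable families *)

Section FamilySum.
Context (R : realType) (T : choiceType).
Implicit Types f g : T -> R.

Definition summ f := (\esum_(x in [set: T]) `|f x|%:E < +oo)%E.
Definition nsum f := fine (\esum_(x in [set: T]) (f x)%:E).
Definition asum f := nsum (fun x => `|f x|).
(** The formula of [lsum] over an arbitrary index type; on the cube the two are convertible. *)
Definition ssum f : R := fine (\esum_(x in [set: T]) ((EFin \o f)^\+ x))%E -
  fine (\esum_(x in [set: T]) ((EFin \o f)^\- x))%E.

Lemma summ_fin f : summ f -> (\esum_(x in [set: T]) `|f x|%:E)%E = (asum f)%:E.
Proof.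
move=> sf; rewrite /asum /nsum fineK// ge0_fin_numE//.
by apply: esum_ge0 => x _; rewrite lee_fin.
Qed.

Lemma summ_nsum f : summ f -> (forall x, 0 <= f x) ->
  (\esum_(x in [set: T]) (f x)%:E)%E = (nsum f)%:E.
Proof.
move=> sf f0; have fE : f = (fun x => `|f x|).
  by apply/funext => x; rewrite ger0_norm.
by rewrite {1}fE summ_fin// /asum -fE.
Qed.

Lemma le_summ f g : (forall x, `|f x| <= `|g x|) -> summ g -> summ f.
Proof. by move=> fg; apply: le_lt_trans; apply: le_esum => x _; rewrite lee_fin. Qed.

Lemma summD f g : summ f -> summ g -> summ (fun x => f x + g x).
Proof.
move=> sf sg; apply: le_lt_trans (lte_add_pinfty sf sg).
rewrite -esumD; try by move=> x _; rewrite lee_fin.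
by apply: le_esum => x _; rewrite -EFinD lee_fin ler_normD.
Qed.

Lemma esumZ (c : R) (h : T -> \bar R) : 0 <= c -> (forall x, 0 <= h x)%E ->
  (\esum_(x in [set: T]) (c%:E * h x) <= c%:E * \esum_(x in [set: T]) h x)%E.
Proof.
move=> c0 h0; apply: ge_ereal_sup => _ [A [fA _] <-].
rewrite -ge0_mule_fsumr//; apply: lee_wpmul2l; first by rewrite lee_fin.
by apply: ereal_sup_ubound; exists A.
Qed.

Lemma summZ c f : summ f -> summ (fun x => c * f x).
Proof.
move=> sf; apply: (@le_lt_trans _ _ (`|c|%:E * \esum_(x in [set: T]) `|f x|%:E)%E).
  apply: le_trans (esumZ (normr_ge0 c) _); last by move=> x; rewrite lee_fin.
  by apply: le_esum => x _; rewrite normrM EFinM.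
by rewrite summ_fin// -EFinM ltry.
Qed.

Lemma summ0 : summ (fun=> 0).
Proof. by rewrite /summ esum1 ?ltry// => x _; rewrite normr0. Qed.

Lemma nsumD f g : summ f -> summ g -> (forall x, 0 <= f x) -> (forall x, 0 <= g x) ->
  nsum (fun x => f x + g x) = nsum f + nsum g.
Proof.
move=> sf sg f0 g0; apply: EFin_inj; rewrite EFinD -!summ_nsum//.
- by rewrite -esumD// => x _; rewrite lee_fin.
- exact: summD.
- by move=> x; rewrite addr_ge0.
Qed.

Lemma nsum_ge0 f : (forall x, 0 <= f x) -> 0 <= nsum f.
Proof. by move=> f0; apply: fine_ge0; apply: esum_ge0 => x _; rewrite lee_fin. Qed.

Lemma le_nsum f g : summ g -> (forall x, 0 <= f x <= g x) -> nsum f <= nsum g.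
Proof.
move=> sg fg; have f0 x : 0 <= f x by case/andP: (fg x).
have g0 x : 0 <= g x by case/andP: (fg x) => /le_trans; apply.
rewrite -lee_fin -!summ_nsum//; last first.
  by apply: le_summ sg => x; rewrite !ger0_norm//; case/andP: (fg x).
by apply: le_esum => x _; rewrite lee_fin; case/andP: (fg x).
Qed.

Lemma nsumZ c f : 0 <= c -> summ f -> (forall x, 0 <= f x) ->
  nsum (fun x => c * f x) = c * nsum f.
Proof.
move=> c0 sf f0.
have le1 a g : 0 <= a -> summ g -> (forall x, 0 <= g x) ->
    nsum (fun x => a * g x) <= a * nsum g.
  move=> a0 sg g0; rewrite -lee_fin EFinM -!summ_nsum//.
  - by rewrite (le_trans _ (esumZ a0 _))// => x; rewrite lee_fin.
  - exact: summZ.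
  - by move=> x; rewrite mulr_ge0.
apply/eqP; rewrite eq_le le1//=.
have [->|cn0] := eqVneq c 0.
  by rewrite mul0r nsum_ge0// => x; rewrite mul0r.
have cp : 0 < c by rewrite lt_neqAle eq_sym cn0.
rewrite -ler_pdivlMl//.
have -> : nsum f = nsum (fun x => c^-1 * (c * f x)).
  by congr nsum; apply/funext => x; rewrite mulKf.
apply: le1; first by rewrite invr_ge0.
  exact: summZ.
by move=> x; rewrite mulr_ge0.
Qed.

Lemma asum_ge0 f : 0 <= asum f. Proof. exact: nsum_ge0. Qed.

Lemma summ_norm f : summ f -> summ (fun x => `|f x|).
Proof. by apply: le_summ => x; rewrite normr_id. Qed.

Lemma asumD f g : summ f -> summ g -> asum (fun x => f x + g x) <= asum f + asum g.
Proof.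
move=> sf sg; rewrite /asum -nsumD//; try exact: summ_norm.
apply: le_nsum => [|x]; first by apply: summD; exact: summ_norm.
by rewrite normr_ge0 ler_normD.
Qed.

Lemma asumZ c f : summ f -> asum (fun x => c * f x) = `|c| * asum f.
Proof.
move=> sf; rewrite /asum -nsumZ//; last exact: summ_norm.
by congr nsum; apply/funext => x; rewrite normrM.
Qed.

Let pos f x := Num.max (f x) 0.
Let neg f x := Num.max (- f x) 0.

Let pos_ge0 f x : 0 <= pos f x. Proof. by rewrite le_max lexx orbT. Qed.
Let neg_ge0 f x : 0 <= neg f x. Proof. by rewrite le_max lexx orbT. Qed.
Let posBneg f x : pos f x - neg f x = f x.
Proof.
by rewrite /pos /neg; case: (leP (f x) 0) => h; case: (leP (- f x) 0) => h'; lra.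
Qed.
Let posDneg f x : pos f x + neg f x = `|f x|.
Proof.
by rewrite /pos /neg; case: (leP (f x) 0) => h; case: (leP (- f x) 0) => h';
  [rewrite ler0_norm|rewrite ler0_norm|rewrite gtr0_norm|rewrite gtr0_norm]; lra.
Qed.
Let summ_pos f : summ f -> summ (pos f).
Proof.
apply: le_summ => x; rewrite ger0_norm// -posDneg lerDl//; exact: neg_ge0.
Qed.
Let summ_neg f : summ f -> summ (neg f).
Proof.
apply: le_summ => x; rewrite ger0_norm// -posDneg lerDr//; exact: pos_ge0.
Qed.

Let ssumE f : ssum f = nsum (pos f) - nsum (neg f).
Proof.
rewrite /ssum; congr (fine _ - fine _); apply: eq_esum => x _.
  by rewrite funeposE EFin_max.
by rewrite funenegE EFin_max.
Qed.

(** Any decomposition into nonnegative summable parts computes the sum, not only the one into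
    positive and negative parts. Additivity reduces to this. *)
Lemma ssumB f g : summ f -> summ g -> (forall x, 0 <= f x) -> (forall x, 0 <= g x) ->
  ssum (fun x => f x - g x) = nsum f - nsum g.
Proof.
move=> sf sg f0 g0; set h := fun x => f x - g x.
have sh : summ h.
  by apply: summD => //; apply: le_summ sg => x; rewrite normrN.
rewrite ssumE; apply/eqP; rewrite subr_eq addrAC eq_sym subr_eq; apply/eqP.
rewrite -!nsumD//; try exact: summ_pos; try exact: summ_neg.
congr nsum; apply/funext => x; have := posBneg h x; rewrite /h; lra.
Qed.

Lemma ssumD f g : summ f -> summ g -> ssum (fun x => f x + g x) = ssum f + ssum g.
Proof.
move=> sf sg.
have -> : (fun x => f x + g x) = (fun x => (pos f x + pos g x) - (neg f x + neg g x)).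
  by apply/funext => x; rewrite -[in LHS](posBneg f) -[in LHS](posBneg g); lra.
rewrite ssumB; try (by apply: summD; try exact: summ_pos; exact: summ_neg);
  try by move=> x; rewrite addr_ge0.
rewrite !nsumD//; try exact: summ_pos; try exact: summ_neg.
rewrite !ssumE; lra.
Qed.

Lemma ssumN f : ssum (fun x => - f x) = - ssum f.
Proof.
rewrite !ssumE opprB; congr (nsum _ - nsum _); apply/funext => x.
by rewrite /neg opprK.
Qed.

Lemma ssumZ c f : summ f -> ssum (fun x => c * f x) = c * ssum f.
Proof.
move=> sf; wlog c0 : c / 0 <= c.
  move=> h; have [c0|c0] := leP 0 c; first exact: h.
  have := h (- c); rewrite oppr_ge0 => /(_ (ltW c0)).
  under eq_fun do rewrite mulNr.
  by rewrite ssumN mulNr => /oppr_inj.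
have -> : (fun x => c * f x) = (fun x => c * pos f x - c * neg f x).
  by apply/funext => x; rewrite -mulrBr posBneg.
rewrite ssumB; try (by apply: summZ; try exact: summ_pos; exact: summ_neg);
  try by move=> x; rewrite mulr_ge0.
rewrite !nsumZ//; try exact: summ_pos; try exact: summ_neg.
by rewrite -mulrBr ssumE.
Qed.

Lemma ler_norm_ssum f : summ f -> `|ssum f| <= asum f.
Proof.
move=> sf; rewrite ssumE (le_trans (ler_normB _ _))//.
rewrite !ger0_norm ?nsum_ge0// -nsumD//; try exact: summ_pos; try exact: summ_neg.
by rewrite /asum (_ : (fun x => _) = (fun x => `|f x|))//; apply/funext => x.
Qed.

Definition delta (x : T) : T -> R := fun y => (y == x)%:R.

Lemma esum_delta (c : R) x : 0 <= c ->
  (\esum_(y in [set: T]) (c * delta x y)%:E)%E = c%:E.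
Proof.
move=> c0; rewrite (_ : (fun y => _) = (fun y => if y \in [set x] then c%:E else 0%E)).
  by rewrite -esum_mkcond esum_set1.
by apply/funext => y; rewrite in_set1 /delta; case: eqP; rewrite ?mulr1 ?mulr0.
Qed.

Lemma summ_delta x : summ (delta x).
Proof.
rewrite /summ (_ : (fun y => _) = (fun y => (1 * delta x y)%:E)).
  by rewrite esum_delta// ltry.
by apply/funext => y; rewrite mul1r ger0_norm// ler0n.
Qed.

Lemma asum_delta x : asum (delta x) = 1.
Proof.
rewrite /asum /nsum (_ : (fun y => _) = (fun y => (1 * delta x y)%:E)).
  by rewrite esum_delta.
by apply/funext => y; rewrite mul1r ger0_norm// ler0n.
Qed.

Lemma ssum_delta (g : T -> R) x : ssum (fun y => g y * delta x y) = g x.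
Proof.
have -> : (fun y => g y * delta x y) = (fun y => g x * delta x y).
  by apply/funext => y; rewrite /delta; case: eqP => [->//|_]; rewrite !mulr0.
rewrite ssumZ ?summ_delta//.
have -> : delta x = (fun y => delta x y - 0) by apply/funext => y; rewrite subr0.
rewrite ssumB//; last 2 first.
- exact: summ_delta.
- exact: summ0.
have -> : nsum (delta x) = 1.
  by rewrite -(asum_delta x) /asum; congr nsum; apply/funext => y; rewrite ger0_norm// ler0n.
by rewrite /nsum esum1// subr0 mulr1.
Qed.

(** Written as a combination of point masses, so that a linear functional applied to it becomes a
    finite sum. *)
Definition trunc (s : seq T) f : T -> R := \sum_(x <- s) f x *: delta x.

Lemma truncE s f : uniq s -> trunc s f = (fun y => if y \in s then f y else 0).
Proof.
move=> us; apply/funext => y; rewrite /trunc fct_sumE.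
have E x : (f x *: delta x) y = if x == y then f y else 0.
  have -> : (f x *: delta x) y = f x * delta x y by [].
  by rewrite /delta eq_sym; case: eqP => [->|_]; rewrite ?mulr1 ?mulr0.
rewrite (eq_bigr _ (fun x _ => E x)); case: ifPn => ys.
  by rewrite (bigD1_seq y)//= eqxx big1 ?addr0// => i /negbTE->.
rewrite big_seq big1// => i si; case: eqP => // iy.
by move: ys; rewrite -iy si.
Qed.

Lemma sum_le_asum f s : uniq s -> summ f -> \sum_(x <- s) `|f x| <= asum f.
Proof.
move=> us sf; rewrite -lee_fin -summ_fin// -sumEFin; apply: esum_ge.
exists [set` s]; first by split => //; exact: finite_seq.
by rewrite -fsbig_seq.
Qed.

Lemma trunc_tail f e : summ f -> 0 < e ->
  exists2 s, uniq s & asum (fun x => f x - trunc s f x) <= e.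
Proof.
move=> sf e0; have := summ_fin sf => fE.
have : ((asum f - e)%:E < \esum_(x in [set: T]) `|f x|%:E)%E.
  by rewrite fE lte_fin ltrBlDr ltrDl.
move=> /ereal_sup_gt[_ [A [fA _] <-]].
rewrite fsbig_finite//= sumEFin lte_fin; set s := finmap.enum_fset _ => sA.
have us : uniq s by exact: finmap.fset_uniq.
exists s => //.
have st : summ (trunc s f).
  by apply: le_summ sf => x; rewrite truncE//; case: ifP => // _; rewrite normr0.
have sB : summ (fun x => f x - trunc s f x).
  apply: le_summ sf => x; rewrite truncE//; case: ifP => // _; last by rewrite subr0.
  by rewrite subrr normr0.
have : asum f = asum (fun x => f x - trunc s f x) + asum (trunc s f).
  rewrite /asum -nsumD//; try exact: summ_norm.
  congr nsum; apply/funext => x; rewrite truncE//; case: ifP => _.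
    by rewrite subrr normr0 add0r.
  by rewrite subr0 normr0 addr0.
have : \sum_(x <- s) `|f x| <= asum (trunc s f).
  apply: le_trans (sum_le_asum us st); rewrite big_seq [leRHS]big_seq.
  by apply: ler_sum => x xs; rewrite truncE// xs.
move: sA; lra.
Qed.

End FamilySum.

(** * Point masses *)

Section Boxes.
Context (R : realType) (d : nat).
Implicit Types (x y c : 'rV[R]_d) (r : R).

Definition cbox c r : set 'rV[R]_d := [set y | forall i, c 0 i <= y 0 i <= c 0 i + r].
Definition obox c r : set 'rV[R]_d := [set y | forall i, c 0 i < y 0 i < c 0 i + r].

Lemma cube_cbox c r : 0 < r -> cube (cbox c r).
Proof. by move=> r0; exists c, r. Qed.

Lemma interior_cbox c r : (cbox c r)° = obox c r.
Proof.
apply/seteqP; split=> y.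
  rewrite /interior /= => /nbhs_ballP[e /= e0 h] i.
  have e20 : 0 < e / 2 by rewrite divr_gt0.
  have hb s : `|s| < e -> cbox c r (y + const_mx s).
    move=> se; apply: h; split=> // j l; rewrite /ball /= !mxE opprD addNKr normrN.
    by [].
  have e2 : `|e / 2| < e by rewrite gtr0_norm// ltr_pdivrMr// mulr2n mulrDr mulr1 ltrDl.
  have e2N : `|- (e / 2)| < e by rewrite normrN.
  have := hb _ e2 i; have := hb _ e2N i; rewrite !mxE => /andP[h1 h2] /andP[h3 h4].
  by apply/andP; split; lra.
move=> hy; rewrite /interior /=.
pose e i := Num.min (y 0 i - c 0 i) (c 0 i + r - y 0 i).
have e0 i : 0 < e i by have /andP[h1 h2] := hy i; rewrite lt_min !subr_gt0 h1 h2.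
pose m := \big[Num.min/1]_i e i.
have m0 : 0 < m by apply: lt_bigmin => // i _; exact: e0.
apply/nbhs_ballP; exists m => //= z [_ yz] i; have := yz 0 i; rewrite /ball /=.
have : m <= e i by exact: bigmin_le_cond.
rewrite le_min => /andP[h1 h2]; rewrite ltr_norml => /andP[h3 h4].
by apply/andP; split; lra.
Qed.

(** A common interior point is found coordinatewise. If both cubes extend to the right of [x], go
    halfway to the nearer right end; otherwise [x] is at the right end of both, and one goes halfway
    to the larger left end. *)
Lemma obox_meet c r c' r' x : cbox c r x -> cbox c' r' x -> 0 < r -> 0 < r' ->
  (forall i, (x 0 i < c 0 i + r) = (x 0 i < c' 0 i + r')) ->
  obox c r `&` obox c' r' !=set0.
Proof.
move=> xc xc' r0 r'0 h.
exists (\row_i if x 0 i < c 0 i + r then (x 0 i + Num.min (c 0 i + r) (c' 0 i + r')) / 2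
   else (x 0 i + Num.max (c 0 i) (c' 0 i)) / 2).
split=> i; rewrite mxE; have := h i; have /andP[h1 h2] := xc i;
  have /andP[h3 h4] := xc' i; case: ifPn => xi /esym xi'.
- apply/andP; case: (leP (c 0 i + r) (c' 0 i + r')) => h5; split; lra.
- move: xi xi'; rewrite -!leNgt => xi /negbT; rewrite -leNgt => xi'.
  apply/andP; case: (leP (c 0 i) (c' 0 i)) => h5; split; lra.
- apply/andP; case: (leP (c 0 i + r) (c' 0 i + r')) => h5; split; lra.
- move: xi xi'; rewrite -!leNgt => xi /negbT; rewrite -leNgt => xi'.
  apply/andP; case: (leP (c 0 i) (c' 0 i)) => h5; split; lra.
Qed.

(* Near a point [x] every cube containing [x] fills one of the 2^d orthants. *)
Lemma packing_overlap n (Q : 'I_n -> set 'rV[R]_d) x : packing Q ->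
  (#|[pred i | `[< Q i x >]]| <= 2 ^ d)%N.
Proof.
move=> [Q1 Q2]; have /choice[cr crP] : forall i, exists cr : 'rV[R]_d * R,
    0 < cr.2 /\ Q i = cbox cr.1 cr.2.
  by move=> i; have [[c [r h]] _] := Q1 i; exists (c, r).
pose f i : {ffun 'I_d -> bool} := [ffun j => x 0 j < (cr i).1 0 j + (cr i).2].
have <- : #|{ffun 'I_d -> bool}| = (2 ^ d)%N by rewrite card_ffun card_bool card_ord.
rewrite -(@card_in_imset _ _ f) ?max_card// => i j.
rewrite !inE => /asboolP/asboolP xi /asboolP/asboolP xj fij; apply: Q2 => //.
have [ri Qi] := crP i; have [rj Qj] := crP j.
rewrite Qi Qj !interior_cbox; apply: (@obox_meet _ _ _ _ x) => //.
- by rewrite -Qi.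
- by rewrite -Qj.
- by move=> l; have := congr1 (fun g : {ffun _ -> _} => g l) fij; rewrite !ffunE.
Qed.

End Boxes.

(** * Moment vectors and monomials on the unit cube *)

Section Moments.
Context (R : realType) (d k : nat).

(** A multi-index of degree less than [k] has all its entries below [k], so it appears in this
    finite type; [momvec] puts 0 at the indices of degree at least [k]. *)
Definition mindex := {ffun 'I_d -> 'I_k}.

Definition momvec (F : ('I_d -> nat) -> R) : 'rV[R]_#|{: mindex}| :=
  \row_i if (\sum_j (enum_val i : mindex) j < k)%N
         then F (fun j => (enum_val i : mindex) j) else 0.

Lemma momvec_eq0 F : momvec F = 0 <->
  forall alpha, (\sum_j alpha j < k)%N -> F alpha = 0.
Proof.
split=> [/rowP h alpha ak|h]; last first.
  by apply/rowP => i; rewrite !mxE; case: ifP => // /h.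
have aj j : (alpha j < k)%N by apply: leq_ltn_trans ak; rewrite (bigD1 j)//= leq_addr.
pose b : mindex := [ffun j => Ordinal (aj j)].
have bE : alpha = (fun j => b j) by apply/funext => j; rewrite ffunE.
have := h (enum_rank b); rewrite !mxE enum_rankK -bE.
rewrite (_ : (\sum_j _)%N = (\sum_j alpha j)%N) ?ak//.
by apply: eq_bigr => j _; rewrite ffunE.
Qed.

Lemma momvecP a F G H : (forall alpha, (\sum_j alpha j < k)%N ->
  F alpha = a * G alpha + H alpha) -> momvec F = a *: momvec G + momvec H.
Proof.
by move=> h; apply/rowP => i; rewrite !mxE; case: ifP => [/h//|_]; rewrite mulr0 addr0.
Qed.

Lemma eq_momvec F G : (forall alpha, (\sum_j alpha j < k)%N -> F alpha = G alpha) ->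
  momvec F = momvec G.
Proof. by move=> h; apply/rowP => i; rewrite !mxE; case: ifP => [/h|]. Qed.

Lemma momvecB F G : momvec F - momvec G = momvec (fun alpha => F alpha - G alpha).
Proof. by apply/rowP => i; rewrite !mxE; case: ifP => // _; rewrite subr0. Qed.

Lemma mnorm_momvec F e : 0 <= e -> (forall alpha, (\sum_j alpha j < k)%N -> `|F alpha| <= e) ->
  mnorm (momvec F) <= #|{: mindex}|%:R * e.
Proof.
move=> e0 h; rewrite /mnorm (@le_trans _ _ (\sum_(j < #|{: mindex}|) e))//; last first.
  by rewrite sumr_const card_ord mulr_natl.
apply: ler_sum => i _; rewrite mxE; case: ifP => [/h//|_]; rewrite normr0 //.
Qed.

Local Notation K := (unit_cube R d).

Lemma monomial01 alpha x (s : seq 'I_d) : K x ->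
  0 <= \prod_(i <- s) x 0 i ^+ alpha i <= 1.
Proof.
move=> Kx; elim/big_ind: _ => [|a b /andP[a0 a1] /andP[b0 b1]|i _].
- by rewrite ler01 lexx.
- by rewrite mulr_ge0// mulr_ile1.
- by have /andP[h1 h2] := Kx i; rewrite exprn_ge0// exprn_ile1.
Qed.

Lemma monomial_ge0 alpha x : K x -> 0 <= monomial alpha x.
Proof. by move=> /(monomial01 alpha (index_enum _))/andP[]. Qed.

Lemma monomial_le1 alpha x : K x -> monomial alpha x <= 1.
Proof.
by move=> /(monomial01 alpha (index_enum _))/andP[].
Qed.

(** All factors lie in [[0, 1]], so exchanging them one at a time costs [e] each, and there are
    fewer than [k] of them. *)
Lemma monomial_lip alpha x y e : 0 <= e -> K x -> K y -> (forall i, `|x 0 i - y 0 i| <= e) ->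
  (\sum_j alpha j < k)%N -> `|monomial alpha x - monomial alpha y| <= k%:R * e.
Proof.
move=> e0 Kx Ky xy ak.
have p1 (a b : R) n : 0 <= a <= 1 -> 0 <= b <= 1 -> `|a - b| <= e ->
    `|a ^+ n - b ^+ n| <= n%:R * e.
  move=> /andP[a0 a1] /andP[b0 b1] ab; elim: n => [|n IH].
    by rewrite !expr0 subrr normr0 mul0r.
  have -> : a ^+ n.+1 - b ^+ n.+1 = a * (a ^+ n - b ^+ n) + (a - b) * b ^+ n.
    by rewrite !exprS; ring.
  rewrite (le_trans (ler_normD _ _))// -natr1 [leRHS]mulrDl mul1r lerD//.
    by rewrite normrM ger0_norm// (le_trans _ IH)// ler_piMl.
  by rewrite normrM (le_trans _ ab)// ler_piMr// ger0_norm ?exprn_ge0// exprn_ile1.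
suff h (s : seq 'I_d) : `|\prod_(i <- s) x 0 i ^+ alpha i - \prod_(i <- s) y 0 i ^+ alpha i|
    <= (\sum_(i <- s) alpha i)%:R * e.
  by rewrite (le_trans (h _))// ler_wpM2r// ler_nat ltnW.
elim: s => [|i s IH]; first by rewrite !big_nil subrr normr0 mul0r.
rewrite !big_cons natrD mulrDl; set a := x 0 i ^+ _; set b := y 0 i ^+ _.
set A := \prod_(j <- s) _; set B := \prod_(j <- s) _.
have -> : a * A - b * B = (a - b) * A + b * (A - B) by ring.
rewrite (le_trans (ler_normD _ _))// lerD//.
  rewrite normrM (le_trans _ (p1 _ _ _ (Kx i) (Ky i) (xy i)))// ler_piMr//.
  by have /andP[A0 A1] := monomial01 alpha s Kx; rewrite ger0_norm.
rewrite normrM (le_trans _ IH)// ler_piMl//; have /andP[h1 h2] := Ky i.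
by rewrite ger0_norm ?exprn_ge0// exprn_ile1.
Qed.

End Moments.

Section EllOneModel.
Context (R : realType) (d k : nat).
Local Notation K := (unit_cube R d).
Local Notation T := (unit_cube R d).
Implicit Types a f g : T -> R.

Lemma lp1_summ a : lp 1 a <-> summ a.
Proof.
rewrite /lp /lp_mass /summ /=; rewrite (_ : (fun x => _) = (fun x => `|a x|%:E))//.
by apply/funext => x; rewrite powRr1.
Qed.

Lemma lp1_norm a : lp_norm 1 a = asum a.
Proof.
rewrite /lp_norm /lp_mass invr1 powRr1; last first.
  by apply: fine_ge0; apply: esum_ge0 => x _; rewrite lee_fin powR_ge0.
by congr fine; apply: eq_esum => x _; rewrite powRr1.
Qed.

Definition l1_sup (Q : set 'rV[R]_d) : set (T -> R) :=
  [set a | summ a /\ forall x : T, ~ Q (set_val x) -> a x = 0].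

Definition l1_mom a : 'rV[R]_#|{: mindex d k}| :=
  momvec k (fun alpha => lsum (fun x : T => monomial alpha (set_val x) * a x)).

Lemma set_val_unit (x : T) : K (set_val x). Proof. exact: set_valP. Qed.

Lemma summM (phi : T -> R) C a : (forall x, `|phi x| <= C) -> summ a ->
  summ (fun x => phi x * a x).
Proof.
move=> h sa; apply: (@le_summ _ _ _ (fun x => C * a x)); last exact: summZ.
by move=> x; rewrite !normrM ler_wpM2r// (le_trans (h x)) ?ler_norm.
Qed.

Lemma summ_monomial alpha a : summ a -> summ (fun x : T => monomial alpha (set_val x) * a x).
Proof.
apply: (@summM _ 1) => x; rewrite ger0_norm.
  exact/monomial_le1/set_val_unit.
exact/monomial_ge0/set_val_unit.
Qed.

Lemma summ_lin c f g : summ f -> summ g -> summ (c *: f + g).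
Proof. by move=> sf sg; apply: (summD (summZ c sf) sg). Qed.

Lemma lsumP (phi : T -> R) C c f g : (forall x, `|phi x| <= C) -> summ f -> summ g ->
  lsum (fun x => phi x * (c *: f + g) x) =
  c * lsum (fun x => phi x * f x) + lsum (fun x => phi x * g x).
Proof.
move=> h sf sg; have sf' := summM h sf; have sg' := summM h sg.
have := ssumD (summZ c sf') sg'; rewrite ssumZ// => <-.
by congr (@ssum R T _); apply/funext => x; rewrite mulrDr mulrCA.
Qed.

Lemma monomial_bound alpha (x : T) : `|monomial alpha (set_val x)| <= 1.
Proof.
rewrite ger0_norm; last exact/monomial_ge0/set_val_unit.
exact/monomial_le1/set_val_unit.
Qed.

Definition l1_model : atomic_model #|{: mindex d k}| (@l1_atom R d k).
Proof.
apply: (@AtomicModel _ _ _ _ _ l1_sup (@asum R T) l1_mom).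
- by move=> Q; split=> //; exact: summ0.
- move=> Q c f g [sf f0] [sg g0]; split; first exact: summ_lin.
  by move=> x Qx; rewrite !fctE f0// g0// scaler0 addr0.
- by move=> Q Q' QQ' a [sa a0]; split=> // x Qx; apply: a0 => /QQ'.
- by move=> f g [sf _] [sg _]; exact: asumD.
- by move=> c f [sf _]; exact: asumZ.
- move=> c f g [sf _] [sg _]; apply: momvecP => alpha _.
  exact: (lsumP c (monomial_bound alpha)).
- move=> Q a QK; split.
    move=> [/lp1_summ sa a0 a1 am]; split=> //; first by rewrite -lp1_norm.
    exact/momvec_eq0.
  move=> [[sa a0] a1 am]; split=> //; first exact/lp1_summ.
    by rewrite lp1_norm.
  exact/momvec_eq0.
Defined.

Lemma delta_sup Q (x : T) : Q (set_val x) -> l1_sup Q (delta R x).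
Proof.
move=> Qx; split; first exact: summ_delta.
by move=> y Qy; rewrite /delta; case: eqP => // yx; case: Qy; rewrite yx.
Qed.

Lemma l1_mom_delta (x : T) : l1_mom (delta R x) = momvec k (fun alpha => monomial alpha (set_val x)).
Proof. by apply: eq_momvec => alpha _; exact: (ssum_delta (fun y => monomial alpha (set_val y))). Qed.

Lemma trunc_sup Q s a : uniq s -> l1_sup Q a -> l1_sup Q (trunc s a).
Proof.
move=> us [sa a0]; rewrite truncE//; split.
  by apply: le_summ sa => x; case: ifP => // _; rewrite normr0.
by move=> x Qx; rewrite a0//; case: ifP.
Qed.

End EllOneModel.

Lemma seq_max (R : realDomainType) (T : eqType) (F : T -> R) x0 s :
  exists2 x, x \in x0 :: s & forall y, y \in x0 :: s -> F y <= F x.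
Proof.
elim: s x0 => [|z s IH] x0.
  by exists x0 => [|y]; rewrite ?mem_head// inE => /eqP->.
have [x xs xmax] := IH z; have [h|/ltW h] := leP (F x0) (F x).
  exists x => [|y]; first by rewrite inE xs orbT.
  by rewrite inE => /predU1P[->|/xmax].
exists x0 => [|y]; first exact: mem_head.
by rewrite inE => /predU1P[->//|/xmax/le_trans]; apply.
Qed.

(** The functional is a bare function on all families; linearity and the bound are demanded on
    summable ones only, which spares a separate type for l_1. *)
Definition l1_bounded (R : realType) (d : nat) (lam : (unit_cube R d -> R) -> R) (C : R) :=
  (forall c f g, summ f -> summ g -> lam (c *: f + g) = c * lam f + lam g) /\
  (forall f, summ f -> `|lam f| <= C * asum f).

Section PointFunctional.
Context (R : realType) (d k : nat) (p : R) (p1 : 1 <= p).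
Local Notation K := (unit_cube R d).
Local Notation T := (unit_cube R d).
Context (lam : (T -> R) -> R) (C : R) (phi : T -> R).
Context (lamP : l1_bounded lam C) (phiE : forall x, lam (delta R x) = phi x).

Let lam0 : lam 0 = 0.
Proof.
have := lamP.1 1 0 0 (summ0 _ _) (summ0 _ _).
by rewrite scaler0 addr0 mul1r => /eqP; rewrite -subr_eq0 opprD addNKr oppr_eq0 => /eqP.
Qed.

Lemma l1_bounded_sum (I : Type) (r : seq I) (c : I -> R) (f : I -> T -> R) :
  (forall i, summ (f i)) ->
  lam (\sum_(i <- r) c i *: f i) = \sum_(i <- r) c i * lam (f i).
Proof.
move=> sf; suff [//] : summ (\sum_(i <- r) c i *: f i) /\
  lam (\sum_(i <- r) c i *: f i) = \sum_(i <- r) c i * lam (f i).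
elim/big_rec2: _ => [|i x y _ [sy my]]; first by split; [exact: summ0|exact: lam0].
by split; [exact: summ_lin|rewrite lamP.1// my].
Qed.

Let C_ge0 (x : T) : 0 <= C.
Proof.
have := lamP.2 _ (summ_delta R x); rewrite asum_delta mulr1.
exact: le_trans.
Qed.

(** On the unit ball of l_1 a functional is at most its supremum over point masses. Truncating [a]
    to finitely many points turns the supremum into a maximum, attained at [x]; the slack [e] pays
    for the tail. *)
Lemma atom_point Q a e : Q `<=` K -> Q !=set0 -> l1_sup Q a -> asum a <= 1 -> 0 < e ->
  exists2 x : T, Q (set_val x) & `|lam a| <= `|phi x| + e.
Proof.
move=> QK [y Qy] [sa a0] a1 e0.
pose x0 : T := SigSub (mem_set (QK _ Qy)).
have C0 := C_ge0 x0; have C1 : 0 < C + 1 by rewrite ltr_wpDl.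
have [s us sE] := trunc_tail sa (divr_gt0 e0 C1).
have st : l1_sup Q (trunc s a) by exact: trunc_sup.
have st1 := st.1.
have x0t : `[< Q (set_val x0) >] by apply/asboolP.
(* The default [x0], a point of [Q], keeps the list nonempty even if no point of [s] lies in [Q]. *)
have [x xt xmax] := seq_max (fun x => `|phi x|) x0 [seq x <- s | `[< Q (set_val x) >]].
have Qx : Q (set_val x).
  move: xt; rewrite inE => /predU1P[->|]; first exact/asboolP.
  by rewrite mem_filter => /andP[/asboolP].
exists x => //.
have sB : summ (fun x => a x - trunc s a x).
  by apply: (summD sa); apply: le_summ st.1 => y'; rewrite normrN.
have aE : a = 1 *: trunc s a + (fun x => a x - trunc s a x).
  by apply/funext => y'; rewrite !fctE scale1r addrC subrK.
rewrite {1}aE lamP.1 ?mul1r//.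
rewrite (le_trans (ler_normD _ _))// lerD//; last first.
  rewrite (le_trans (lamP.2 _ sB))// (@le_trans _ _ (C * (e / (C + 1))))//.
    by rewrite ler_wpM2l.
  by rewrite mulrA ler_pdivrMr// mulrC ler_wpM2l ?(ltW e0)// lerDl.
rewrite /trunc l1_bounded_sum => [|i]; last exact: summ_delta.
rewrite (le_trans (ler_norm_sum _ _ _))//.
rewrite (@le_trans _ _ (\sum_(y <- s) `|a y| * `|phi x|))//.
  rewrite big_seq [leRHS]big_seq ler_sum// => z zs; rewrite phiE normrM.
  have [Qz|Qz] := pselect (Q (set_val z)); last first.
    rewrite (a0 _ Qz) normr0.
    by move: `|phi z| `|phi x| => u v; rewrite !mul0r.
  apply: ler_wpM2l; [exact: normr_ge0|apply: xmax].
  rewrite inE mem_filter zs andbT; apply/orP; right.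
  exact/asboolP.
by rewrite -mulr_suml ler_piMl// (le_trans (sum_le_asum us sa)).
Qed.

(* Hoelder over the cubes of a packing; a point lies in at most [2 ^ d] of them. *)
Lemma l1_bounded_hull (B : R) : 0 <= B ->
  (forall s : seq T, uniq s -> \sum_(x <- s) `|phi x| `^ p <= B `^ p) ->
  forall f : hull (@l1_atom R d k),
  `|lam (val f)| <= (2 ^ d)%:R `^ p^-1 * B * atomic_seminorm (@l1_atom R d k) p1 f.
Proof.
move=> B0 hB f; have p0 := p_gt0 p1.
set D := (2 ^ d)%:R `^ p^-1 * B; have D0 : 0 <= D by rewrite mulr_ge0// powR_ge0.
have chain b w : chain_repr p (@l1_atom R d k) b w -> summ b /\ `|lam b| <= D * w.
  move=> [n [Q [c [a [[Q1 Q2] aQ -> ->]]]]].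
  have aQ' i : l1_sup (Q i) (a i) /\ asum (a i) <= 1.
    by have /(am_atomP (l1_model R d k) _ (proj2 (Q1 i)))[] := aQ i.
  have Qn i : Q i !=set0.
    have [[c0 [r [r0 ->]]] _] := Q1 i; exists c0 => j /=.
    by rewrite lexx lerDl ltW.
  split.
    elim/big_ind: _ => [|f1 f2 h1 h2|i _]; [exact: summ0|exact: summD|].
    by apply: summZ; case: (aQ' i) => -[].
  rewrite l1_bounded_sum => [|i]; last by case: (aQ' i) => -[].
  rewrite (le_trans (ler_norm_sum _ _ _))//.
  apply/ler_addgt0Pr => e e0; pose S := \sum_i `|c i|.
  have S1 : 0 < S + 1 by rewrite ltr_wpDl// sumr_ge0.
  have /choice[x xP] : forall i, exists x : T, Q i (set_val x) /\
      `|lam (a i)| <= `|phi x| + e / (S + 1).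
    move=> i; have [s1 s2] := aQ' i.
    have [x h1 h2] := atom_point (proj2 (Q1 i)) (Qn i) s1 s2 (divr_gt0 e0 S1).
    by exists x.
  rewrite (@le_trans _ _ (\sum_i (`|c i| * `|phi (x i)| + `|c i| * (e / (S + 1)))))//.
    apply: ler_sum => i _; rewrite normrM -mulrDr ler_wpM2l//.
    by case: (xP i).
  rewrite big_split/= lerD//; last first.
    by rewrite -mulr_suml -/S mulrCA ler_piMr ?(ltW e0)// ler_pdivrMr// mul1r lerDl.
  rewrite (le_trans (hoelder_lqnorm p1 _ _))// mulrC ler_wpM2r ?lqnorm_ge0//.
  have -> : D = ((2 ^ d)%:R * B `^ p) `^ p^-1.
    by rewrite powRM ?powR_ge0// -powRrM (mulfV (lt0r_neq0 p0)) powRr1.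
  rewrite ge0_ler_powR ?invr_ge0 ?(ltW p0)// ?nnegrE ?mulr_ge0 ?powR_ge0 ?sumr_powR_ge0//.
  (* The points [x i] may coincide. Listed once in [u], a point [y] is counted for at most as many
     indices as there are cubes containing it, hence at most [2 ^ d] times. *)
  pose u := undup [seq x i | i <- enum 'I_n].
  have uu : uniq u by exact: undup_uniq.
  pose F y := `|phi y| `^ p.
  rewrite (@le_trans _ _ (\sum_(y <- u) (2 ^ d)%:R * F y))//; last first.
    by rewrite -mulr_sumr ler_wpM2l// hB.
  rewrite (@le_trans _ _ (\sum_i \sum_(y <- u) (y == x i)%:R * F y))//.
    apply: ler_sum => i _; rewrite (bigD1_seq (x i))//=; last first.
      by rewrite mem_undup map_f// mem_enum.
    by rewrite eqxx mul1r lerDl sumr_ge0// => y _; rewrite mulr_ge0// powR_ge0.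
  rewrite exchange_big ler_sum// => y _; rewrite -mulr_suml ler_wpM2r ?powR_ge0//.
  rewrite -natr_sum ler_nat.
  apply: leq_trans (packing_overlap (set_val y) (conj Q1 Q2)).
  rewrite -sum1_card [leqRHS]big_mkcond leq_sum// => i _.
  rewrite inE; case: eqP => // ->; case: asboolP => //.
  by case: (xP i).
apply/ler_addgt0Pr => e e0; have D1 : 0 < D + 1 by rewrite ltr_wpDl.
have [m [b [w [bw -> wN]]]] := hull_presentation p1 f (divr_gt0 e0 D1).
have -> : \sum_i b i = \sum_i 1 *: b i by apply: eq_bigr => i _; rewrite scale1r.
rewrite l1_bounded_sum => [|i]; last by case: (chain _ _ (bw i)).
rewrite (le_trans (ler_norm_sum _ _ _))//.
rewrite (@le_trans _ _ (\sum_i D * w i))//.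
  by apply: ler_sum => i _; rewrite mul1r; case: (chain _ _ (bw i)).
rewrite -mulr_sumr (le_trans (ler_wpM2l D0 wN))// mulrDr lerD2l.
by rewrite mulrCA ler_piMr ?(ltW e0)// ler_pdivrMr// mul1r lerDl.
Qed.

End PointFunctional.

(** * Integrable functions on the cube *)

Section BoxVolume.
Context (R : realType).

(** Half-open, so that boxes tile without overlap and indicators add up everywhere. *)
Definition hbox d (a b : 'rV[R]_d) : set 'rV[R]_d :=
  [set x | forall i, a 0 i <= x 0 i < b 0 i].

Lemma measurable_hbox d (a b : 'rV[R]_d) : measurable (hbox a b).
Proof.
have -> : hbox a b =
    \bigcap_(i in [set: 'I_d]) [set x : 'rV[R]_d | x 0 i \in `[a 0 i, b 0 i[].
  apply/seteqP; split=> x /= h i; first by move=> _; have := h i; rewrite ?in_itv.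
  by have /= := h i I; rewrite ?in_itv.
apply: fin_bigcap_measurable => // i _.
rewrite (_ : [set x | _] = (fun x : 'rV[R]_d => x 0 i) @^-1` `[a 0 i, b 0 i[%classic)//.
rewrite -[X in measurable X]setTI; apply: measurable_coord => //.
Qed.

Lemma lebesgue_hbox d (a b : 'rV[R]_d) : (forall i, a 0 i <= b 0 i) ->
  lebesgue R d (hbox a b) = (\prod_i (b 0 i - a 0 i))%:E.
Proof.
elim: d a b => [|d IH] a b ab.
  rewrite big_ord0 /= diracE mem_set//.
  by case.
rewrite /= /lebesgue_step /pushforward.
pose a' : 'rV[R]_d := \row_j a 0 (lift ord0 j).
pose b' : 'rV[R]_d := \row_j b 0 (lift ord0 j).
have -> : @row_cons R d @^-1` hbox a b =
    `[a 0 ord0, b 0 ord0[%classic `*` hbox a' b'.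
  apply/seteqP; split=> [[x y] /= h|[x y] /= [h1 h2] i].
    split; first by have := h ord0; rewrite !mxE unlift_none in_itv.
    by move=> i; have := h (lift ord0 i); rewrite !mxE liftK.
  case: (unliftP ord0 i) => [j ->|->].
    by have := h2 j; rewrite !mxE liftK.
  by move: h1; rewrite !mxE unlift_none in_itv.
rewrite product_measure1E//; last exact: measurable_hbox.
rewrite IH => [|i]; last by rewrite !mxE ab.
rewrite [X in (X * _)%E](lebesgue_measure_itv `[a 0 ord0, b 0 ord0[) /=.
rewrite big_ord_recl; have := ab ord0; rewrite le_eqVlt => /predU1P[->|h].
  by rewrite ltxx subrr mul0r mul0e.
rewrite lte_fin h -EFinB -EFinM; congr (_ * _)%:E.
by apply: eq_bigr => i _; rewrite !mxE.
Qed.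

End BoxVolume.

Section CubeMeasure.
Context (R : realType) (d : nat).
Local Notation K := (unit_cube R d).
Local Notation mu := (cube_measure R d).

Lemma cube_measure_hbox (a b : 'rV[R]_d) : (forall i, a 0 i <= b 0 i) ->
  hbox a b `<=` K -> mu (hbox a b) = (\prod_i (b 0 i - a 0 i))%:E.
Proof. by move=> ab abK; rewrite /= /mrestr setIidl// lebesgue_hbox. Qed.

Lemma cube_measure_le (A : set 'rV[R]_d) (a b : 'rV[R]_d) : measurable A ->
  (forall i, a 0 i <= b 0 i) -> A `&` K `<=` hbox a b ->
  (mu A <= (\prod_i (b 0 i - a 0 i))%:E)%E.
Proof.
move=> mA ab AK; rewrite -(lebesgue_hbox ab) /= /mrestr.
apply: le_measure; rewrite ?inE//.
- by apply: measurableI => //; exact: measurable_unit_cube.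
- exact: measurable_hbox.
Qed.

Lemma cube_measure_fin : (mu setT < +oo)%E.
Proof.
apply: (@le_lt_trans _ _ (\prod_(i < d) (2 - 0))%:E); last exact: ltry.
have := @cube_measure_le setT 0 (const_mx 2) measurableT.
under [in X in _ -> _ -> X]eq_bigr do rewrite !mxE.
apply; first by move=> i; rewrite !mxE.
by move=> x [_ Kx] i; rewrite !mxE; have /andP[-> h] := Kx i; lra.
Qed.

Lemma cube_measureC : mu (~` K) = 0%E.
Proof. by rewrite /= /mrestr setICl measure0. Qed.

Lemma ae_cube : {ae mu, forall x, K x}.
Proof.
exists (~` K); split => //; [|exact: cube_measureC].
by apply: measurableC; exact: measurable_unit_cube.
Qed.

End CubeMeasure.

Section LOneBasics.
Context (R : realType) (d : nat).
Local Notation K := (unit_cube R d).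
Local Notation mu := (cube_measure R d).
Implicit Types (f g : 'rV[R]_d -> R) (a b : L1 R d).

Definition integr f := mu.-integrable setT (EFin \o f).

(** Made total by the value 0 on non-integrable functions; [toL1K] identifies it whenever [integr f]
    holds. *)
Definition toL1 f : L1 R d :=
  if pselect (f \in Lfun mu 1) is left h then to_sep (L1_seminorm R d) (Lfun_Sub (lexx 1%E) h) else 0.

Definition aeq f g := {ae mu, forall x, f x = g x}.

Lemma aeq_sym f g : aeq f g -> aeq g f.
Proof. by apply: filterS => x ->. Qed.

Lemma aeq_trans f g h : aeq f g -> aeq g h -> aeq f h.
Proof. by move=> fg gh; apply: filterS2 fg gh => x -> ->. Qed.

Lemma L1_integr a : integr (L1_fun a).
Proof. by apply/Lfun1_integrable; exact: LfunP. Qed.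

Lemma integr_meas f : integr f -> measurable_fun setT f.
Proof. by move=> /integrableP[/measurable_EFinP]. Qed.

Lemma L1_seminormE (u : LfunType mu (lexx 1%E)) :
  L1_seminorm R d u = \int[mu]_x `|u x|.
Proof. by rewrite /= Lnorm1 /Rintegral; congr fine; exact: eq_integral. Qed.

Lemma L1_normE a : `|a| = \int[mu]_x `|L1_fun a x|.
Proof. by rewrite -L1_seminormE -(norm_to_sep (L1_seminorm R d)) to_sepK. Qed.

Lemma L1_seminorm_eq0 (u : LfunType mu (lexx 1%E)) :
  L1_seminorm R d u = 0 <-> aeq u (fun=> 0).
Proof.
have iu : integr u by apply/Lfun1_integrable; exact: LfunP.
rewrite L1_seminormE /Rintegral.
have mu_ : measurable_fun setT (EFin \o u) by exact: (measurable_int mu iu).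
have := @ae_eq_integral_abs _ _ _ mu setT measurableT (EFin \o u) mu_.
have <- : (\int[mu]_x `|(EFin \o u) x|)%E = (\int[mu]_x (`|u x|)%:E)%E.
  by apply: eq_integral.
have fi : (\int[mu]_x `|(EFin \o u) x|)%E \is a fin_num.
  by move/integrableP : iu => [_]; rewrite ge0_fin_numE// integral_ge0.
move=> [h1 h2]; split=> [h|h].
  have : (\int[mu]_x `|(EFin \o u) x|)%E = 0%E by rewrite -(fineK fi) h.
  by move=> /h1; apply: filterS => x /(_ I)[].
suff -> : (\int[mu]_x `|(EFin \o u) x|)%E = 0%E by [].
by apply: h2; apply: filterS h => x /= -> _.
Qed.

Lemma toL1K f : integr f -> aeq (L1_fun (toL1 f)) f.
Proof.
move=> fi; rewrite /toL1; case: pselect => [h|]; last first.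
  by case; apply/Lfun1_integrable.
have := repr_to_sep (L1_seminorm R d) (Lfun_Sub (lexx 1%E) h).
move=> /L1_seminorm_eq0; apply: filterS => x /eqP.
by rewrite subr_eq0 => /eqP.
Qed.

Lemma L1_funP c a b : aeq (L1_fun (c *: a + b)) (fun x => c * L1_fun a x + L1_fun b x).
Proof.
have := repr_to_sep (L1_seminorm R d) (c *: repr a + repr b).
have -> : to_sep (L1_seminorm R d) (c *: repr a + repr b) = c *: a + b.
  by rewrite linearP /= !to_sepK.
move=> /L1_seminorm_eq0; apply: filterS => x /eqP.
by rewrite subr_eq0 => /eqP.
Qed.

Lemma L1_eqP a b : a = b <-> aeq (L1_fun a) (L1_fun b).
Proof.
split=> [->|h]; first exact: (@aeW _ _ _ mu).
rewrite -(to_sepK a) -(to_sepK b); apply/to_sepP/L1_seminorm_eq0.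
by apply: filterS h => x /= h; apply/eqP; rewrite subr_eq0; apply/eqP.
Qed.

Lemma toL1_eq f a : integr f -> aeq (L1_fun a) f -> a = toL1 f.
Proof.
by move=> fi af; apply/L1_eqP; apply: aeq_trans af _; exact/aeq_sym/toL1K.
Qed.

Lemma aeq_Rintegral f g : measurable_fun setT f -> measurable_fun setT g ->
  aeq f g -> \int[mu]_x f x = \int[mu]_x g x.
Proof.
move=> mf mg fg; congr fine; apply: ae_eq_integral => //; try exact/measurable_EFinP.
by move: fg; rewrite /ae_eq; apply: filterS => x /= -> _.
Qed.

Lemma norm_toL1 f : integr f -> `|toL1 f| = \int[mu]_x `|f x|.
Proof.
move=> fi; rewrite L1_normE; apply: aeq_Rintegral.
- by apply: measurableT_comp => //; apply: integr_meas; exact: L1_integr.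
- by apply: measurableT_comp => //; exact: integr_meas.
- by apply: filterS (toL1K fi) => x ->.
Qed.

Lemma integrM f (h : 'rV[R]_d -> R) C : measurable_fun setT h ->
  (forall x, K x -> `|h x| <= C) -> integr f -> integr (fun x => h x * f x).
Proof.
move=> mh hC fi; apply/integrableP; split.
  by apply/measurable_EFinP/measurable_funM => //; exact: integr_meas.
have /integrableP[mCf] : integr (fun x => `|C| * f x).
  by have := integrableZl measurableT `|C| fi; apply: eq_integrable.
apply: le_lt_trans; apply: ae_ge0_le_integral => //.
- by apply/measurableT_comp => //; apply/measurable_EFinP/measurable_funM => //; exact: integr_meas.
- exact/measurableT_comp.
- apply: filterS (ae_cube R d) => x Kx _ /=.
  by rewrite lee_fin !normrM ler_wpM2r// normr_id (le_trans (hC _ Kx))// ler_norm.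
Qed.

Lemma integr_lin c f g : integr f -> integr g -> integr (fun x => c * f x + g x).
Proof.
move=> fi gi; have := integrableD measurableT (integrableZl measurableT c fi) gi.
exact: eq_integrable.
Qed.

Lemma integr_sum (I : Type) (r : seq I) (P : pred I) (F : I -> 'rV[R]_d -> R) :
  (forall i, P i -> integr (F i)) -> integr (fun x => \sum_(i <- r | P i) F i x).
Proof.
move=> h; have := integrable_sum measurableT (mu := mu) r h.
apply: eq_integrable => // x _.
by rewrite /= -sumEFin.
Qed.

Lemma bounded_integr f C : measurable_fun setT f -> (forall x, K x -> `|f x| <= C) -> integr f.
Proof.
move=> mf fC; have : integr (fun=> 1).
  apply/integrableP; split; first exact/measurable_EFinP.
  under eq_integral do rewrite /= normr1.
  by rewrite integral_cst// mul1e cube_measure_fin.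
by move=> /(integrM mf fC); under eq_fun do rewrite mulr1.
Qed.

End LOneBasics.

(** * Pairing densities with bounded functions, and masses of sets *)

Section Pairing.
Context (R : realType) (d : nat).
Local Notation K := (unit_cube R d).
Local Notation mu := (cube_measure R d).
Implicit Types (f h : 'rV[R]_d -> R) (a b : L1 R d) (S : set 'rV[R]_d).

(** Boundedness is asked on the unit cube only: monomials are unbounded elsewhere, and the measure
    is concentrated there. *)
Definition bmeas h := measurable_fun setT h /\ exists C, forall x, K x -> `|h x| <= C.

Definition pair h a : R := \int[mu]_x (h x * L1_fun a x).

Lemma bmeas_cst c : bmeas (fun=> c).
Proof. by split; [exact: measurable_cst|exists `|c|]. Qed.

Lemma bmeas_indic S : measurable S -> bmeas (\1_S).
Proof.
move=> mS; split; first exact: measurable_indic.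
by exists 1 => x _; rewrite indicE; case: (_ \in _); rewrite ?normr1// normr0.
Qed.

Lemma measurable_monomial (alpha : 'I_d -> nat) :
  measurable_fun setT (@monomial R d alpha).
Proof.
rewrite /monomial; elim: (index_enum _) => [|i s IH].
  by under eq_fun do rewrite big_nil; exact: measurable_cst.
under eq_fun do rewrite big_cons; apply: measurable_funM => //.
by apply: measurable_funX; exact: measurable_coord.
Qed.

Lemma bmeas_monomial alpha : bmeas (@monomial R d alpha).
Proof.
split; first exact: measurable_monomial.
by exists 1 => x Kx; rewrite ger0_norm ?monomial_le1// monomial_ge0.
Qed.

Lemma pair_integr h a : bmeas h -> integr (fun x => h x * L1_fun a x).
Proof. by move=> [mh [C hC]]; exact: integrM mh hC (L1_integr a). Qed.

Lemma pair_toL1 h f : bmeas h -> integr f -> pair h (toL1 f) = \int[mu]_x (h x * f x).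
Proof.
move=> [mh [C hC]] fi; apply: aeq_Rintegral.
- by apply: integr_meas; apply: pair_integr; split=> //; exists C.
- by apply: integr_meas; exact: integrM mh hC fi.
- by apply: filterS (toL1K fi) => x ->.
Qed.

Lemma pairP h c a b : bmeas h -> pair h (c *: a + b) = c * pair h a + pair h b.
Proof.
move=> bh; have ia := pair_integr a bh; have ib := pair_integr b bh.
rewrite /pair -RintegralZl// -RintegralD//.
  apply: aeq_Rintegral.
  - by apply: integr_meas; exact: pair_integr.
  - by apply: integr_meas; have := integr_lin c ia ib.
  - by apply: filterS (L1_funP c a b) => x ->; rewrite mulrDr mulrCA.
by have := integrableZl measurableT c ia; exact: eq_integrable.
Qed.

Lemma pair0 h : bmeas h -> pair h 0 = 0.
Proof.
by move=> bh; have := pairP 1 0 0 bh; rewrite scaler0 addr0 mul1r => /eqP;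
  rewrite -subr_eq0 opprD addNKr oppr_eq0 => /eqP.
Qed.

Lemma pair_sum h (I : Type) (r : seq I) (P : pred I) (F : I -> L1 R d) : bmeas h ->
  pair h (\sum_(i <- r | P i) F i) = \sum_(i <- r | P i) pair h (F i).
Proof.
move=> bh; elim/big_rec2: _ => [|i x y Pi IH]; first exact: pair0.
by rewrite -[F i]scale1r pairP// mul1r scale1r IH.
Qed.

Definition L1_sup S : set (L1 R d) := [set a | {ae mu, forall x, ~ S x -> L1_fun a x = 0}].

Lemma ae_le_Rintegral f g : integr f -> integr g -> (forall x, 0 <= f x) ->
  (forall x, 0 <= g x) -> {ae mu, forall x, f x <= g x} ->
  \int[mu]_x f x <= \int[mu]_x g x.
Proof.
move=> fi gi f0 g0 fg; rewrite /Rintegral; apply: fine_le.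
- exact: (integrable_fin_num measurableT fi).
- exact: (integrable_fin_num measurableT gi).
apply: ae_ge0_le_integral => //.
- by move=> x _; rewrite lee_fin.
- exact: (measurable_int mu fi).
- by move=> x _; rewrite lee_fin.
- exact: (measurable_int mu gi).
- by apply: filterS fg => x h _; rewrite lee_fin.
Qed.

Lemma integr_norm f : integr f -> integr (fun x => `|f x|).
Proof. by move=> fi; apply: integrable_norm. Qed.

Lemma integrZ c f : integr f -> integr (fun x => c * f x).
Proof. by move=> fi; have := integrableZl measurableT c fi; exact: eq_integrable. Qed.

Lemma integrB f g : integr f -> integr g -> integr (fun x => f x - g x).
Proof. by move=> fi gi; have := integrableB measurableT fi gi; exact: eq_integrable. Qed.

(** Replacing [h] by a constant on the support costs [e] per unit of mass. The moment errors of
    discretisations and of small boxes are both instances. *)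
Lemma pair_near h c S e a : 0 <= e -> bmeas h -> L1_sup S a ->
  (forall x, K x -> S x -> `|h x - c| <= e) ->
  `|pair h a - c * pair (fun=> 1) a| <= e * `|a|.
Proof.
move=> e0 bh Sa hc; have ih := pair_integr a bh.
have i1 := pair_integr a (bmeas_cst 1).
rewrite /pair -RintegralZl// -RintegralB//; last exact: integrZ.
have iB : integr (fun x => h x * L1_fun a x - c * (1 * L1_fun a x)).
  by apply: integrB => //; exact: integrZ.
rewrite (le_trans (le_normr_Rintegral _ _))// L1_normE -RintegralZl//; last first.
  exact/integr_norm/L1_integr.
apply: ae_le_Rintegral.
- exact: integr_norm.
- exact/integrZ/integr_norm/L1_integr.
- by [].
- by move=> x; rewrite mulr_ge0.
- apply: filterS2 (ae_cube R d) Sa => x Kx Sx.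
  have [Sx'|/Sx ->] := pselect (S x); last by rewrite !mulr0 subrr normr0 mulr0.
  by rewrite mul1r -mulrBl normrM ler_wpM2r// hc.
Qed.

Lemma pair_le h C a : bmeas h -> (forall x, K x -> `|h x| <= C) -> `|pair h a| <= `|C| * `|a|.
Proof.
move=> bh hC; have := @pair_near h 0 setT `|C| a (normr_ge0 C) bh.
rewrite mul0r subr0; apply; first by apply: aeW => x; case.
by move=> x Kx _; rewrite subr0 (le_trans (hC _ Kx))// ler_norm.
Qed.

Definition restr S a := toL1 (fun x => \1_S x * L1_fun a x).

Definition mass S a : R := \int[mu]_x (\1_S x * `|L1_fun a x|).

Lemma restr_aeq S a : measurable S -> aeq (L1_fun (restr S a)) (fun x => \1_S x * L1_fun a x).
Proof. by move=> mS; apply: toL1K; exact/pair_integr/bmeas_indic. Qed.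

Lemma norm_restr S a : measurable S -> `|restr S a| = mass S a.
Proof.
move=> mS; rewrite norm_toL1; last exact/pair_integr/bmeas_indic.
apply: eq_Rintegral => x _; rewrite normrM ger0_norm//.
Qed.

Lemma pair_restr h S a : bmeas h -> measurable S ->
  pair h (restr S a) = pair (fun x => h x * \1_S x) a.
Proof.
move=> bh mS; rewrite pair_toL1//; last exact/pair_integr/bmeas_indic.
by apply: eq_Rintegral => x _; rewrite mulrA.
Qed.

Lemma L1_sup_restr S a : measurable S -> L1_sup S (restr S a).
Proof.
move=> mS; apply: filterS (restr_aeq a mS) => x -> Sx.
by rewrite indicE memNset// mul0r.
Qed.

Lemma integr_mass S a : measurable S -> integr (fun x => \1_S x * `|L1_fun a x|).
Proof.
move=> mS; have [mh [C hC]] := bmeas_indic mS.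
exact/(integrM mh hC)/integr_norm/L1_integr.
Qed.

Lemma mass_ge0 S a : 0 <= mass S a.
Proof. by apply: Rintegral_ge0 => x _; rewrite mulr_ge0. Qed.

Section Partition.
Context (J : finType) (S : J -> set 'rV[R]_d).
Context (mS : forall j, measurable (S j)).
Context (S1 : forall x, K x -> \sum_j \1_(S j) x = 1 :> R).

(** Indicators summing to 1 express covering and disjointness at once. The almost everywhere
    identity is assembled one index at a time, by induction over sequences. *)
Lemma restr_sum a : a = \sum_j restr (S j) a.
Proof.
apply/L1_eqP; pose F (s : seq J) x := \sum_(j <- s) \1_(S j) x * L1_fun a x.
have h s : aeq (L1_fun (\sum_(j <- s) restr (S j) a)) (F s).
  elim: s => [|j s IH].
    rewrite big_nil; have /L1_seminorm_eq0 := repr_to_sep (L1_seminorm R d) 0.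
    apply: filterS => x; rewrite linear0 /F big_nil => /eqP.
    by rewrite subr_eq0 => /eqP.
  rewrite big_cons; have := L1_funP 1 (restr (S j) a) (\sum_(j <- s) restr (S j) a).
  rewrite scale1r => h; apply: filterS3 h IH (restr_aeq a (mS j)) => x h1 h2 h3.
  by rewrite /F big_cons h1 h2 h3 mul1r.
apply: aeq_sym; apply: aeq_trans (h _) _.
by apply: filterS (ae_cube R d) => x Kx; rewrite /F -mulr_suml S1// mul1r.
Qed.

Lemma mass_sum a : \sum_j mass (S j) a = `|a|.
Proof.
have -> : \sum_j mass (S j) a = \int[mu]_x (\sum_j \1_(S j) x * `|L1_fun a x|).
  rewrite /mass; elim: (index_enum J) => [|j s IH].
    rewrite big_nil; under eq_Rintegral do rewrite big_nil.
    by rewrite Rintegral_cst// mul0r.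
  rewrite big_cons IH -RintegralD//; last 2 first.
  - exact: integr_mass.
  - by apply: integr_sum => i _; exact: integr_mass.
  by apply: eq_Rintegral => x _; rewrite big_cons.
rewrite L1_normE; apply: aeq_Rintegral.
- by apply: integr_meas; apply: integr_sum => i _; exact: integr_mass.
- by apply: integr_meas; exact/integr_norm/L1_integr.
- by apply: filterS (ae_cube R d) => x Kx; rewrite -mulr_suml S1// mul1r.
Qed.

End Partition.

(** Absolute continuity of the integral. Above a height [n] the density has small integral by
    dominated convergence; below it, the mass is at most [n + 1] times the measure of [S]. *)
Lemma mass_small a e : 0 < e -> exists2 dlt, 0 < dlt &
  forall S, measurable S -> (mu S <= dlt%:E)%E -> mass S a <= e.
Proof.
move=> e0; pose f x := `|L1_fun a x|.
have fi : integr f by exact/integr_norm/L1_integr.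
have f0 x : 0 <= f x by exact: normr_ge0.
pose A n := [set x | n%:R < f x].
have mA n : measurable (A n).
  rewrite (_ : A n = f @^-1` `]n%:R, +oo[%classic); last first.
    by apply/seteqP; split=> x /=; rewrite in_itv/= andbT.
  rewrite -[X in measurable X]setTI; apply: (integr_meas fi) => //.
have : (fun n => \int[mu]_x ((\1_(A n) x * f x)%:E))%E @ \oo --> (\int[mu]_x (0 : R)%:E)%E.
  have := @dominated_convergence _ _ _ mu setT measurableT
    (fun n x => (\1_(A n) x * f x)%:E) (fun=> 0%E) (EFin \o f).
  case.
  - move=> n; apply/measurable_EFinP/measurable_funM; last exact: integr_meas.
    exact: measurable_indic.
  - exact: measurable_cst.
  - apply: aeW => x _; apply/fine_cvgP; split; first by apply: nearW.
    apply/cvgrPdist_le => eps eps0; near=> n.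
    rewrite /= indicE memNset ?mul0r ?subrr ?normr0 ?ltW//=.
    apply/negP; rewrite -leNgt; near: n; exact: nbhs_infty_ger.
  - exact: fi.
  - apply: aeW => x n _ /=; rewrite lee_fin normrM ger0_norm// ger0_norm//.
    by rewrite ler_piMl// indicE; case: (_ \in _).
  by move=> _ _; apply.
rewrite integral0 => /fine_cvgP[_ /cvgrPdist_le /(_ (e / 2))].
rewrite divr_gt0// => /(_ isT)[n _ /(_ n (leqnn n))/=]; rewrite sub0r normrN => hn.
have n1 : 0 < n.+1%:R :> R by [].
exists (e / 2 / n.+1%:R); first by rewrite !divr_gt0.
move=> S mS Sd; rewrite /mass.
have iA : integr (fun x => \1_(A n) x * f x) by exact: integr_mass.
have iS : integr (fun x => n.+1%:R * \1_S x).
  apply: integrZ; have [mh [C hC]] := bmeas_indic mS; exact: bounded_integr mh hC.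
rewrite (@le_trans _ _ (\int[mu]_x (n.+1%:R * \1_S x + \1_(A n) x * f x)))//.
  apply: le_Rintegral => //; first exact: integr_mass.
    by have := integrableD measurableT iS iA; exact: eq_integrable.
  move=> x _; have [Ax|Ax] := pselect (A n x).
    have -> : \1_(A n) x = 1 :> R by rewrite indicE mem_set.
    rewrite mul1r.
    rewrite (@le_trans _ _ (f x))//.
      by rewrite ler_piMl// indicE; case: (_ \in _).
    by rewrite lerDr mulr_ge0.
  have -> : \1_(A n) x = 0 :> R by rewrite indicE memNset.
  rewrite mul0r addr0 mulrC ler_wpM2r//.
  move: Ax => /negP; rewrite -leNgt => /le_trans; apply.
  by rewrite ler_nat.
rewrite RintegralD// [leRHS]splitr lerD//; last first.
  by rewrite (le_trans (ler_norm _)).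
rewrite RintegralZl//; last first.
  by have [mh [C hC]] := bmeas_indic mS; exact: bounded_integr mh hC.
rewrite -ler_pdivlMl// mulrC /Rintegral integral_indic// setIT.
by rewrite -lee_fin fineK// ge0_fin_numE//; apply: le_lt_trans Sd _; exact: ltry.
Unshelve. all: end_near.
Qed.

End Pairing.

(** * Moments and dyadic cells *)

Section LOneModel.
Context (R : realType) (d k : nat).
Local Notation K := (unit_cube R d).
Local Notation mu := (cube_measure R d).

Definition L1_mom (a : L1 R d) : 'rV[R]_#|{: mindex d k}| :=
  momvec k (fun alpha => pair (@monomial R d alpha) a).

Definition L1_model : atomic_model #|{: mindex d k}| (@L1_atom R d k).
Proof.
apply: (@AtomicModel _ _ _ _ _ (@L1_sup R d) (fun a : L1 R d => `|a|) L1_mom).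
- move=> Q; have /L1_seminorm_eq0 := repr_to_sep (L1_seminorm R d) 0.
  by apply: filterS => x; rewrite linear0 => /eqP; rewrite subr_eq0 => /eqP.
- move=> Q c a b; apply: filterS3 (L1_funP c a b) => x -> ha hb Qx.
  by rewrite ha// hb// mulr0 addr0.
- by move=> Q Q' QQ' a; apply: filterS => x h Qx; apply: h => /QQ'.
- by move=> a b _ _; exact: ler_normD.
- by move=> c a _; exact: normrZ.
- move=> c a b _ _; apply: momvecP => alpha _; apply: pairP; exact: bmeas_monomial.
- move=> Q a QK; split=> [[sa a1 am]|[sa a1 am]]; split=> //.
    exact/momvec_eq0.
  exact/momvec_eq0.
Defined.

End LOneModel.

Section Cells.
Context (R : realType) (d : nat).
Local Notation K := (unit_cube R d).
Local Notation mu := (cube_measure R d).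
Local Notation J N := {ffun 'I_d -> 'I_N}.

(* The last cell is closed, so that the cells partition the closed cube. *)
Definition icell (N j : nat) (y : R) := (j%:R <= N%:R * y) && ((N%:R * y < j.+1%:R) || (j.+1 == N)).

Definition cell N (j : J N) : set 'rV[R]_d := [set x | K x /\ forall i, icell N (j i) (x 0 i)].

Definition corner N (j : J N) : 'rV[R]_d := \row_i ((j i)%:R / N%:R).

Definition ccube N (j : J N) : set 'rV[R]_d := cbox (corner j) N%:R^-1.

Lemma ord_gt0 N (j : 'I_N) : 0 < N%:R :> R.
Proof. by rewrite ltr0n; case: N j => [[]|]. Qed.

Lemma cell_ccube N (j : J N) : cell j `<=` ccube j.
Proof.
move=> x [Kx hx] i; have N0 := ord_gt0 (j i); rewrite mxE.
have /andP[h1 h2] := hx i; rewrite ler_pdivrMr// mulrC h1 /=.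
rewrite -[X in _ + X]mul1r -mulrDl natr1 ler_pdivlMr// mulrC.
case/orP: h2 => [/ltW//|/eqP ->].
by rewrite ler_piMr ?ler0n//; case/andP: (Kx i).
Qed.

Lemma ccube_unit N (j : J N) : ccube j `<=` K.
Proof.
move=> x hx i; have N0 := ord_gt0 (j i); have /andP[h1 h2] := hx i.
apply/andP; split; first by apply: le_trans h1; rewrite mxE divr_ge0 ?ler0n.
apply: (le_trans h2); rewrite mxE -[X in _ + X]mul1r -mulrDl natr1 ler_pdivrMr// mul1r.
by rewrite ler_nat.
Qed.

Lemma measurable_cell N (j : J N) : measurable (cell j).
Proof.
have -> : cell j = K `&` \bigcap_(i in [set: 'I_d]) [set x | icell N (j i) (x 0 i)].
  by apply/seteqP; split=> x /= [Kx h]; split=> // i; [move=> _|]; exact: h.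
apply: measurableI; first exact: measurable_unit_cube.
apply: fin_bigcap_measurable => // i _.
have mf : measurable_fun setT (fun x : 'rV[R]_d => N%:R * x 0 i).
  by apply: measurable_funM => //; exact: measurable_coord.
have m1 : measurable [set x : 'rV[R]_d | (j i)%:R <= N%:R * x 0 i].
  rewrite (_ : [set x | _] = (fun x : 'rV[R]_d => N%:R * x 0 i) @^-1` `[(j i)%:R, +oo[%classic).
    by rewrite -[X in measurable X]setTI; exact: mf.
  by apply/seteqP; split=> x /=; rewrite in_itv/= andbT.
have m2 : measurable [set x : 'rV[R]_d | N%:R * x 0 i < (j i).+1%:R].
  rewrite (_ : [set x | _] = (fun x : 'rV[R]_d => N%:R * x 0 i) @^-1` `]-oo, (j i).+1%:R[%classic).
    by rewrite -[X in measurable X]setTI; exact: mf.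
  by apply/seteqP; split=> x /=; rewrite in_itv/=.
rewrite [X in measurable X](_ : _ = [set x : 'rV[R]_d | (j i)%:R <= N%:R * x 0 i] `&`
   (if (j i).+1 == N then setT else [set x : 'rV[R]_d | N%:R * x 0 i < (j i).+1%:R])).
  by apply: measurableI => //; case: ifP.
by apply/seteqP; split=> x /=; rewrite /icell; case: ifP => _; rewrite ?orbT ?orbF ?andbT;
  [|move=> /andP|move=> []|move=> [-> ->]].
Qed.

Lemma icell_ex N (y : R) : (0 < N)%N -> 0 <= y <= 1 -> exists j : 'I_N, icell N j y.
Proof.
move=> N0 /andP[y0 y1]; have Ny : 0 <= N%:R * y by rewrite mulr_ge0.
have /andP[h1 h2] := truncn_itv Ny.
have [h|h] := leqP N (Num.truncn (N%:R * y)).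
  have jN : (N.-1 < N)%N by rewrite prednK.
  exists (Ordinal jN); rewrite /icell /= prednK// eqxx orbT andbT.
  by apply: le_trans h1; rewrite ler_nat (leq_trans _ h)// leq_pred.
by exists (Ordinal h); rewrite /icell /= h1 h2.
Qed.

(** One common point suffices for nesting, because the fine grid refines the coarse one. For a
    closed last interval the comparison of end points is replaced by [q < N] or [j < N * L]. *)
Lemma icell_nest N L (q j : nat) (y : R) : (q < N)%N -> (j < N * L)%N ->
  icell N q y -> icell (N * L) j y -> (q * L <= j)%N /\ (j.+1 <= q.+1 * L)%N.
Proof.
move=> qN jNL /andP[q1 q2] /andP[j1 j2].
have L0 : (0 < L)%N by move: jNL; case: (L) => //; rewrite muln0.
have L0' : 0 < L%:R :> R by rewrite ltr0n.
split.
  case/orP: j2 => [j2|/eqP j2]; last first.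
    have : (q.+1 * L <= N * L)%N by rewrite leq_mul2r qN orbT.
    by rewrite -j2 mulSn; move: L0; case: (L) => // l _; rewrite addSn ltnS; apply: leq_trans; rewrite leq_addl.
  rewrite -ltnS -(ltr_nat R) natrM (le_lt_trans _ j2)// natrM mulrAC.
  by rewrite ler_wpM2r// ltW.
case/orP: q2 => [q2|/eqP->//].
rewrite -(ltr_nat R) natrM (le_lt_trans j1)// natrM mulrAC.
by rewrite ltr_pM2r.
Qed.

Lemma icell_inj N (i j : 'I_N) (y : R) : icell N i y -> icell N j y -> i = j.
Proof.
have h (a b : nat) : (b < N)%N -> icell N a y -> icell N b y -> (b <= a)%N.
  move=> bN /andP[a1 a2] /andP[b1 b2]; case/orP: a2 => [a2|/eqP aN].
    by rewrite -ltnS -(ltr_nat R); exact: le_lt_trans b1 a2.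
  by rewrite -ltnS aN.
move=> hi hj; apply/val_inj/eqP; rewrite eqn_leq.
by rewrite (h j i)//= (h i j).
Qed.

Lemma cell_sum N x : (0 < N)%N -> K x -> \sum_(j : J N) \1_(cell j) x = 1 :> R.
Proof.
move=> N0 Kx; have /choice[j0 hj0] : forall i, exists j : 'I_N, icell N j (x 0 i).
  by move=> i; apply: icell_ex => //; exact: Kx.
pose j : J N := [ffun i => j0 i].
have xj : cell j x by split=> // i; rewrite ffunE.
rewrite (bigD1 j)//= big1 ?addr0; first by rewrite indicE mem_set.
move=> l lj; rewrite indicE memNset// => -[_ hl].
move/eqP : lj; apply; apply/ffunP => i; apply: (@icell_inj _ _ _ (x 0 i)) => //.
by rewrite ffunE.
Qed.

Lemma ccube_nest N L (q : J N) (j : J (N * L)) x : cell q x -> cell j x ->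
  ccube j `<=` ccube q.
Proof.
move=> [_ qx] [_ jx] y yj i; have := icell_nest (ltn_ord _) (ltn_ord _) (qx i) (jx i).
move=> [h1 h2]; have N0 := ord_gt0 (q i); have NL0 := ord_gt0 (j i).
have L0 : 0 < L%:R :> R by move: NL0; rewrite natrM pmulr_rgt0.
have /andP[y1 y2] := yj i; apply/andP; split.
  apply: le_trans y1; rewrite !mxE ler_pdivrMr// mulrAC ler_pdivlMr//.
  by rewrite -!natrM ler_nat mulnCA [X in (_ <= X)%N]mulnC leq_mul2l h1 orbT.
apply: (le_trans y2); rewrite !mxE -[X in _ + X <= _]mul1r -[X in _ <= _ + X]mul1r -!mulrDl !natr1.
rewrite ler_pdivrMr// mulrAC ler_pdivlMr// -!natrM ler_nat.
by rewrite [X in (_ <= X)%N]mulnCA mulnC leq_mul2l h2 orbT.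
Qed.

Lemma fpacking_ccube N : (0 < N)%N -> fpacking (fun j : J N => ccube j).
Proof.
move=> Np; split=> [j|i j _ _ [y []]].
  split; last exact: ccube_unit.
  by apply: cube_cbox; rewrite invr_gt0 ltr0n.
rewrite !interior_cbox => yi yj; apply/ffunP => l; apply/val_inj/eqP.
have N0 := ord_gt0 (i l).
have h (a b : J N) : obox (corner a) N%:R^-1 y -> obox (corner b) N%:R^-1 y -> (a l <= b l)%N.
  move=> ya yb; have /andP[a1 a2] := ya l; have /andP[b1 b2] := yb l.
  rewrite -ltnS -(ltr_nat R); have := lt_trans a1 b2.
  rewrite !mxE -[X in _ + X]mul1r -mulrDl natr1 ltr_pdivrMr// divfK//.
  by rewrite gt_eqF.
by rewrite eqn_leq (h i j)// (h j i).
Qed.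

(** The enclosing half-open box has side [2 / N], since a cell may contain its right faces. Of the
    [d] factors one is kept and the others are at most 1. In dimension 0 the only cell has full
    measure, whence [0 < d]. *)
Lemma cell_measure N (j : J N) : (0 < d)%N -> (1 < N)%N -> (mu (cell j) <= (2 / N%:R)%:E)%E.
Proof.
move=> d0 N1; have N0 : 0 < N%:R :> R by rewrite ltr0n (ltn_trans _ N1).
have N2 : 0 <= 2 / N%:R :> R by rewrite divr_ge0// ltW.
pose b : 'rV[R]_d := \row_i (corner j 0 i + 2 / N%:R).
have bE i : b 0 i = corner j 0 i + 2 / N%:R by rewrite mxE.
have := @cube_measure_le R d (cell j) (corner j) b (measurable_cell j).
have -> : \prod_i (b 0 i - corner j 0 i) = (2 / N%:R) ^+ d.
  rewrite -[d in RHS]card_ord -prodr_const; apply: eq_bigr => i _.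
  by rewrite bE addrC addKr.
move=> h; apply: le_trans (h _ _) _.
- by move=> i; rewrite bE lerDl.
- move=> x [/cell_ccube xj _] i; have /andP[-> h2] := xj i; rewrite bE.
  rewrite (le_lt_trans h2)// ltrD2l -[X in X < _]mul1r ltr_pM2r ?invr_gt0//.
  by rewrite ltr1n.
- rewrite lee_fin -(prednK d0) exprS ler_piMr// exprn_ile1//.
  by rewrite ler_pdivrMr// mul1r ler_nat.
Qed.

Lemma cell_mass_small (a : L1 R d) e : (0 < d)%N -> 0 < e ->
  exists n0, forall n (j : J n), (n0 <= n)%N -> mass (cell j) a <= e.
Proof.
move=> d0 e0; have [dlt dlt0 h] := mass_small a e0.
have [n0 _ hn] := near_infty_natSinv_lt (PosNum (divr_gt0 dlt0 (ltr0n _ 2))).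
exists n0.+2 => n j nn; have n1 : (1 < n)%N by apply: leq_trans nn.
apply: h; first exact: measurable_cell.
apply: (le_trans (cell_measure j d0 n1)); rewrite lee_fin.
have nn' : (n0 <= n.-1)%N by rewrite -ltnS prednK ?(ltnW n1)//; apply: ltnW.
have := hn n.-1 nn'; rewrite /= prednK ?(ltnW n1)// => h'.
lra.
Qed.

End Cells.

(** * Discretisation *)

Section Disc.
Context (R : realType) (d k : nat) (p : R) (p1 : 1 <= p) (d0 : (0 < d)%N).
Local Notation K := (unit_cube R d).
Local Notation T := (unit_cube R d).
Local Notation J N := {ffun 'I_d -> 'I_N}.
Local Notation M := #|{: mindex d k}|.
Local Notation mom := (@l1_mom R d k).
Local Notation MOM := (@L1_mom R d k).
Local Notation A := (l1_model R d k).
Implicit Types (a b : L1 R d) (f g : T -> R).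

Lemma l1_supK f : summ f -> l1_sup K f.
Proof. by move=> sf; split=> // x; case; exact: set_val_unit. Qed.

Lemma l1_momP c f g : summ f -> summ g -> mom (c *: f + g) = c *: mom f + mom g.
Proof. by move=> /l1_supK sf /l1_supK sg; exact: (@am_momP _ _ _ _ _ A). Qed.

Lemma l1_momB f g : summ f -> summ g -> mom (f - g) = mom f - mom g.
Proof. by move=> /l1_supK sf /l1_supK sg; exact: (am_momB (A := A)). Qed.

Lemma l1_momZ c f : summ f -> mom (c *: f) = c *: mom f.
Proof. by move=> /l1_supK sf; exact: (am_momZ (A := A)). Qed.

Lemma l1_mom_sum (I : Type) (r : seq I) (F : I -> T -> R) : (forall i, summ (F i)) ->
  mom (\sum_(i <- r) F i) = \sum_(i <- r) mom (F i).
Proof. by move=> sF; apply: (am_mom_sum (A := A)) => i _; exact: l1_supK. Qed.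

Lemma asum_sum (I : Type) (r : seq I) (F : I -> T -> R) : (forall i, summ (F i)) ->
  asum (\sum_(i <- r) F i) <= \sum_(i <- r) asum (F i).
Proof. by move=> sF; apply: (am_nu_sum (A := A)) => i _; exact: l1_supK. Qed.

Lemma L1_momP c a b : MOM (c *: a + b) = c *: MOM a + MOM b.
Proof. by apply: momvecP => alpha _; apply: pairP; exact: bmeas_monomial. Qed.

Lemma L1_supK a : L1_sup K a.
Proof. by apply: filterS (ae_cube R d) => x Kx; case. Qed.

Lemma L1_mom_sum (I : Type) (r : seq I) (F : I -> L1 R d) :
  MOM (\sum_(i <- r) F i) = \sum_(i <- r) MOM (F i).
Proof. by apply: (am_mom_sum (A := L1_model R d k)) => i _; exact: L1_supK. Qed.

(** The nodes are left free, since three choices are used: [znode], whose smearing is explicit,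
    points of a prescribed support, and corners of cells. *)
Definition nodes N (z : J N -> T) := forall j, ccube j (set_val (z j)).

Definition disc N (z : J N -> T) a : T -> R :=
  \sum_j pair (\1_(cell j)) a *: delta R (z j).

Let bc N (j : J N) : bmeas (\1_(@cell R d N j)).
Proof. by apply: bmeas_indic; exact: measurable_cell. Qed.

Lemma disc_linear N (z : J N -> T) c a b : disc z (c *: a + b) = c *: disc z a + disc z b.
Proof.
rewrite /disc scaler_sumr -big_split; apply: eq_bigr => j _.
by rewrite pairP// scalerDl scalerA.
Qed.

Lemma disc_sum N (z : J N -> T) (I : Type) (r : seq I) (F : I -> L1 R d) :
  disc z (\sum_(i <- r) F i) = \sum_(i <- r) disc z (F i).
Proof.
elim: r => [|i r IH].
  by rewrite !big_nil /disc big1// => j _; rewrite pair0// scale0r.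
by rewrite !big_cons -[F i]scale1r disc_linear !scale1r IH.
Qed.

Lemma disc_sup N (z : J N -> T) a Q :
  (forall j, pair (\1_(cell j)) a != 0 -> Q (set_val (z j))) -> l1_sup Q (disc z a).
Proof.
move=> h; apply: (am_sup_sum (A := A)) => j _.
have [->|h'] := eqVneq (pair (\1_(cell j)) a) 0.
  by rewrite scale0r; exact: (am_sup0 A).
by apply: (am_supZ (A := A)); apply: delta_sup; exact: h.
Qed.

Lemma summ_disc N (z : J N -> T) a : summ (disc z a).
Proof. by have [] : l1_sup K (disc z a) by apply: disc_sup => j _; exact: set_val_unit. Qed.

Lemma pair_cell_le N (j : J N) a : `|pair (\1_(cell j)) a| <= mass (cell j) a.
Proof.
have -> : pair (\1_(cell j)) a = pair (fun=> 1) (restr (cell j) a).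
  rewrite pair_restr//; [|exact: bmeas_cst|exact: measurable_cell].
  by congr pair; apply/funext => x; rewrite mul1r.
rewrite (le_trans (@pair_le _ _ _ 1 _ _ _))//; first exact: bmeas_cst.
  by move=> x _; rewrite normr1.
by rewrite normr1 mul1r norm_restr//; exact: measurable_cell.
Qed.

Lemma asum_disc N (z : J N -> T) a : (0 < N)%N -> asum (disc z a) <= `|a|.
Proof.
move=> N0; rewrite (le_trans (asum_sum _ _))//.
  by move=> j; apply: summZ; exact: summ_delta.
rewrite -(mass_sum (@measurable_cell R d N) (fun x => cell_sum N0)).
apply: ler_sum => j _; rewrite asumZ ?asum_delta ?mulr1 ?pair_cell_le//.
exact: summ_delta.
Qed.

Lemma mnorm_sum (I : Type) (r : seq I) (F : I -> 'rV[R]_M) :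
  mnorm (\sum_(i <- r) F i) <= \sum_(i <- r) mnorm (F i).
Proof.
elim/big_rec2: _ => [|i x y _ h]; first by rewrite mnorm0.
by rewrite (le_trans (mnormD _ _))// lerD2l.
Qed.

(** Within a cell a monomial of degree below [k] varies by at most [k / N], so concentrating the
    mass of the cell at its node changes each moment by that much per unit of mass. *)
Lemma disc_mom N (z : J N -> T) a : (0 < N)%N -> nodes z ->
  mnorm (mom (disc z a) - MOM a) <= M%:R * (k%:R / N%:R) * `|a|.
Proof.
move=> N0 hz; have mc := @measurable_cell R d N.
have S1 x := @cell_sum R d N x N0.
rewrite [in MOM a](restr_sum mc S1 a) L1_mom_sum.
rewrite l1_mom_sum => [|j]; last by apply: summZ; exact: summ_delta.
rewrite -sumrB (le_trans (mnorm_sum _ _))// -(mass_sum mc S1) mulr_sumr.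
apply: ler_sum => j _; rewrite l1_momZ ?l1_mom_delta; last exact: summ_delta.
rewrite -mulrA.
have -> : pair (\1_(cell j)) a *: momvec k (fun alpha => monomial alpha (set_val (z j))) - MOM (restr (cell j) a) =
  momvec k (fun alpha => pair (\1_(cell j)) a * monomial alpha (set_val (z j)) - pair (@monomial R d alpha) (restr (cell j) a)).
  by apply/rowP => i; rewrite !mxE; case: ifP => // _; rewrite mulr0 subrr.
have e0 : 0 <= k%:R / N%:R :> R by rewrite divr_ge0.
apply: mnorm_momvec => [|alpha ak]; first by rewrite mulr_ge0// mass_ge0.
rewrite distrC -(norm_restr a (mc j)).
have -> : pair (\1_(cell j)) a = pair (fun=> 1) (restr (cell j) a).
  rewrite pair_restr//; [|exact: bmeas_cst].
  by congr pair; apply/funext => x; rewrite mul1r.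
rewrite mulrC; apply: (@pair_near _ _ _ _ (cell j)) => //.
- exact: bmeas_monomial.
- exact: L1_sup_restr.
- move=> x Kx xj; apply: monomial_lip => //.
    exact: set_val_unit.
  move=> i; have /andP[h1 h2] := cell_ccube xj i; have /andP[h3 h4] := hz j i.
  by rewrite ler_norml; apply/andP; split; lra.
Qed.

Lemma restr_cell_meet N N' (q : J N) (j : J N') a :
  pair (\1_(cell j)) (restr (cell q) a) != 0 -> exists2 x : 'rV[R]_d, cell q x & cell j x.
Proof.
move=> h; apply: contrapT => h0.
move/eqP: h; apply; rewrite pair_restr//; last exact: measurable_cell.
transitivity (\int[cube_measure R d]_x (0 : R)); last by rewrite Rintegral_cst// mul0r.
apply: eq_Rintegral => x _.
rewrite !indicE; have [xq|xq] := pselect (cell q x); last by rewrite (memNset xq) mulr0 mul0r.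
have [xj|xj] := pselect (cell j x); last by rewrite (memNset xj) !mul0r.
by case: h0; exists x.
Qed.

Lemma ccube_nest_dvd N N' (q : J N) (j : J N') (x : 'rV[R]_d) : (N %| N')%N ->
  cell q x -> cell j x -> ccube j `<=` @ccube R d N q.
Proof.
move=> /dvdnP[L NL]; have {}NL : N' = (N * L)%N by rewrite mulnC.
by subst N'; exact: ccube_nest.
Qed.

Lemma disc_restr_sup N N' (z : J N' -> T) (q : J N) a : (N %| N')%N -> nodes z ->
  l1_sup (ccube q) (disc z (restr (cell q) a)).
Proof.
move=> NN' hz; apply: disc_sup => j /restr_cell_meet[x xq xj].
exact: (ccube_nest_dvd NN' xq xj).
Qed.

Lemma expn2_gt0 n : (0 < 2 ^ n)%N. Proof. by rewrite expn_gt0. Qed.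

(** Cut [a] along a coarse dyadic grid. Both discretisations of a piece stay in its closed cell,
    with small mass and nearly equal moments, so [coarse_chain] applies. The term [s] leaves room
    for the balancing that makes the total moments vanish. *)
Lemma disc_close a e : 0 < e -> exists n0, exists2 zeta, 0 < zeta &
  forall n n' (z : J (2 ^ n) -> T) (z' : J (2 ^ n') -> T) s,
  (n0 <= n)%N -> (n0 <= n')%N -> nodes z -> nodes z' -> summ s -> asum s <= zeta ->
  mom (disc z a - disc z' a + s) = 0 ->
  hull_le p1 (@l1_atom R d k) (disc z a - disc z' a + s) e.
Proof.
move=> e0; have B0 : 0 <= 2 * `|a| by rewrite mulr_ge0.
have [dlt dlt0 hd] := @coarse_chain _ _ _ _ p1 _ _ A _ _ B0 e0.
(* The coarse level [m0] is fixed by the bound [dlt] on coefficients; only then does [eta] exist,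
   and it determines the fine level [n0]. *)
have [m0 hm0] := cell_mass_small a d0 (divr_gt0 dlt0 (ltr0n _ 2)).
pose N := (2 ^ m0)%N; have N0 : (0 < N)%N by exact: expn2_gt0.
have hm (q : J N) : 2 * mass (cell q) a <= dlt.
  by rewrite mulrC -ler_pdivlMr// hm0// ltnW// ltn_expl.
have [eta eta0 heta] := hd _ _ (fpacking_ccube R d N0).
pose D : R := 2 * M%:R * k%:R * `|a|; have D0 : 0 <= D by rewrite !mulr_ge0.
have [n0 _ hn0] := near_infty_natSinv_lt (PosNum (divr_gt0 eta0 (ltr_pwDr ltr01 D0))).
exists (maxn m0 n0.+1), eta => // n n' z z' s; rewrite !geq_max => /andP[mn n0n] /andP[mn' n0n'].
move=> hz hz' ss se mom0.
pose g (q : J N) := disc z (restr (cell q) a) - disc z' (restr (cell q) a).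
have mc := @measurable_cell R d N; have S1 x := @cell_sum R d N x N0.
have gE : disc z a - disc z' a = \sum_(q : J N) g q.
  by rewrite sumrB -!disc_sum -!(restr_sum mc S1).
have small l (y : J (2 ^ l) -> T) q : (n0 < l)%N -> nodes y ->
    mnorm (mom (disc y (restr (cell q) a)) - MOM (restr (@cell R d N q) a)) <= eta / 2.
  move=> n0l hy; rewrite (le_trans (disc_mom _ (expn2_gt0 l) hy))//.
  have aq : `|restr (cell q) a| <= `|a|.
    rewrite norm_restr// -(mass_sum mc S1 a) (bigD1 q)//= lerDl.
    by apply: sumr_ge0 => i _; exact: mass_ge0.
  rewrite (@le_trans _ _ (M%:R * (k%:R / (2 ^ l)%:R) * `|a|))//.
    by rewrite ler_wpM2l// mulr_ge0// divr_ge0.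
  have lh : (n0 <= (2 ^ l).-1)%N.
    by rewrite -ltnS prednK ?expn2_gt0//; apply: ltn_trans n0l _; exact: ltn_expl.
  have := hn0 _ lh; rewrite /= prednK ?expn2_gt0// => h.
  have -> : M%:R * (k%:R / (2 ^ l)%:R) * `|a| = D * (2 ^ l)%:R^-1 / 2.
    by rewrite /D; field; rewrite gt_eqF// ltr0n expn2_gt0.
  rewrite ler_pM2r ?invr_gt0// (le_trans (ler_wpM2l D0 (ltW h)))//.
  by rewrite mulrA ler_pdivrMr ?ltr_wpDl// mulrDr mulr1 mulrC lerDl ltW.
have dv l : (m0 <= l)%N -> (N %| 2 ^ l)%N by move=> ml; rewrite dvdn_exp2l.
rewrite gE; apply: (heta g (fun q => 2 * mass (cell q) a) s).
- move=> q; split.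
  + apply: (am_supB (A := A)); apply: disc_restr_sup => //; exact: dv.
  + rewrite (le_trans (am_nuB (A := A) (l1_supK (summ_disc _ _)) (l1_supK (summ_disc _ _))))//.
    rewrite mulr2n mulrDl mul1r -(norm_restr a (mc q)).
    by apply: lerD; apply: asum_disc; exact: expn2_gt0.
  + exact: hm.
  + rewrite /= l1_momB; try exact: summ_disc.
    rewrite -(subrKA (MOM (restr (cell q) a))) (le_trans (mnormD _ _))//.
    by rewrite [leRHS]splitr lerD ?small// -mnormN opprB small.
- by rewrite -mulr_sumr (mass_sum mc S1).
- exact: l1_supK.
- exact: se.
- by rewrite -gE.
Qed.

(* These nodes shrink to the corners of the cells under the factor [1 - 1/N]. *)
Definition znode_fun N (j : J N) : 'rV[R]_d := \row_i ((j i)%:R / N.-1%:R).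

Lemma znode_ccube N (j : J N) : ccube j (znode_fun j).
Proof.
move=> i; have N0 := ord_gt0 R (j i); rewrite !mxE; have := ltn_ord (j i).
case: N j N0 => [|[|N]] j N0 jN.
- by [].
(* For [N = 1] the denominator is 0; as [0^-1 = 0], the node is the corner of the only cell. *)
- move: jN; rewrite ltnS leqn0 => /eqP ->.
  by rewrite /= invr0 mulr0 !mul0r add0r lexx invr_ge0 ltW.
- have N1 : 0 < N.+1%:R :> R by [].
  rewrite -[X in _ + X]mul1r -mulrDl natr1 /=; apply/andP; split.
    by rewrite ler_wpM2l// lef_pV2 ?posrE// ler_nat.
  rewrite ler_pdivrMr// mulrAC ler_pdivlMr// -!natrM ler_nat.
  move: jN; move: (nat_of_ord (j i)) => l; rewrite ltnS => lN.
  by rewrite mulnS mulSn leq_add2r.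
Qed.

Definition znode N (j : J N) : T := SigSub (mem_set (ccube_unit (znode_ccube j))).

Lemma znodeE N (j : J N) : set_val (znode j) = znode_fun j.
Proof. by rewrite /set_val /=. Qed.

Lemma nodes_znode N : nodes (@znode N).
Proof. by move=> j; rewrite znodeE; exact: znode_ccube. Qed.

Context (kap : 'rV[R]_M -> T -> R) (C : R) (kapP : corrector A K kap C).

Local Notation U0 := (U0 R d k).
Local Notation UN := (U0_norm d k p1).
Local Notation U := (U d k p1).

Lemma kap_summ v : summ (kap v). Proof. by have [_ _ /(_ v)[[]]] := kapP. Qed.

Lemma kap_linear : linear kap. Proof. by have [] := kapP. Qed.

Lemma kap_asum v : asum (kap v) <= C * mnorm v.
Proof. by have [_ _ /(_ v)[]] := kapP. Qed.

Lemma kap_mom f : summ f -> mom (kap (mom f)) = mom f.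
Proof. by move=> sf; have [_ _ _ + _] := kapP; apply; exact: l1_supK. Qed.

(** Subtracting the realisation of its moments sends every summable function into the hull, and
    [balU_id] shows that the hull itself is fixed. *)
Definition bal f : T -> R := f - kap (mom f).

Lemma summB f g : summ f -> summ g -> summ (f - g).
Proof. by move=> sf sg; have [] := am_supB (A := A) (l1_supK sf) (l1_supK sg). Qed.

Lemma summ_bal f : summ f -> summ (bal f).
Proof. by move=> sf; apply: summB => //; exact: kap_summ. Qed.

Lemma mom_bal f : summ f -> mom (bal f) = 0.
Proof. by move=> sf; rewrite l1_momB ?kap_mom ?subrr//; exact: kap_summ. Qed.

Lemma hull_le_bal f : summ f -> hull_le p1 (@l1_atom R d k) (bal f) (asum (bal f)).
Proof.
move=> sf; apply: (@hull_le_nu _ _ _ _ p1 _ _ A); last exact: mom_bal.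
exact/l1_supK/summ_bal.
Qed.

Definition balU f : U0 := insubd (0 : U0) (bal f).

Lemma val_balU f : summ f -> val (balU f) = bal f.
Proof.
move=> sf; rewrite /balU insubdK//.
by have [u <- _] := hull_le_bal sf; exact: valP.
Qed.

Lemma balU_linear c f g : summ f -> summ g -> balU (c *: f + g) = c *: balU f + balU g.
Proof.
move=> sf sg; apply: val_inj; rewrite val_balU; last exact: summ_lin.
rewrite /= !val_balU// /bal l1_momP// kap_linear.
by rewrite scalerBr opprD addrACA.
Qed.

Lemma balUB f g : summ f -> summ g -> balU (f - g) = balU f - balU g.
Proof. by move=> sf sg; rewrite addrC -scaleN1r balU_linear// scaleN1r addrC. Qed.

Lemma balU_id (u : U0) : balU (val u) = u.
Proof.
have [[su _] mu0] := hull_in A u; apply: val_inj; rewrite val_balU// /bal.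
have /eqP := mu0; rewrite -[am_mom A _]/(mom _) => /eqP ->.
have -> : kap 0 = 0.
  have := kap_linear 1 0 0; rewrite !scale1r addr0 => /eqP.
  by rewrite -subr_eq0 opprD addNKr oppr_eq0 => /eqP.
by rewrite subr0.
Qed.

Lemma mnorm_l1_mom f : summ f -> mnorm (mom f) <= M%:R * asum f.
Proof.
move=> sf; apply: mnorm_momvec => [|alpha _]; first exact: asum_ge0.
rewrite (le_trans (ler_norm_ssum (summ_monomial alpha sf)))//.
apply: le_nsum => [|x]; first exact: summ_norm.
by rewrite normr_ge0 normrM ler_piMl// monomial_bound.
Qed.

Definition Cp : R := 1 + C * M%:R.

Lemma C_ge0 : 0 <= C. Proof. by have [_ /ltW] := kapP. Qed.

Lemma Cp_gt0 : 0 < Cp.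
Proof. by rewrite ltr_pwDl// mulr_ge0// C_ge0. Qed.

Lemma norm_balU f : summ f -> UN (balU f) <= Cp * asum f.
Proof.
move=> sf; apply: hull_leP; rewrite val_balU//.
apply: hull_le_weaken (hull_le_bal sf).
rewrite /= (le_trans (am_nuB (A := A) (l1_supK sf) (l1_supK (kap_summ _))))//=.
rewrite mulrDl mul1r lerD2l (le_trans (kap_asum _))// -mulrA ler_wpM2l ?C_ge0//.
exact: mnorm_l1_mom.
Qed.

(** This is [disc_close] with [s] the balancing term: its l_1 norm is at most [C] times the moment
    discrepancy of the two discretisations, which falls below [zeta]. *)
Lemma balU_disc_close a e : 0 < e -> exists n0, 
  forall n n' (z : J (2 ^ n) -> T) (z' : J (2 ^ n') -> T),
  (n0 <= n)%N -> (n0 <= n')%N -> nodes z -> nodes z' ->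
  UN (balU (disc z a) - balU (disc z' a)) <= e.
Proof.
move=> e0; have [n0 [zeta zeta0 h]] := disc_close a e0.
pose D : R := C * (2 * M%:R * k%:R * `|a|).
have D0 : 0 <= D by rewrite mulr_ge0 ?C_ge0// !mulr_ge0.
have [n1 _ hn1] := near_infty_natSinv_lt (PosNum (divr_gt0 zeta0 (ltr_pwDr ltr01 D0))).
exists (maxn n0 n1.+1) => n n' z z'; rewrite !geq_max => /andP[n0n n1n] /andP[n0n' n1n'].
move=> hz hz'; have sz := summ_disc z a; have sz' := summ_disc z' a.
rewrite -balUB//; apply: hull_leP; rewrite val_balU; last exact: summB.
have small l (y : J (2 ^ l) -> T) : (n1 < l)%N -> nodes y ->
    C * mnorm (mom (disc y a) - MOM a) <= zeta / 2.
  move=> n1l hy; rewrite (le_trans (ler_wpM2l C_ge0 (disc_mom _ (expn2_gt0 l) hy)))//.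
  have lh : (n1 <= (2 ^ l).-1)%N.
    by rewrite -ltnS prednK ?expn2_gt0//; apply: ltn_trans n1l _; exact: ltn_expl.
  have := hn1 _ lh; rewrite /= prednK ?expn2_gt0// => hh.
  have -> : C * (M%:R * (k%:R / (2 ^ l)%:R) * `|a|) = D * (2 ^ l)%:R^-1 / 2.
    by rewrite /D; field; rewrite gt_eqF// ltr0n expn2_gt0.
  rewrite ler_pM2r ?invr_gt0// (le_trans (ler_wpM2l D0 (ltW hh)))//.
  by rewrite mulrA ler_pdivrMr ?ltr_wpDl// mulrDr mulr1 mulrC lerDl ltW.
have sk := kap_summ (mom (disc z a - disc z' a)).
have nk : summ (- kap (mom (disc z a - disc z' a))).
  by have [] := am_supZ (A := A) (-1) (l1_supK sk); rewrite scaleN1r.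
apply: h => //; last exact: (mom_bal (summB sz sz')).
rewrite -[asum _]/(am_nu A _) (am_nuN (A := A) (l1_supK sk)) (le_trans (kap_asum _))//.
rewrite l1_momB// -(subrKA (MOM a)) (le_trans (ler_wpM2l C_ge0 (mnormD _ _)))//.
rewrite mulrDr [leRHS]splitr lerD ?small//.
by rewrite -mnormN opprB small.
Qed.

Lemma balU_disc_cauchy a : is_cauchy_seq UN (fun n => balU (disc (@znode (2 ^ n)) a)).
Proof.
move=> e e0; have [n0 h] := balU_disc_close a (divr_gt0 e0 (ltr0n _ 2)).
exists n0 => m n m0 n_0; rewrite (le_lt_trans (h _ _ _ _ m0 n_0 _ _))//; try exact: nodes_znode.
by rewrite ltr_pdivrMr// mulr2n mulrDr mulr1 ltrDl.
Qed.

(** Defined on all of [L1]: for nonzero moments the balancing subtracts, in the limit, [kap] of the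
    moments of [a]. *)
Definition Jt a : U := to_sep (cauchy_seminorm UN) (mk_cauchy (balU_disc_cauchy a)).

Lemma Jt_linear : linear Jt.
Proof.
move=> c a b; rewrite /Jt -linearP; congr to_sep; apply: val_inj; apply/funext => n /=.
by rewrite disc_linear balU_linear//; exact: summ_disc.
Qed.

Lemma Jt_disc a e : 0 < e -> exists n0, forall n (z : J (2 ^ n) -> T),
  (n0 <= n)%N -> nodes z -> `|Jt a - to_completion UN (balU (disc z a))| <= e.
Proof.
move=> e0; have e20 : 0 < e / 2 by rewrite divr_gt0.
have [n0 h0] := balU_disc_close a e20.
have [n1 h1] := norm_completion_sub (mk_cauchy (balU_disc_cauchy a)) e20.
exists (maxn n0 n1) => n z; rewrite geq_max => /andP[n0n n1n] hz.
rewrite -(subrKA (to_completion UN (balU (disc (@znode (2 ^ n)) a)))).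
rewrite (le_trans (ler_normD _ _))// [leRHS]splitr lerD//; first exact: (h1 n n1n).
by rewrite -linearB norm_to_completion h0//; exact: nodes_znode.
Qed.

(** The node of a cell is taken inside [Q] whenever the cell meets [Q]; the other cells carry no
    mass of [a]. This keeps the discretisation supported by [Q]. *)
Lemma Jt_approx Q a e : L1_sup Q a -> 0 < e -> exists g, [/\ l1_sup Q g, asum g <= `|a|,
  mnorm (mom g - MOM a) <= e & `|Jt a - to_completion UN (balU g)| <= e].
Proof.
move=> aQ e0; have [n0 h0] := Jt_disc a e0.
pose D : R := M%:R * k%:R * `|a|; have D0 : 0 <= D by rewrite !mulr_ge0.
have [n1 _ hn1] := near_infty_natSinv_lt (PosNum (divr_gt0 e0 (ltr_pwDr ltr01 D0))).
pose n := maxn n0 n1.+1; have n1n : (n1 < n)%N by exact: leq_maxr.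
have /choice[z zP] : forall j : J (2 ^ n), exists z : T, ccube j (set_val z) /\
    ((exists2 x, cell j x & Q x) -> Q (set_val z)).
  move=> j; have [[x xj Qx]|nQ] := pselect (exists2 x, cell j x & Q x).
    exists (SigSub (mem_set (proj1 xj))); rewrite /set_val/=; split => //.
    exact: cell_ccube.
  by exists (znode j); split=> //; exact: nodes_znode.
have hz : nodes z by move=> j; case: (zP j).
exists (disc z a); split.
- apply: disc_sup => j hj; have [_] := zP j; apply; apply: contrapT => nQ.
  move/eqP: hj; apply; have [mh [C' hC]] := bc j.
  transitivity (\int[cube_measure R d]_x (0 : R)); last by rewrite Rintegral_cst// mul0r.
  apply: aeq_Rintegral.
  + by apply: integr_meas; apply: pair_integr.
  + exact: measurable_cst.
  + apply: filterS aQ => x hx; rewrite indicE.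
    have [xj|xj] := pselect (cell j x); last by rewrite memNset// mul0r.
    by rewrite hx ?mulr0// => Qx; case: nQ; exists x.
- exact/asum_disc/expn2_gt0.
- rewrite (le_trans (disc_mom _ (expn2_gt0 n) hz))//.
  have lh : (n1 <= (2 ^ n).-1)%N.
    by rewrite -ltnS prednK ?expn2_gt0//; apply: ltn_trans n1n _; exact: ltn_expl.
  have := hn1 _ lh; rewrite /= prednK ?expn2_gt0// => hh.
  have -> : M%:R * (k%:R / (2 ^ n)%:R) * `|a| = D * (2 ^ n)%:R^-1.
    by rewrite /D; field; rewrite gt_eqF// ltr0n expn2_gt0.
  rewrite (le_trans (ler_wpM2l D0 (ltW hh)))//.
  by rewrite mulrA ler_pdivrMr ?ltr_wpDl// mulrDr mulr1 mulrC lerDl ltW.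
- by apply: h0 => //; exact: leq_maxl.
Qed.

End Disc.

(** * Uniform densities on boxes *)

Section UniformBox.
Context (R : realType) (d k : nat).
Local Notation K := (unit_cube R d).
Local Notation mu := (cube_measure R d).
Local Notation J N := {ffun 'I_d -> 'I_N}.
Local Notation M := #|{: mindex d k}|.
Local Notation MOM := (@L1_mom R d k).
Implicit Types (x y : 'rV[R]_d) (r h : R).

Definition shiftv y r : 'rV[R]_d := \row_i (y 0 i + r).
Definition ubox_fun r y x : R := r^-1 ^+ d * \1_(hbox y (shiftv y r)) x.
Definition ubox r y : L1 R d := toL1 (ubox_fun r y).

Lemma hbox_cbox r y : hbox y (shiftv y r) `<=` cbox y r.
Proof. by move=> x hx i; have := hx i; rewrite mxE => /andP[-> /ltW]. Qed.

Lemma integr_indic S : measurable S -> integr (\1_S : 'rV[R]_d -> R).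
Proof. by move=> mS; have [mh [C hC]] := bmeas_indic mS; exact: bounded_integr mh hC. Qed.

Lemma Rintegral_indic (S : set 'rV[R]_d) : measurable S ->
  \int[mu]_x (\1_S x : R) = fine (mu S).
Proof. by move=> mS; rewrite /Rintegral integral_indic// setIT. Qed.

Lemma integr_ubox r y : integr (ubox_fun r y).
Proof. by apply: integrZ; apply: integr_indic; exact: measurable_hbox. Qed.

Lemma fine_cube_measure_le (S : set 'rV[R]_d) (a b : 'rV[R]_d) : measurable S ->
  (forall i, a 0 i <= b 0 i) -> S `<=` hbox a b ->
  fine (mu S) <= \prod_i (b 0 i - a 0 i).
Proof.
move=> mS ab Sab.
have h : (mu S <= (\prod_i (b 0 i - a 0 i))%:E)%E.
  by apply: cube_measure_le => // x [/Sab].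
rewrite -lee_fin fineK// ge0_fin_numE//.
by apply: le_lt_trans h _; exact: ltry.
Qed.

Lemma prod_shiftv r y : \prod_i (shiftv y r 0 i - y 0 i) = r ^+ d.
Proof.
rewrite -[d in RHS]card_ord -prodr_const; apply: eq_bigr => i _.
by rewrite mxE addrC addKr.
Qed.

(** Only an inequality, since the part of the box outside the unit cube has measure 0; [pair1_ubox]
    gives total mass 1 for boxes inside. *)
Lemma norm_ubox r y : 0 < r -> `|ubox r y| <= 1.
Proof.
move=> r0; rewrite norm_toL1; last exact: integr_ubox.
have e x : `|ubox_fun r y x| = ubox_fun r y x.
  by rewrite ger0_norm// mulr_ge0// exprn_ge0// invr_ge0 ltW.
rewrite (@eq_Rintegral _ _ _ _ _ (ubox_fun r y)) => [|x _]; last exact: e.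
rewrite RintegralZl//; last by apply: integr_indic; exact: measurable_hbox.
rewrite Rintegral_indic; last exact: measurable_hbox.
rewrite exprVn mulrC ler_pdivrMr ?exprn_gt0// mul1r -(prod_shiftv r y).
apply: fine_cube_measure_le => //; first exact: measurable_hbox.
by move=> i; rewrite mxE lerDl ltW.
Qed.

Lemma ubox_sup r y Q : cbox y r `<=` Q -> L1_sup Q (ubox r y).
Proof.
move=> yQ; apply: filterS (toL1K (integr_ubox r y)) => x -> Qx.
by rewrite /ubox_fun indicE memNset ?mulr0// => /hbox_cbox/yQ.
Qed.

Lemma pair1_ubox r y : 0 < r -> cbox y r `<=` K -> pair (fun=> 1) (ubox r y) = 1.
Proof.
move=> r0 yK; rewrite pair_toL1; [|exact: bmeas_cst|exact: integr_ubox].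
rewrite (@eq_Rintegral _ _ _ _ _ (ubox_fun r y)) => [|x _]; last by rewrite mul1r.
rewrite RintegralZl//; last by apply: integr_indic; exact: measurable_hbox.
rewrite Rintegral_indic; last exact: measurable_hbox.
rewrite cube_measure_hbox /= ?prod_shiftv.
- by rewrite exprVn mulVf// expf_neq0// gt_eqF.
- by move=> i; rewrite mxE lerDl ltW.
- exact: subset_trans (@hbox_cbox r y) yK.
Qed.

Lemma cbox_corner r y : 0 <= r -> cbox y r y.
Proof. by move=> r0 i; rewrite lexx lerDl. Qed.

Lemma ubox_mom r y : 0 < r -> cbox y r `<=` K ->
  mnorm (MOM (ubox r y) - momvec k (fun alpha => monomial alpha y)) <= M%:R * (k%:R * r).
Proof.
move=> r0 yK; have Ky : K y by apply: yK; apply: cbox_corner; exact: ltW.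
rewrite momvecB; apply: mnorm_momvec => [|alpha ak]; first by rewrite mulr_ge0// ltW.
have := @pair_near _ _ (@monomial R d alpha) (monomial alpha y) (cbox y r) (k%:R * r) (ubox r y).
rewrite pair1_ubox// mulr1 => h; apply: (le_trans (h _ _ _ _)).
- by rewrite mulr_ge0// ltW.
- exact: bmeas_monomial.
- exact: ubox_sup.
- move=> x Kx xy; apply: monomial_lip => //; first exact: ltW.
  by move=> i; have /andP[h1 h2] := xy i; rewrite ler_norml; apply/andP; split; lra.
- by rewrite ler_piMr ?norm_ubox// mulr_ge0// ltW.
Qed.

Lemma toL1_sum (I : Type) (s : seq I) (c : I -> R) (F : I -> 'rV[R]_d -> R) :
  (forall i, integr (F i)) ->
  \sum_(i <- s) c i *: toL1 (F i) = toL1 (fun x => \sum_(i <- s) c i * F i x).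
Proof.
move=> hF; apply: toL1_eq; first by apply: integr_sum => i _; exact: integrZ.
elim: s => [|i s IH].
  rewrite big_nil; have /L1_seminorm_eq0 := repr_to_sep (L1_seminorm R d) 0.
  apply: filterS => x; rewrite linear0 big_nil => /eqP.
  by rewrite subr_eq0 => /eqP.
rewrite big_cons; apply: filterS3 (L1_funP (c i) (toL1 (F i)) (\sum_(j <- s) c j *: toL1 (F j)))
  IH (toL1K (hF i)) => x -> -> ->.
by rewrite big_cons.
Qed.

Lemma toL1B f g : integr f -> integr g -> toL1 f - toL1 g = toL1 (fun x => f x - g x).
Proof.
move=> fi gi; have := @toL1_sum bool [:: true; false] (fun b => if b then 1 else -1)
  (fun b => if b then f else g).
rewrite big_cons big_seq1 scale1r scaleN1r => -> => [|[]//].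
by congr toL1; apply/funext => x; rewrite big_cons big_seq1 mul1r mulN1r.
Qed.

Definition gridv r L y (t : J L) : 'rV[R]_d := \row_i (y 0 i + r * (t i)%:R).

Lemma indic_hbox a b x : \1_(hbox a b) x = \prod_i (a 0 i <= x 0 i < b 0 i)%R%:R :> R.
Proof.
rewrite indicE; have [h|h] := pselect (hbox a b x).
  by rewrite mem_set// big1// => i _; rewrite h.
rewrite memNset//; apply/esym/eqP; rewrite prodf_seq_eq0; apply: contrapT => /negP.
rewrite -all_predC => /allP h'; apply: h => i.
have := h' i (mem_index_enum i); rewrite /=.
by case: (_ <= _ < _) => //; rewrite eqxx.
Qed.

Lemma indic_itv_tile (y x r : R) L : 0 <= r ->
  (y <= x < y + r * L%:R)%R%:R = \sum_(l < L) (y + r * l%:R <= x < y + r * l%:R + r)%R%:R :> R.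
Proof.
move=> r0; elim: L => [|L IH].
  rewrite big_ord0 mulr0 addr0 leNgt; by case: (x < y).
rewrite big_ord_recr /= -IH -natr1 mulrDr mulr1 addrA.
have rL : 0 <= r * L%:R by rewrite mulr_ge0.
case: (leP y x) => h1; case: (ltP x (y + r * L%:R)) => h2;
  case: (leP (y + r * L%:R) x) => h3; case: (ltP x (y + r * L%:R + r)) => h4 //=;
  rewrite ?addr0 ?add0r//; exfalso; lra.
Qed.

(** Each side is cut into [L] half-open intervals; expanding the product of the sums yields the
    grid, with the volume ratio [L^-d] as weight. *)
Lemma ubox_tile h L y : 0 < h -> (0 < L)%N ->
  ubox h y = \sum_(t : J L) L%:R^-1 ^+ d *: ubox (h / L%:R) (gridv (h / L%:R) y t).
Proof.
move=> h0 L0; have L0' : 0 < L%:R :> R by rewrite ltr0n.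
have r0 : 0 <= h / L%:R by rewrite divr_ge0 ?ltW.
rewrite toL1_sum => [|t]; last exact: integr_ubox.
congr toL1; apply/funext => x; rewrite /ubox_fun.
have E : L%:R^-1 ^+ d * (h / L%:R)^-1 ^+ d = h^-1 ^+ d.
  by rewrite -exprMn invf_div (mulKf (lt0r_neq0 L0')).
under eq_bigr do rewrite mulrA E.
rewrite -mulr_sumr; congr (_ * _); rewrite indic_hbox.
under eq_bigr do rewrite mxE -[X in _ + X](divfK (lt0r_neq0 L0')) (indic_itv_tile _ _ _ r0).
rewrite bigA_distr_bigA /=; apply: eq_bigr => t _; rewrite indic_hbox.
by apply: eq_bigr => i _; rewrite !mxE.
Qed.

Lemma bernoulli_ge (x : R) n : 0 <= x <= 1 -> 1 - n%:R * x <= (1 - x) ^+ n.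
Proof.
move=> /andP[x0 x1]; elim: n => [|n IH]; first by rewrite mul0r subr0 expr0.
rewrite exprS -natr1 (@le_trans _ _ ((1 - x) * (1 - n%:R * x)))//; last first.
  by rewrite ler_wpM2l// subr_ge0.
have : 0 <= n%:R * x * x by rewrite !mulr_ge0.
lra.
Qed.

(** The overlap of the two boxes has sides at least [h - h/L], hence volume at least [h^d (1 - d/L)]
    by Bernoulli. Each box loses at most the fraction [d/L], which explains the factor 2. *)
Lemma ubox_shift h L y y' : 0 < h -> (0 < L)%N -> cbox y h `<=` K -> cbox y' h `<=` K ->
  (forall i, y' 0 i <= y 0 i <= y' 0 i + h / L%:R) ->
  `|ubox h y - ubox h y'| <= 2 * d%:R / L%:R.
Proof.
move=> h0 L0 yK yK' yy'; have L0' : 0 < L%:R :> R by rewrite ltr0n.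
have hL : 0 <= h / L%:R by rewrite divr_ge0 ?ltW.
have Lh : h / L%:R <= h by rewrite ler_pdivrMr// ler_peMr ?(ltW h0)// ler1n.
rewrite toL1B; [|exact: integr_ubox|exact: integr_ubox].
set A := hbox y (shiftv y h); set B := hbox y' (shiftv y' h).
pose I := hbox y (shiftv y' h).
have mA : measurable A by exact: measurable_hbox.
have mB : measurable B by exact: measurable_hbox.
have mI : measurable I by exact: measurable_hbox.
have IA : I `<=` A.
  move=> x xI i; have := xI i; rewrite !mxE => /andP[-> h2] /=.
  by have /andP[h3 _] := yy' i; lra.
have IB : I `<=` B.
  move=> x xI i; have := xI i; rewrite !mxE => /andP[h1 ->].
  by have /andP[h3 _] := yy' i; rewrite andbT; lra.
have iA := integr_indic mA; have iB := integr_indic mB; have iI := integr_indic mI.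
have iD : integr (fun x => ubox_fun h y x - ubox_fun h y' x).
  by apply: integrB; exact: integr_ubox.
have hd : 0 <= h^-1 ^+ d by rewrite exprn_ge0// invr_ge0 ltW.
have iU : integr (fun x => (\1_A x - \1_I x) + (\1_B x - \1_I x)).
  have := integr_lin 1 (integrB iA iI) (integrB iB iI).
  by under eq_fun do rewrite mul1r.
rewrite norm_toL1// (@le_trans _ _ (\int[mu]_x (h^-1 ^+ d * ((\1_A x - \1_I x) + (\1_B x - \1_I x)))))//.
  apply: le_Rintegral => //; [exact: integr_norm|exact: integrZ|].
  move=> x _; rewrite /ubox_fun -mulrBr normrM ger0_norm// ler_wpM2l// -/A -/B !indicE.
  have [xI|xI] := pselect (I x).
    by rewrite (mem_set xI) (mem_set (IA _ xI)) (mem_set (IB _ xI)) !subrr normr0 addr0.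
  rewrite (memNset xI) !subr0 (le_trans (ler_normB _ _))// lerD//;
    by case: (_ \in _); rewrite ?normr1 ?normr0.
rewrite RintegralZl// RintegralD//; [|exact: integrB|exact: integrB].
rewrite !RintegralB// !Rintegral_indic//.
have vA : fine (mu A) <= h ^+ d.
  rewrite -(prod_shiftv h y); apply: fine_cube_measure_le => // i.
  by rewrite mxE lerDl ltW.
have vB : fine (mu B) <= h ^+ d.
  rewrite -(prod_shiftv h y'); apply: fine_cube_measure_le => // i.
  by rewrite mxE lerDl ltW.
have vI : h ^+ d * (1 - d%:R / L%:R) <= fine (mu I).
  rewrite cube_measure_hbox; last 2 first.
  - by move=> i; rewrite mxE; have /andP[_ h2] := yy' i; lra.
  - by move=> x /IA/hbox_cbox/yK.
  rewrite /= (@le_trans _ _ ((h - h / L%:R) ^+ d))//.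
    have -> : h - h / L%:R = h * (1 - L%:R^-1) by rewrite mulrBr mulr1.
    rewrite exprMn ler_wpM2l ?exprn_ge0 ?(ltW h0)// bernoulli_ge//.
    by rewrite invr_ge0 ltW//= invf_le1// ler1n.
  rewrite -[d in X in X <= _]card_ord -prodr_const; apply: ler_prod => i _.
  rewrite subr_ge0 Lh mxE /=; have /andP[_ h2] := yy' i; lra.
rewrite exprVn mulrC ler_pdivrMr ?exprn_gt0//.
have -> : 2 * d%:R / L%:R * h ^+ d = 2 * (h ^+ d * (d%:R / L%:R)) by ring.
rewrite mulrBr mulr1 in vI; lra.
Qed.

End UniformBox.

(** * Smearing point masses *)

Section Smear.
Context (R : realType) (d k : nat).
Local Notation K := (unit_cube R d).
Local Notation T := (unit_cube R d).
Local Notation J N := {ffun 'I_d -> 'I_N}.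
Local Notation M := #|{: mindex d k}|.
Local Notation mom := (@l1_mom R d k).
Local Notation MOM := (@L1_mom R d k).
Implicit Types (f g a : T -> R) (s : seq T).

(** Eventually along finite subsets. Smearing acts on finitely many points, and several
    approximations have to hold for one and the same [s]. *)
Definition evs (P : seq T -> Prop) :=
  exists s1, forall s, uniq s -> {subset s1 <= s} -> P s.

Lemma evs_all (I : finType) (P : I -> seq T -> Prop) :
  (forall i, evs (P i)) -> evs (fun s => forall i, P i s).
Proof.
move=> /choice[s1 h]; exists (flatten [seq s1 i | i <- index_enum I]) => s us ss i.
apply: h => // x xs; apply: ss; apply/flatten_mapP; exists i => //.
Qed.

Lemma evs_mono (P P' : seq T -> Prop) : (forall s, uniq s -> P s -> P' s) -> evs P -> evs P'.
Proof. by move=> PP [s1 h]; exists s1 => s us ss; apply: PP => //; exact: h. Qed.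

Lemma evsI (P P' : seq T -> Prop) : evs P -> evs P' -> evs (fun s => P s /\ P' s).
Proof.
move=> [s1 h] [s2 h']; exists (s1 ++ s2) => s us ss.
by split; [apply: h|apply: h'] => // x xs; apply: ss; rewrite mem_cat xs ?orbT.
Qed.

Lemma evs_sub s1 : evs (fun s => {subset s1 <= s}).
Proof. by exists s1. Qed.

Lemma evs_ex (P : seq T -> Prop) : evs P -> exists s, uniq s /\ P s.
Proof.
move=> [s1 h]; exists (undup s1); split; first exact: undup_uniq.
by apply: h; [exact: undup_uniq|move=> x; rewrite mem_undup].
Qed.

Definition tail f s := asum (fun x => f x - trunc s f x).

Lemma tail_evs f e : summ f -> 0 < e -> evs (fun s => tail f s <= e).
Proof.
move=> sf e0; have [s1 us1 h1] := trunc_tail sf e0.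
exists s1 => s us ss; apply: le_trans h1; apply: le_nsum => [|x].
  apply: summ_norm; apply: le_summ sf => x; rewrite truncE//.
  by case: ifP; rewrite ?subrr ?normr0 ?subr0.
rewrite normr_ge0/= !truncE//; case: ifPn => [_|xs]; first by rewrite subrr normr0.
by case: ifPn => // xs1; move: xs; rewrite ss.
Qed.

(** As the full sum vanishes, the partial sum is minus the remaining one. The bound [C] only secures
    summability; the estimate uses the bound 1 on the support. *)
Lemma lsum_trunc f (phi : T -> R) s C : summ f -> uniq s -> (forall x, `|phi x| <= C) ->
  (forall x, f x != 0 -> `|phi x| <= 1) -> lsum (fun x => phi x * f x) = 0 ->
  `|\sum_(x <- s) f x * phi x| <= tail f s.
Proof.
move=> sf us hC h1 f0.
have st : summ (trunc s f).
  by apply: le_summ sf => x; rewrite truncE//; case: ifP => // _; rewrite normr0.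
have -> : \sum_(x <- s) f x * phi x = lsum (fun x => phi x * trunc s f x).
  rewrite /trunc; elim: (s) => [|x r IH].
    rewrite !big_nil; have := lsumP 1 hC (@summ0 R T) (@summ0 R T).
    have E : ((1 : R) *: (fun=> 0) + (fun=> 0) : T -> R) = (fun=> 0).
      by apply/funext => y; rewrite !fctE scaler0 addr0.
    rewrite E mul1r => /eqP; rewrite -subr_eq0 opprD addNKr oppr_eq0 => /eqP ->.
    by [].
  rewrite !big_cons IH (lsumP _ hC); [|exact: summ_delta|].
    by congr (_ * _ + _); rewrite -(ssum_delta phi).
  elim: r {IH} => [|y r IH]; first by rewrite big_nil; exact: summ0.
  by rewrite big_cons; apply: summ_lin => //; exact: summ_delta.
have sB : summ (fun x => f x - trunc s f x).
  apply: le_summ sf => x; rewrite truncE//.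
  by case: ifP; rewrite ?subrr ?normr0 ?subr0.
have := lsumP (-1) hC st sf; rewrite f0 addr0 mulN1r => /(congr1 (fun z => `|z|)).
rewrite normrN => <-; apply: le_trans (ler_norm_ssum _) _.
  by apply: summM hC _; exact: summ_lin.
apply: le_nsum => [|x]; first exact: summ_norm.
have -> : (-1 *: trunc s f + f) x = f x - trunc s f x.
  by rewrite -[LHS]/(-1 * trunc s f x + f x) mulN1r addrC.
rewrite normr_ge0/= normrM.
have [x0|x0] := eqVneq (f x) 0; last by rewrite ler_piMl// h1.
by rewrite truncE// x0; case: ifP; rewrite subrr normr0 mulr0.
Qed.

(** Polynomials of degree at most [n]. Substituting an affine map in a monomial leaves this class,
    which carries the vanishing of moments over to shrunk and translated atoms. *)
Inductive pd : nat -> ('rV[R]_d -> R) -> Prop :=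
| pd_monomial n alpha c : (\sum_i alpha i <= n)%N -> pd n (fun x => c * monomial alpha x)
| pd_add n P P' : pd n P -> pd n P' -> pd n (fun x => P x + P' x).

Lemma pd_mul n P (t c : R) i : pd n P -> pd n.+1 (fun x => (t * x 0 i + c) * P x).
Proof.
elim=> {n P} [n alpha b h|n P P' _ IH _ IH']; last first.
  rewrite (_ : (fun x : 'rV[R]_d => _) = fun x : 'rV[R]_d => (t * x 0 i + c) * P x + (t * x 0 i + c) * P' x).
    exact: pd_add.
  by apply/funext => x; rewrite mulrDr.
pose beta j := (alpha j + (j == i))%N.
rewrite (_ : (fun x : 'rV[R]_d => _) = fun x => (t * b) * monomial beta x + (c * b) * monomial alpha x).
  apply: pd_add; apply: pd_monomial; last exact: leqW.
  have E : (\sum_j (j == i) = 1)%N by rewrite (bigD1 i)//= eqxx big1 ?addn0// => j /negbTE ->.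
  by rewrite big_split /= E addn1 ltnS.
apply/funext => x; rewrite mulrDl; congr (_ + _); last by rewrite mulrA.
have -> : monomial beta x = x 0 i * monomial alpha x.
  rewrite /monomial /beta; under eq_bigr do rewrite exprD.
  rewrite big_split /= mulrC; congr (_ * _).
  rewrite (bigD1 i)//= eqxx expr1 big1 ?mulr1// => j /negbTE ->.
  by rewrite expr0.
ring.
Qed.

Lemma pd_affine (t : R) (c : 'rV[R]_d) alpha :
  pd (\sum_i alpha i) (fun x => monomial alpha (t *: x + c)).
Proof.
rewrite /monomial; elim: (index_enum _) => [|i r IH].
  have := @pd_monomial 0 (fun=> 0%N) 1 _; rewrite big1// => /(_ isT).
  rewrite big_nil; congr pd; apply/funext => x; rewrite big_nil mul1r /monomial.
  by rewrite big1.
rewrite big_cons (_ : (fun x : 'rV[R]_d => _) = fun x : 'rV[R]_d => (t *: x + c) 0 i ^+ alpha i *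
    \prod_(j <- r) (t *: x + c) 0 j ^+ alpha j); last by apply/funext => x; rewrite big_cons.
elim: (alpha i) => [|m IHm].
  rewrite add0n; move: IH; congr pd; apply/funext => x.
  by rewrite expr0 mul1r.
move: (pd_mul t (c 0 i) i IHm); rewrite addSn; congr pd; apply/funext => x.
by rewrite !mxE exprS mulrA.
Qed.

Lemma pd_lsum n P f : pd n P -> (n < k)%N -> summ f -> mom f = 0 ->
  (exists C, forall x : T, `|P (set_val x)| <= C) /\ lsum (fun x => P (set_val x) * f x) = 0.
Proof.
move=> nP nk sf f0; elim: nP nk => {n P} [n alpha c h|n P P' _ IH _ IH'] nk.
  split.
    by exists `|c| => x; rewrite normrM ler_piMr// monomial_bound.
  have /momvec_eq0/(_ alpha (leq_ltn_trans h nk)) f1 := f0.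
  transitivity (c * lsum (fun x : T => monomial alpha (set_val x) * f x)); last by rewrite f1 mulr0.
  rewrite -ssumZ; last exact: summ_monomial.
  by congr (@ssum R T _); apply/funext => x; rewrite mulrA.
have [[C hC] h] := IH nk; have [[C' hC'] h'] := IH' nk; split.
  by exists (C + C') => x; rewrite (le_trans (ler_normD _ _))// lerD.
transitivity (lsum (fun x : T => P (set_val x) * f x) + lsum (fun x => P' (set_val x) * f x)).
  rewrite -ssumD; [|exact: summM hC sf|exact: summM hC' sf].
  by congr (@ssum R T _); apply/funext => x; rewrite mulrDl.
by rewrite h h' addr0.
Qed.

Definition smear (kap : T -> L1 R d) s f : L1 R d := \sum_(x <- s) f x *: kap x.

Lemma smearP kap s c f g : smear kap s (c *: f + g) = c *: smear kap s f + smear kap s g.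
Proof.
rewrite scaler_sumr -big_split; apply: eq_bigr => x _ /=.
by rewrite scalerA -scalerDl.
Qed.

Lemma smear_sum kap s (I : Type) (r : seq I) (c : I -> R) (F : I -> T -> R) :
  smear kap s (\sum_(i <- r) c i *: F i) = \sum_(i <- r) c i *: smear kap s (F i).
Proof.
elim: r => [|i r IH]; last by rewrite !big_cons smearP IH.
by rewrite !big_nil /smear big1// => x _; rewrite scale0r.
Qed.

Lemma norm_smear kap s f (e : R) : 0 <= e -> uniq s -> summ f ->
  (forall x, f x != 0 -> `|kap x| <= e) ->
  `|smear kap s f| <= e * asum f.
Proof.
move=> e0 us sf h; apply: le_trans (ler_norm_sum _ _ _) _.
apply: (@le_trans _ _ (e * \sum_(x <- s) `|f x|)); last first.
  by rewrite ler_wpM2l// sum_le_asum.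
rewrite mulr_sumr; apply: ler_sum => x _; rewrite normrZ mulrC.
by have [->|/h ?] := eqVneq (f x) 0; [rewrite normr0 !mulr0|rewrite ler_wpM2r].
Qed.

Definition aff (t : R) (c : 'rV[R]_d) (x : T) : 'rV[R]_d := t *: set_val x + c.

Lemma smear_mom_near s f (t r : R) c : 0 < r -> uniq s -> summ f ->
  (forall x, cbox (aff t c x) r `<=` K) -> mom f = 0 ->
  mnorm (MOM (smear (fun x => ubox r (aff t c x)) s f)) <=
  M%:R * (k%:R * r) * asum f + M%:R * tail f s.
Proof.
move=> r0 us sf fK f0.
have -> : MOM (smear (fun x => ubox r (aff t c x)) s f) =
    \sum_(x <- s) f x *: (MOM (ubox r (aff t c x)) - momvec k (fun al => monomial al (aff t c x)))
    + momvec k (fun al => \sum_(x <- s) f x * monomial al (aff t c x)).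
  rewrite /smear L1_mom_sum.
  have -> : momvec k (fun al => \sum_(x <- s) f x * monomial al (aff t c x)) =
      \sum_(x <- s) f x *: momvec k (fun al => monomial al (aff t c x)).
    elim: (s) => [|x l IH].
      by rewrite big_nil; apply/momvec_eq0 => al _; rewrite big_nil.
    rewrite big_cons -IH; apply: momvecP => al _; by rewrite big_cons.
  rewrite -big_split; apply: eq_bigr => x _ /=.
  rewrite -scalerDr subrK; have := L1_momP k (f x) (ubox r (aff t c x)) 0.
  have := L1_momP k 1 0 (0 : L1 R d); rewrite scale1r addr0 scale1r => /eqP.
  by rewrite -subr_eq0 opprD addNKr oppr_eq0 => /eqP ->; rewrite !addr0.
apply: le_trans (mnormD _ _) _; apply: lerD.
  apply: le_trans (mnorm_sum _ _) _.
  apply: (@le_trans _ _ (M%:R * (k%:R * r) * \sum_(x <- s) `|f x|)); last first.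
    by rewrite ler_wpM2l ?sum_le_asum// !mulr_ge0// ltW.
  rewrite mulr_sumr; apply: ler_sum => x _.
  rewrite (_ : mnorm _ = `|f x| * mnorm (MOM (ubox r (aff t c x)) - momvec k (fun al => monomial al (aff t c x)))).
    by rewrite mulrC ler_wpM2r// ubox_mom.
  by rewrite /mnorm mulr_sumr; apply: eq_bigr => j _; rewrite mxE normrM.
apply: mnorm_momvec => [|al alk]; first exact: asum_ge0.
have [[C hC] h] := pd_lsum (pd_affine t c al) alk sf f0.
apply: (lsum_trunc sf us hC) => // x _.
have Kx : K (aff t c x) by apply: fK; apply: cbox_corner; exact: ltW.
rewrite ger0_norm; [exact: monomial_le1|exact: monomial_ge0].
Qed.

Lemma smear_tile s f (t r : R) c L : 0 < r -> (0 < L)%N ->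
  smear (fun x => ubox r (aff t c x)) s f = \sum_(q : J L) L%:R^-1 ^+ d *:
    smear (fun x => ubox (r / L%:R) (aff t (gridv (r / L%:R) c q) x)) s f.
Proof.
move=> r0 L0; under [RHS]eq_bigr do rewrite scaler_sumr.
rewrite exchange_big; apply: eq_bigr => x _; rewrite (ubox_tile _ r0 L0) scaler_sumr.
apply: eq_bigr => q _; rewrite !scalerA mulrC; congr (_ *: ubox _ _).
by apply/rowP => i; rewrite !mxE addrA.
Qed.

Lemma sum_weights L : (0 < L)%N -> \sum_(q : J L) L%:R^-1 ^+ d = 1 :> R.
Proof.
move=> L0; rewrite sumr_const (card_ffun 'I_d 'I_L) !card_ord -[_ *+ (L ^ d)]mulr_natl natrX exprVn mulfV//.
by rewrite expf_neq0// pnatr_eq0 -lt0n.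
Qed.

(* The moments vanish up to the tail for all side lengths: cutting the boxes into
   [L ^ d] boxes makes the error of [smear_mom_near] arbitrarily small. *)
Lemma smear_mom s f (t r : R) c : 0 < r -> uniq s -> summ f ->
  (forall x, cbox (aff t c x) r `<=` K) -> mom f = 0 ->
  mnorm (MOM (smear (fun x => ubox r (aff t c x)) s f)) <= M%:R * tail f s.
Proof.
move=> r0 us sf fK f0; apply/ler_addgt0Pr => e e0.
have [L L0 hL] : exists2 L, (0 < L)%N & M%:R * (k%:R * (r / L%:R)) * asum f <= e.
  exists (Num.truncn (M%:R * (k%:R * r) * asum f / e)).+1 => //.
  have := truncnS_gt (M%:R * (k%:R * r) * asum f / e).
  rewrite ltr_pdivrMr// => h; rewrite !mulrA mulrAC ler_pdivrMr ?ltr0n//.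
  rewrite [leRHS]mulrC; move: h; rewrite !mulrA; exact: ltW.
have rL0 : 0 < r / L%:R by rewrite divr_gt0// ltr0n.
rewrite (smear_tile _ _ _ _ r0 L0) L1_mom_sum; apply: le_trans (mnorm_sum _ _) _.
apply: (@le_trans _ _ (\sum_(q : J L) L%:R^-1 ^+ d * (M%:R * tail f s + e))); last first.
  by rewrite -big_distrl /= sum_weights// mul1r.
apply: ler_sum => q _.
have ->: MOM (L%:R^-1 ^+ d *: smear (fun x => ubox (r / L%:R) (aff t (gridv (r / L%:R) c q) x)) s f)
  = L%:R^-1 ^+ d *: MOM (smear (fun x => ubox (r / L%:R) (aff t (gridv (r / L%:R) c q) x)) s f).
  have := @am_momZ _ _ _ _ _ (L1_model R d k) (L%:R^-1 ^+ d) _ (@L1_supK R d _); exact.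
rewrite (_ : mnorm _ = L%:R^-1 ^+ d * mnorm (MOM (smear (fun x => ubox (r / L%:R) (aff t (gridv (r / L%:R) c q) x)) s f))); last first.
  rewrite /mnorm mulr_sumr; apply: eq_bigr => j _; rewrite mxE normrM ger0_norm//.
rewrite ler_wpM2l ?exprn_ge0 ?invr_ge0//.
apply: le_trans (smear_mom_near rL0 us sf _ f0) _; last by rewrite addrC lerD2l.
move=> x; apply: subset_trans (fK x) => y yb i; have := yb i; rewrite !mxE.
have qi : (q i)%:R + 1 <= L%:R :> R by rewrite natr1 ler_nat.
have h1 : 0 <= r / L%:R * (q i)%:R by rewrite mulr_ge0// ltW.
have h2 : r / L%:R * (q i)%:R + r / L%:R <= r.
  rewrite -[X in _ + X]mulr1 -mulrDr -[leRHS](divfK (_ : L%:R != 0)) ?ler_wpM2l//; first exact: ltW.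
  by rewrite pnatr_eq0 -lt0n.
by move=> /andP[h3 h4]; apply/andP; split; lra.
Qed.

(** The smeared atom has moments at most [M] times the tail, whatever the side [r]. The cost of
    correcting them inside [Q'] is fixed beforehand, so a large [s] makes the correction as small as
    wanted. *)
Lemma smear_atom (Q Q' : set 'rV[R]_d) f (t r delta : R) c : Q' `<=` K -> 0 < r -> 0 < delta ->
  (forall x, cbox (aff t c x) r `<=` K) ->
  (forall x : T, Q (set_val x) -> cbox (aff t c x) r `<=` Q') ->
  l1_sup Q f -> asum f <= 1 -> mom f = 0 ->
  evs (fun s => exists a : L1 R d, [/\ L1_sup Q' a, `|a| <= 1 + delta, MOM a = 0 &
    `|smear (fun x => ubox r (aff t c x)) s f - a| <= delta]).
Proof.
move=> Q'K r0 del0 fK fQ [sf fs] f1 f0.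
have [kap [C [klin C0 kS kM _]]] := corrector_ex (L1_model R d k) Q'K.
have e0 : 0 < delta / (C * (M%:R + 1)) by rewrite divr_gt0// mulr_gt0// ltr_wpDl.
apply: evs_mono (tail_evs sf e0) => s us hs.
set S := smear _ s f.
have SQ : L1_sup Q' S.
  apply: (@am_sup_sum _ _ _ _ _ (L1_model R d k) Q') => x _.
  have [xQ|xQ] := pselect (Q (set_val x)).
    by apply: (@am_supZ _ _ _ _ _ (L1_model R d k) Q'); exact/ubox_sup/fQ.
  by rewrite fs// scale0r; exact: (am_sup0 (L1_model R d k)).
have Sn : `|S| <= 1.
  have := @norm_smear (fun x => ubox r (aff t c x)) s f 1 ler01 us sf.
  by rewrite mul1r => h; apply: le_trans f1; apply: h => x _; exact: norm_ubox.
have kn : `|kap (MOM S)| <= delta.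
  have [_ /le_trans] := kS (MOM S); apply.
  apply: (@le_trans _ _ (C * (M%:R * (delta / (C * (M%:R + 1)))))).
    rewrite ler_wpM2l ?(ltW C0)//; apply: le_trans (smear_mom r0 us sf fK f0) _.
    by rewrite ler_wpM2l.
  have M1 : 0 < M%:R + 1 :> R by rewrite ltr_wpDl.
  have -> : C * (M%:R * (delta / (C * (M%:R + 1)))) = delta * (M%:R / (M%:R + 1)).
    by field; rewrite !gt_eqF.
  by rewrite ler_piMr ?(ltW del0)// ler_pdivrMr// mul1r lerDl.
exists (S - kap (MOM S)); split.
- by apply: (@am_supB _ _ _ _ _ (L1_model R d k) Q') => //; exact: (kS _).1.
- by rewrite (le_trans (ler_normB _ _))// lerD.
- have := @am_momB _ _ _ _ _ (L1_model R d k) _ _ (L1_supK S) (L1_supK (kap (MOM S))).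
  by move=> h; apply: (etrans h); rewrite (kM S SQ) subrr.
- by rewrite opprB addrC subrK.
Qed.

End Smear.

(** * Smearing whole chains at one common side *)

Section SmearChain.
Context (R : realType) (d k : nat) (p : R) (p1 : 1 <= p).
Local Notation K := (unit_cube R d).
Local Notation T := (unit_cube R d).
Local Notation J N := {ffun 'I_d -> 'I_N}.
Local Notation mom := (@l1_mom R d k).
Local Notation MOM := (@L1_mom R d k).

Lemma cbox_unit (c : 'rV[R]_d) r i : 0 < r -> cbox c r `<=` K -> 0 <= c 0 i /\ c 0 i + r <= 1.
Proof.
move=> r0 cK; split.
  have /cK/(_ i)/andP[] // : cbox c r c by apply: cbox_corner; exact: ltW.
have /cK/(_ i) : cbox c r (shiftv c r) by move=> j; rewrite mxE lexx lerDl ltW.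
by rewrite mxE => /andP[].
Qed.

Section Family.
Context (h : R) (h0 : 0 < h) (h1 : h < 1).
Let h01 : 0 < 1 - h. Proof. by rewrite subr_gt0. Qed.

(** The image of [cbox c r] under [x -> (1 - h) x], moved by [r'] times the grid vector [q]. For
    fixed [q] this is one affine map for all cubes, so packings go to packings. *)
Let tcube c r (r' : R) L (q : J L) : set 'rV[R]_d := cbox (gridv r' ((1 - h) *: c) q) ((1 - h) * r).

Let gridP L (q : J L) i : (0 < L)%N -> 0 <= h / L%:R * (q i)%:R /\ h / L%:R * (q i)%:R + h / L%:R <= h.
Proof.
move=> L0; have Lp : 0 < L%:R :> R by rewrite ltr0n.
have hL : 0 < h / L%:R by rewrite divr_gt0.
have qi : (q i)%:R + 1 <= L%:R :> R by rewrite natr1 ler_nat.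
split; first by rewrite mulr_ge0// ltW.
by rewrite -[X in _ + X]mulr1 -mulrDr mulrAC ler_pdivrMr// ler_wpM2l// ltW.
Qed.

Let tcube_unit c r L (q : J L) : (0 < L)%N -> 0 < r -> cbox c r `<=` K ->
  tcube c r (h / L%:R) q `<=` K.
Proof.
move=> L0 r0 cK y yq i; have := yq i; rewrite !mxE.
have [c0 c1] := cbox_unit i r0 cK; have [g0 g1] := gridP q i L0.
have hL : 0 < h / L%:R by rewrite divr_gt0// ltr0n.
have t0 : 0 <= (1 - h) * c 0 i by rewrite mulr_ge0// ltW.
have t1 : (1 - h) * (c 0 i + r) <= 1 - h by rewrite ler_piMr// ltW.
move=> /andP[y0 y1]; apply/andP; split; lra.
Qed.

Let tcube_packing n (c : 'I_n -> 'rV[R]_d) (r : 'I_n -> R) L (q : J L) : (0 < L)%N ->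
  (forall i, 0 < r i) -> packing (fun i => cbox (c i) (r i)) ->
  packing (fun i => tcube (c i) (r i) (h / L%:R) q).
Proof.
move=> L0 r0 [cK triv]; split=> [i|].
  split; first by apply: cube_cbox; rewrite mulr_gt0.
  by apply: tcube_unit => //; exact: (cK i).2.
move=> i j _ _ [y []]; rewrite !interior_cbox => yi yj.
apply: triv => //; pose x : 'rV[R]_d := \row_l ((y 0 l - h / L%:R * (q l)%:R) / (1 - h)).
exists x; split; rewrite interior_cbox => l.
  have := yi l; rewrite !mxE -!ltrBlDr -!ltrBrDr ltr_pdivlMr// => /andP[a b].
  rewrite ltr_pdivrMr//; apply/andP; split; lra.
have := yj l; rewrite !mxE ltr_pdivlMr// => /andP[a b].
rewrite ltr_pdivrMr//; apply/andP; split; lra.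
Qed.

(** With [u = h / (L r)] the map is [x -> (1 - h) x - u (x - c)]. On [cbox c r] it differs from
    [x -> (1 - h) x] by at most [h / L] in each coordinate, just enough for a box of side [h / L] to
    fit into the shrunk cube. It depends on the cube, and [aff_shift] bounds the price. *)
Let affc c r L := (h / L%:R / r) *: c : 'rV[R]_d.
Let affs r L : R := 1 - h - h / L%:R / r.

Let affP c r L (x : T) i : (0 < L)%N -> 0 < r -> h / L%:R <= (1 - h) * r -> cbox c r `<=` K ->
  0 <= aff (affs r L) (affc c r L) x 0 i /\
  aff (affs r L) (affc c r L) x 0 i <= 1 - h.
Proof.
move=> L0 r0 Lr cK; rewrite !mxE /affs; set u := h / L%:R / r.
have u0 : 0 <= u by rewrite divr_ge0 ?(ltW r0)// divr_ge0// ltW.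
have [c0 c1] := cbox_unit i r0 cK; have [/andP[x0 x1]] := (set_val_unit x i, tt).
have uh : u <= 1 - h by rewrite /u ler_pdivrMr.
have t0 : 0 <= 1 - h - u by rewrite subr_ge0.
move=> _; have a1 : 0 <= (1 - h - u) * set_val x 0 i by rewrite mulr_ge0.
have a2 : (1 - h - u) * set_val x 0 i <= 1 - h - u by rewrite ler_piMr.
have a3 : 0 <= u * c 0 i by rewrite mulr_ge0.
have a4 : u * c 0 i <= u by rewrite ler_piMr//; lra.
split; lra.
Qed.

Let aff_unit c r L (q : J L) (x : T) : (0 < L)%N -> 0 < r -> h / L%:R <= (1 - h) * r -> cbox c r `<=` K ->
  cbox (aff (affs r L) (gridv (h / L%:R) (affc c r L) q) x) (h / L%:R) `<=` K.
Proof.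
move=> L0 r0 Lr cK y yx i; have := yx i.
have [a b] := affP x i L0 r0 Lr cK; have [g0 g1] := gridP q i L0.
move: a b; rewrite !mxE => a b /andP[e f]; apply/andP; split; lra.
Qed.

Let aff_tcube c r L (q : J L) (x : T) : (0 < L)%N -> 0 < r -> h / L%:R <= (1 - h) * r ->
  cbox c r (set_val x) ->
  cbox (aff (affs r L) (gridv (h / L%:R) (affc c r L) q) x) (h / L%:R) `<=` tcube c r (h / L%:R) q.
Proof.
move=> L0 r0 Lr cx y yx i; have := yx i; have := cx i.
rewrite !mxE /affs; set u := h / L%:R / r => /andP[x0 x1].
have ur : u * r = h / L%:R by rewrite divfK// gt_eqF.
have uh : u <= 1 - h by rewrite /u ler_pdivrMr.
have t0 : 0 <= 1 - h - u by rewrite subr_ge0.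
have a1 : 0 <= (1 - h - u) * (set_val x 0 i - c 0 i) by rewrite mulr_ge0// subr_ge0.
have a2 : 0 <= (1 - h - u) * (c 0 i + r - set_val x 0 i) by rewrite mulr_ge0// subr_ge0.
rewrite -ur => /andP[y0 y1]; apply/andP; split; lra.
Qed.

Let aff_shift c r L (x : T) : (0 < L)%N -> 0 < r -> h / L%:R <= (1 - h) * r ->
  cbox c r `<=` K -> cbox c r (set_val x) ->
  `|ubox h (aff (1 - h) 0 x) - ubox h (aff (affs r L) (affc c r L) x)| <= 2 * d%:R / L%:R.
Proof.
move=> L0 r0 Lr cK cx; apply: ubox_shift => //.
- move=> y yx i; have := yx i; rewrite !mxE addr0 => /andP[y0 y1].
  have /andP[x0 x1] := set_val_unit x i.
  have a1 : 0 <= (1 - h) * set_val x 0 i by rewrite mulr_ge0// ltW.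
  have a2 : (1 - h) * set_val x 0 i <= 1 - h by rewrite ler_piMr// ltW.
  apply/andP; split; lra.
- move=> y yx i; have := yx i; have [a b] := affP x i L0 r0 Lr cK.
  by move=> /andP[e f]; apply/andP; split; lra.
- move=> i; rewrite !mxE addr0 /affs; set u := h / L%:R / r.
  have ur : u * r = h / L%:R by rewrite divfK// gt_eqF.
  have u0 : 0 <= u by rewrite divr_ge0 ?(ltW r0)// divr_ge0// ltW.
  have /andP[x0 x1] := cx i.
  have a1 : 0 <= u * (set_val x 0 i - c 0 i) by rewrite mulr_ge0// subr_ge0.
  have a2 : 0 <= u * (c 0 i + r - set_val x 0 i) by rewrite mulr_ge0// subr_ge0.
  rewrite -ur; apply/andP; split; lra.
Qed.

(* Each atom, shrunk by the factor [1 - h], is moved to the [L ^ d] points of a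
   grid and smeared by boxes of side [h / L]. The supports of one translate form
   a packing, and averaging over the translates turns the small boxes into boxes
   of side [h], the same for all atoms. *)
Lemma smear_chain b w e : chain_repr p (@l1_atom R d k) b w -> 0 < e ->
  evs (fun s => exists2 b', hull_le p1 (@L1_atom R d k) b' (w + e) &
    `|smear (fun x => ubox h (aff (1 - h) 0 x)) s b - b'| <= e).
Proof.
move=> bw e0; have w0 := chain_ge0 p1 bw.
move: bw => [n [Q [c [a [[cQ triv] aQ -> wE]]]]].
have /choice[cr crP] : forall i, exists cr : 'rV[R]_d * R, 0 < cr.2 /\ Q i = cbox cr.1 cr.2.
  by move=> i; have [[x [r [r0 ->]]] _] := cQ i; exists (x, r).
pose z i := (cr i).1; pose r i := (cr i).2.
have r0 i : 0 < r i by exact: (crP i).1.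
have QE : Q = (fun i => cbox (z i) (r i)) by apply/funext => i; exact: (crP i).2.
have zK i : cbox (z i) (r i) `<=` K by have := (cQ i).2; rewrite QE.
have aP i : [/\ l1_sup (cbox (z i) (r i)) (a i), asum (a i) <= 1 & mom (a i) = 0].
  have := aQ i; rewrite QE => /(@am_atomP _ _ _ _ _ (l1_model R d k) _ _ (zK i)).
  by [].
pose W := \sum_i `|c i|; have W0 : 0 <= W by exact: sumr_ge0.
(* Chosen to pay for renormalising the atoms, [dl * w], and for two errors of [dl] per unit of the
   coefficient sum [W]. *)
pose dl := e / (2 * (w + W + 1)).
have ww : 0 < 2 * (w + W + 1) by rewrite mulr_gt0//; lra.
have dl0 : 0 < dl by rewrite divr_gt0.
have dlE : dl * (w + W + 1) = e / 2.
  by rewrite /dl invfM mulrA divfK// gt_eqF//; lra.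
clearbody dl.
(* A large [L] makes the shift error small and lets boxes of side [h / L] fit into each of the
   finitely many shrunk cubes. *)
have [L [L0 hL1 hL2]] : exists L, [/\ (0 < L)%N, 2 * d%:R / L%:R <= dl &
    forall i, h / L%:R <= (1 - h) * r i].
  pose B := 2 * d%:R / dl + \sum_i h / ((1 - h) * r i).
  exists (Num.truncn B).+1; have := truncnS_gt B.
  set L := (Num.truncn B).+1 => hB; have Lp : 0 < L%:R :> R by rewrite ltr0n.
  have pos i : 0 <= h / ((1 - h) * r i) by rewrite divr_ge0 ?(ltW h0)// ltW// mulr_gt0.
  split=> //.
    rewrite ler_pdivrMr// [leRHS]mulrC -ler_pdivrMr// (le_trans _ (ltW hB))// lerDl.
    exact: sumr_ge0.
  move=> i; rewrite ler_pdivrMr// [leRHS]mulrC -ler_pdivrMr ?mulr_gt0// (le_trans _ (ltW hB))//.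
  rewrite /B (bigD1 i)//= addrCA lerDl; apply: addr_ge0; last exact: sumr_ge0.
  by apply: divr_ge0; [exact: mulr_ge0|exact: ltW].
have rL0 : 0 < h / L%:R by rewrite divr_gt0// ltr0n.
pose S (i : 'I_n) (q : J L) := fun s : seq T => smear (fun x => ubox (h / L%:R) (aff (affs (r i) L) (gridv (h / L%:R) (affc (z i) (r i) L) q) x)) s (a i).
have : evs (fun s => forall iq : 'I_n * J L, exists a' : L1 R d,
    [/\ L1_sup (tcube (z iq.1) (r iq.1) (h / L%:R) iq.2) a', `|a'| <= 1 + dl, MOM a' = 0 &
    `|S iq.1 iq.2 s - a'| <= dl]).
  apply: evs_all => -[i q] /=; have [a1 a2 a3] := aP i.
  apply: smear_atom a1 a2 a3 => //.
  - exact: tcube_unit.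
  - by move=> x; apply: aff_unit.
  - by move=> x xQ; apply: aff_tcube.
apply: evs_mono => s us /choice[a' a'P].
exists (\sum_(q : J L) L%:R^-1 ^+ d *: \sum_i c i *: a' (i, q)).
  have Ld : 0 <= L%:R^-1 ^+ d :> R by rewrite exprn_ge0// invr_ge0.
  apply: (@hull_le_weaken _ _ _ _ _ _ _ (\sum_(q : J L) L%:R^-1 ^+ d * ((1 + dl) * w))).
    rewrite -big_distrl /= sum_weights// mul1r mulrDl mul1r lerD2l.
    have a1 := mulr_ge0 (ltW dl0) w0; have a2 := mulr_ge0 (ltW dl0) W0.
    by move: dlE; rewrite !mulrDr; lra.
  apply: hull_le_sum => q _.
  rewrite -[X in X * (_ * _)]ger0_norm//; apply: hull_leZ.
  have d1 : 0 < 1 + dl by rewrite addr_gt0.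
  rewrite -[X in X * w]ger0_norm ?(ltW d1)//.
  have -> : \sum_i c i *: a' (i, q) = (1 + dl) *: \sum_i c i *: ((1 + dl)^-1 *: a' (i, q)).
    rewrite scaler_sumr; apply: eq_bigr => i _; rewrite !scalerA; congr (_ *: _).
    by rewrite mulrAC mulfV ?mul1r// gt_eqF.
  apply: hull_leZ; apply: hull_le_chain.
  exists n, (fun i => tcube (z i) (r i) (h / L%:R) q), c, (fun i => (1 + dl)^-1 *: a' (i, q)).
  split=> //; first by apply: tcube_packing => //; rewrite -QE.
  move=> i; apply/(@am_atomP _ _ _ _ _ (L1_model R d k)); first exact: tcube_unit.
  have [/= b1 b2 b3 _] := a'P (i, q); split.
  - exact: (@am_supZ _ _ _ _ _ (L1_model R d k)).
  - by rewrite /= normrZ gtr0_norm ?invr_gt0// mulrC ler_pdivrMr// mul1r.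
  - have := @am_momZ _ _ _ _ _ (L1_model R d k) (1 + dl)^-1 _ (@L1_supK R d (a' (i, q))).
    by rewrite /= => ->; rewrite b3 scaler0.
(* Per atom, the first error comes from exchanging the common map for that of its cube; the second
   is the average over translates of the error in [smear_atom]. *)
have -> : smear (fun x => ubox h (aff (1 - h) 0 x)) s (\sum_i c i *: a i) -
   \sum_(q : J L) L%:R^-1 ^+ d *: (\sum_i c i *: a' (i, q)) =
   \sum_i c i *: (smear (fun x => ubox h (aff (1 - h) 0 x) - ubox h (aff (affs (r i) L) (affc (z i) (r i) L) x)) s (a i)
     + \sum_(q : J L) L%:R^-1 ^+ d *: (S i q s - a' (i, q))).
  rewrite smear_sum.
  under [X in _ - X = _]eq_bigr do rewrite scaler_sumr.
  rewrite [X in _ - X = _]exchange_big -sumrB; apply: eq_bigr => i _ /=.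
  under [X in _ - X = _]eq_bigr do rewrite scalerA mulrC -scalerA.
  rewrite -scaler_sumr -scalerBr; congr (_ *: _).
  under [X in _ = _ + X]eq_bigr do rewrite scalerBr.
  rewrite sumrB -smear_tile// addrA; congr (_ - _).
  rewrite {2}/smear; under [X in _ = X + _]eq_bigr do rewrite scalerBr.
  by rewrite sumrB subrK.
apply: le_trans (ler_norm_sum _ _ _) _.
apply: (@le_trans _ _ (\sum_i `|c i| * (dl + dl))); last first.
  rewrite -big_distrl /= -/W (_ : e = 2 * (dl * (w + W + 1))); last by rewrite dlE; lra.
  have := mulr_ge0 (ltW dl0) w0; lra.
apply: ler_sum => i _; rewrite normrZ ler_wpM2l//.
apply: le_trans (ler_normD _ _) _; apply: lerD.
  have [[sa a0] a1 _] := aP i.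
  apply: (@le_trans _ _ (dl * asum (a i))); last by rewrite ler_piMr// ltW.
  apply: norm_smear => //; first exact: ltW.
  move=> x ax; apply: le_trans hL1; apply: aff_shift => //.
  by apply: contrapT => /a0 /eqP; rewrite (negbTE ax).
apply: le_trans (ler_norm_sum _ _ _) _.
apply: (@le_trans _ _ (\sum_(q : J L) L%:R^-1 ^+ d * dl)); last first.
  by rewrite -big_distrl /= sum_weights// mul1r.
apply: ler_sum => q _.
rewrite normrZ ger0_norm ?exprn_ge0 ?invr_ge0// ler_wpM2l ?exprn_ge0 ?invr_ge0//.
by have [] := a'P (i, q).
Qed.

Lemma smear_hull (u : U0 R d k) e : 0 < e ->
  evs (fun s => exists2 b', hull_le p1 (@L1_atom R d k) b' (U0_norm d k p1 u + e) &
    `|smear (fun x => ubox h (aff (1 - h) 0 x)) s (val u) - b'| <= e).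
Proof.
move=> e0; have e2 : 0 < e / 2 by rewrite divr_gt0.
have [m [b [w [bw uE wN]]]] := hull_presentation p1 u e2.
have em : 0 < e / 2 / m.+1%:R by rewrite divr_gt0.
have me : m%:R * (e / 2 / m.+1%:R) <= e / 2.
  by rewrite mulrCA ler_piMr ?(ltW e2)// ler_pdivrMr// mul1r ler_nat.
have : evs (fun s => forall i : 'I_m, exists2 b', hull_le p1 (@L1_atom R d k) b' (w i + e / 2 / m.+1%:R) &
    `|smear (fun x => ubox h (aff (1 - h) 0 x)) s (b i) - b'| <= e / 2 / m.+1%:R).
  by apply: evs_all => i; exact: smear_chain.
apply: evs_mono => s us hs.
have /choice[b' b'P] : forall i, exists b', hull_le p1 (@L1_atom R d k) b' (w i + e / 2 / m.+1%:R) /\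
    `|smear (fun x => ubox h (aff (1 - h) 0 x)) s (b i) - b'| <= e / 2 / m.+1%:R.
  by move=> i; have [b' ? ?] := hs i; exists b'.
exists (\sum_i b' i).
  apply: (@hull_le_weaken _ _ _ _ _ _ _ (\sum_i (w i + e / 2 / m.+1%:R))); last first.
    by apply: hull_le_sum => i _; exact: (b'P i).1.
  have -> : \sum_(i < m) (w i + e / 2 / m.+1%:R) = \sum_i w i + m%:R * (e / 2 / m.+1%:R).
    by rewrite big_split /= sumr_const card_ord -[_ *+ m]mulr_natl.
  have wN' : \sum_i w i <= U0_norm d k p1 u + e / 2 by exact: wN.
  by rewrite [in leRHS](splitr e) addrA lerD.
have -> : val u = \sum_i 1 *: b i by rewrite uE; apply: eq_bigr => i _; rewrite scale1r.
rewrite smear_sum -sumrB; apply: le_trans (ler_norm_sum _ _ _) _.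
apply: (@le_trans _ _ (\sum_(i < m) e / 2 / m.+1%:R)); last first.
  by rewrite sumr_const card_ord -[_ *+ m]mulr_natl (le_trans me)// ler_pdivrMr//; lra.
by apply: ler_sum => i _; rewrite scale1r; exact: (b'P i).2.
Qed.

End Family.
End SmearChain.

(** * The embedding is isometric *)

Section Isometry.
Context (R : realType) (d k : nat) (p : R) (p1 : 1 <= p) (d0 : (0 < d)%N).
Local Notation K := (unit_cube R d).
Local Notation T := (unit_cube R d).
Local Notation J N := {ffun 'I_d -> 'I_N}.
Local Notation M := #|{: mindex d k}|.
Local Notation mom := (@l1_mom R d k).
Local Notation MOM := (@L1_mom R d k).
Local Notation A := (L1_model R d k).
Context (kap : 'rV[R]_M -> T -> R) (C : R) (kapP : corrector (l1_model R d k) K kap C).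
Local Notation UN := (U0_norm d k p1).
Local Notation UIN := (atomic_seminorm (@L1_atom R d k) p1).
Local Notation balU := (balU kap).
Local Notation Jt := (Jt p1 d0 kapP).
Implicit Types (a b : L1 R d).

(** The conditional expectation of [a] on the grid: the mass of each cell is spread uniformly over
    the cell. *)
Definition step N a : L1 R d :=
  \sum_(j : J N) pair (\1_(cell j)) a *: ubox N%:R^-1 (@corner R d N j).

Let bc N (j : J N) : bmeas (\1_(@cell R d N j)).
Proof. by apply: bmeas_indic; exact: measurable_cell. Qed.

Lemma step_sum N (I : Type) (r : seq I) (F : I -> L1 R d) :
  step N (\sum_(i <- r) F i) = \sum_(i <- r) step N (F i).
Proof.
rewrite exchange_big; apply: eq_bigr => j _ /=.
by rewrite (pair_sum _ _ _ (bc j)) scaler_suml.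
Qed.

Lemma norm_step N a : (0 < N)%N -> `|step N a| <= `|a|.
Proof.
move=> N0; apply: le_trans (ler_norm_sum _ _ _) _.
rewrite -(mass_sum (@measurable_cell R d N) (fun x => @cell_sum R d N x N0) a).
apply: ler_sum => j _; rewrite normrZ (le_trans _ (pair_cell_le j a))//.
by rewrite ler_piMr// norm_ubox// invr_gt0 ltr0n.
Qed.

Let corner_ccube N (j : J N) : (0 < N)%N -> ccube j (@corner R d N j).
Proof. by move=> N0; apply: cbox_corner; rewrite invr_ge0. Qed.

Lemma step_mom N a : (0 < N)%N -> mnorm (MOM (step N a) - MOM a) <= 2 * (M%:R * (k%:R / N%:R)) * `|a|.
Proof.
move=> N0; pose w (j : J N) : T := SigSub (mem_set (ccube_unit (corner_ccube j N0))).
have hw : nodes w by move=> j; exact: corner_ccube.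
rewrite -(subrKA (mom (disc w a))) (le_trans (mnormD _ _))//.
rewrite (_ : 2 * _ * _ = M%:R * (k%:R / N%:R) * `|a| + M%:R * (k%:R / N%:R) * `|a|); last by ring.
apply: lerD; last exact: disc_mom.
rewrite /step /disc L1_mom_sum l1_mom_sum; last by move=> j; exact/summZ/summ_delta.
rewrite -sumrB; apply: le_trans (mnorm_sum _ _) _.
rewrite -(mass_sum (@measurable_cell R d N) (fun x => @cell_sum R d N x N0) a) mulr_sumr.
apply: ler_sum => j _.
have -> : MOM (pair (\1_(cell j)) a *: ubox N%:R^-1 (corner R j)) = pair (\1_(cell j)) a *: MOM (ubox N%:R^-1 (corner R j)).
  exact: (@am_momZ _ _ _ _ _ A _ _ (L1_supK _)).
rewrite l1_momZ ?l1_mom_delta; last exact: summ_delta.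
rewrite -scalerBr (_ : mnorm _ = `|pair (\1_(cell j)) a| * mnorm (MOM (ubox N%:R^-1 (corner R j)) -
    momvec k (fun al => monomial al (set_val (w j))))); last first.
  by rewrite /mnorm mulr_sumr; apply: eq_bigr => i _; rewrite mxE normrM.
rewrite mulrC ler_pM ?mnorm_ge0 ?pair_cell_le//.
by apply: ubox_mom; [rewrite invr_gt0 ltr0n|exact: ccube_unit].
Qed.

Lemma step_restr_sup N N' (q : J N) a : (N %| N')%N ->
  L1_sup (ccube q) (step N' (restr (cell q) a)).
Proof.
move=> NN'; apply: (@am_sup_sum _ _ _ _ _ A) => j _.
have [->|/restr_cell_meet[x xq xj]] := eqVneq (pair (\1_(cell j)) (restr (cell q) a)) 0.
  by rewrite scale0r; exact: (am_sup0 A).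
apply: (@am_supZ _ _ _ _ _ A); apply: ubox_sup.
exact: (ccube_nest_dvd NN' xq xj).
Qed.

(** For [N = 2 ^ n] and [h = 1/N], contraction by [1 - h] sends the node [j / (N - 1)] to the corner
    [j / N], so the box of side [h] placed there is the cell up to its boundary. *)
Lemma smear_disc n s a : (0 < n)%N -> uniq s -> (forall j, @znode R d (2 ^ n) j \in s) ->
  smear (fun x => ubox (2 ^ n)%:R^-1 (aff (1 - (2 ^ n)%:R^-1) 0 x)) s (disc (@znode R d (2 ^ n)) a) =
  step (2 ^ n) a.
Proof.
move=> n0 us zs; rewrite smear_sum; apply: eq_bigr => j _; congr (_ *: _).
rewrite /smear (bigD1_seq (znode R j))//= big1 => [|x xz]; last first.
  by rewrite /delta (negbTE xz) scale0r.
rewrite /delta eqxx scale1r addr0; congr ubox.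
have -> t : aff t 0 (znode R j) = t *: znode_fun R j by rewrite /aff addr0 znodeE.
apply/rowP => i; rewrite !mxE; set N := (2 ^ n)%N.
have N1 : (1 < N)%N by rewrite -[1%N](expn0 2) ltn_exp2l.
have N0 : (0 < N)%N by exact: ltnW.
have -> : N%:R = N.-1%:R + 1 :> R by rewrite natr1 prednK.
have : 0 < N.-1%:R :> R by rewrite ltr0n -ltnS prednK.
by move: (N.-1%:R) => z z0; field; rewrite !gt_eqF//; lra.
Qed.

(* Smearing the discretisation of [a] gives the averages of [a] over the cells,
   which are close to [a] by [coarse_chain]. *)
Lemma Jt_lower (f : hull (@L1_atom R d k)) : UIN f <= `|Jt (val f)|.
Proof.
have [_] := hull_in A f; set a := val f => f0'.
have f0 : MOM a = 0 by exact: f0'.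
apply/ler_addgt0Pr => e' e0'; pose e := e' / 3; have e0 : 0 < e by rewrite divr_gt0.
have ee : e' = e + e + e by rewrite /e; lra.
have B0 : 0 <= 2 * `|a| by rewrite mulr_ge0.
have [dlt dlt0 hd] := @coarse_chain _ _ _ _ p1 _ _ A _ _ B0 e0.
have [m0 hm0] := cell_mass_small a d0 (divr_gt0 dlt0 (ltr0n _ 2)).
pose N := (2 ^ m0)%N; have N0 : (0 < N)%N by exact: expn2_gt0.
have hm (q : J N) : 2 * mass (cell q) a <= dlt.
  by rewrite mulrC -ler_pdivlMr// hm0// ltnW// ltn_expl.
have [eta eta0 heta] := hd _ _ (fpacking_ccube R d N0).
have [n1 h1] := Jt_disc p1 d0 kapP a e0.
pose D : R := 2 * (1 + C) * M%:R * k%:R * `|a|.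
have C0 := C_ge0 kapP.
have D0 : 0 <= D by rewrite !mulr_ge0// addr_ge0.
have [n0 _ hn0] := near_infty_natSinv_lt (PosNum (divr_gt0 eta0 (ltr_pwDr ltr01 D0))).
pose n := maxn (maxn m0 n1) n0.+1; pose Nn := (2 ^ n)%N.
have mn : (m0 <= n)%N by rewrite !leq_max leqnn.
have n1n : (n1 <= n)%N by rewrite !leq_max leqnn orbT.
have n0n : (n0 < n)%N by rewrite !leq_max leqnn !orbT.
have Nn0 : (0 < Nn)%N by exact: expn2_gt0.
have DN : D / Nn%:R <= eta.
  have lh : (n0 <= Nn.-1)%N.
    by rewrite -ltnS prednK//; apply: ltn_trans n0n _; exact: ltn_expl.
  have := hn0 _ lh; rewrite /= prednK// => /ltW /(ler_wpM2l D0) h; apply: le_trans h _.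
  by rewrite mulrA ler_pdivrMr ?ltr_wpDl// mulrDr mulr1 mulrC lerDl ltW.
have mc := @measurable_cell R d N; have S1 x := @cell_sum R d N x N0.
pose g (q : J N) := restr (cell q) a - step Nn (restr (cell q) a).
have gE : a - step Nn a = \sum_(q : J N) g q.
  by rewrite sumrB -step_sum -!(restr_sum mc S1).
have aq (q : J N) : `|restr (cell q) a| <= `|a|.
  rewrite norm_restr; last exact: mc.
  rewrite -(mass_sum mc S1 a) (bigD1 q)//= lerDl.
  by apply: sumr_ge0 => i _; exact: mass_ge0.
pose dz := disc (@znode R d Nn) a; have sdz : summ dz by exact: summ_disc.
pose u := balU dz; pose kz := kap (mom dz); have skz : summ kz by exact: (kap_summ kapP).
have kzn : asum kz <= eta / 2.
  apply: le_trans (kap_asum kapP _) _; have := disc_mom k a Nn0 (@nodes_znode R d Nn).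
  rewrite f0 subr0 => h; apply: le_trans (ler_wpM2l C0 h) _.
  apply: le_trans _ (ler_wpM2r _ DN); last by rewrite invr_ge0.
  have -> : D / Nn%:R / 2 = (1 + C) * (M%:R * (k%:R / Nn%:R) * `|a|).
    by rewrite /D; field; rewrite gt_eqF// ltr0n.
  by rewrite ler_wpM2r ?lerDr// !mulr_ge0// invr_ge0.
have h01 : 0 < Nn%:R^-1 :> R by rewrite invr_gt0 ltr0n.
have h11 : Nn%:R^-1 < 1 :> R.
  rewrite invf_lt1 ?ltr0n// ltr1n -[1%N](expn0 2) ltn_exp2l//.
  exact: leq_ltn_trans n0n.
pose e2 := Num.min e (eta / 2).
have e20 : 0 < e2 by rewrite lt_min e0 divr_gt0.
pose kp : T -> L1 R d := fun x => ubox Nn%:R^-1 (aff (1 - Nn%:R^-1) 0 x).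
(* The set [s] must contain all nodes, for [smear_disc], and be large enough for [smear_hull]. *)
have [s [us [zs [b' hb' nb']]]] := evs_ex (evsI (evs_sub [seq znode R j | j <- index_enum (J Nn)]) (smear_hull p1 h01 h11 u e20)).
have zsE : smear kp s dz = step Nn a.
  apply: smear_disc => //; first exact: leq_ltn_trans n0n.
  by move=> j; apply: zs; apply: map_f; exact: mem_index_enum.
have uE : val u = (-1) *: kz + dz by rewrite (val_balU p1 kapP)// /bal scaleN1r addrC.
(* Everything in [a - b'] apart from [a - step Nn a]: the smeared balancing term and the smearing
   error, each at most [eta / 2]. *)
pose s' := smear kp s kz + (smear kp s (val u) - b').
have abE : a - b' = \sum_(q : J N) g q + s'.
  by rewrite -gE /s' uE smearP zsE scaleN1r -[(- _ + _) - b']addrA addNKr subrKA.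
have b'0 : MOM b' = 0 by have [f' <- _] := hb'; case: (hull_in A f').
have hab : hull_le p1 (@L1_atom R d k) (a - b') e.
  rewrite abE; apply: (heta g (fun q => 2 * mass (cell q) a) s').
  - move=> q; split.
    + apply: (am_supB (A := A)); last first.
        by apply: step_restr_sup; rewrite dvdn_exp2l.
      by apply: filterS (L1_sup_restr a (mc q)) => x h xq; apply: h => /cell_ccube.
    + rewrite (le_trans (ler_normB _ _))// mulr2n mulrDl mul1r -(norm_restr a (mc q)).
      by rewrite lerD// norm_step.
    + exact: hm.
    + have -> : am_mom A (g q) = - (MOM (step Nn (restr (cell q) a)) - MOM (restr (cell q) a)).
        by rewrite opprB; exact: (am_momB (A := A) (L1_supK _) (L1_supK _)).
      rewrite mnormN (le_trans (step_mom _ Nn0))// (le_trans _ DN)//.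
      have hx : 0 <= 2 * (M%:R * (k%:R / Nn%:R)) :> R by rewrite !mulr_ge0// invr_ge0.
      apply: le_trans (ler_wpM2l hx (aq q)) _.
      have -> : D / Nn%:R = (1 + C) * (2 * (M%:R * (k%:R / Nn%:R)) * `|a|).
        by rewrite /D; field; rewrite gt_eqF// ltr0n.
      by rewrite ler_peMl ?lerDl// !mulr_ge0// invr_ge0.
  - by rewrite -mulr_sumr (mass_sum mc S1).
  - exact: L1_supK.
  - rewrite (le_trans (ler_normD _ _))// [leRHS]splitr lerD//.
      apply: le_trans kzn; rewrite -[leRHS]mul1r; apply: norm_smear => // x _.
      exact: norm_ubox.
    by apply: le_trans nb' _; rewrite ge_min lexx orbT.
  - rewrite -abE; apply: (etrans (am_momB (A := A) (L1_supK _) (L1_supK _))).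
    by rewrite /= f0 b'0 subr0.
have ha : hull_le p1 (@L1_atom R d k) a (UN u + e2 + e).
  by rewrite -(subrK b' a) addrC; exact: hull_leD.
apply: le_trans (hull_leP ha) _.
have hu : UN u <= `|Jt a| + e.
  rewrite -norm_to_completion -(subrK (Jt a) (to_completion UN u)).
  rewrite (le_trans (ler_normD _ _))// addrC lerD2l distrC.
  by apply: h1 => //; exact: nodes_znode.
have he2 : e2 <= e by rewrite ge_min lexx.
rewrite ee !addrA; apply: lerD => //; apply: lerD => //.
Qed.

Lemma kap0 : kap 0 = 0.
Proof. exact: (linear0 (mk_linear (kap_linear kapP))). Qed.

Lemma val_balU0 (g : T -> R) : summ g -> mom g = 0 -> val (balU g) = g.
Proof.
move=> sg g0; rewrite (val_balU p1 kapP)// /bal g0.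
by rewrite kap0 subr0.
Qed.

(** The approximation from [Jt_approx] lives in [Q] and has small moments; correcting them inside
    [Q] gives nearly an atom on the same cube. *)
Lemma atom_Jt Q a e : Q `<=` K -> L1_atom k Q a -> 0 < e -> exists g : T -> R,
  [/\ l1_sup Q g, asum g <= 1 + e, mom g = 0 & `|Jt a - to_completion UN (balU g)| <= e].
Proof.
move=> QK /(am_atomP A _ QK)[aQ a1 a0] e0.
have [kq [Cq [_ Cq0 kS kM _]]] := corrector_ex (l1_model R d k) QK.
pose Cpp := Cp d k C; have Cp0 : 0 < Cpp by exact: (Cp_gt0 kapP).
(* In order: the distance to [Jt a], the l_1 norm of the correction, and the norm in [U] of the
   correction after [balU]. *)
pose eta := Num.min (e / 2) (Num.min (e / Cq) (e / 2 / (Cpp * Cq))).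
have eta0 : 0 < eta by rewrite !lt_min !divr_gt0// mulr_gt0.
have [g [gQ g1 g0 gJ]] := Jt_approx p1 d0 kapP aQ eta0.
have {g0}g0 : mnorm (mom g) <= eta by move: g0; rewrite (_ : MOM a = 0)// subr0.
have [kgQ kgn] := kS (mom g).
have sg : summ g by case: gQ.
have skg : summ (kq (mom g)) by case: kgQ.
have e2 : Cq * eta <= e by rewrite mulrC -ler_pdivlMr// !ge_min lexx orbT.
have e3 : Cpp * (Cq * eta) <= e / 2.
  by rewrite mulrA mulrC -ler_pdivlMr ?mulr_gt0// !ge_min lexx !orbT.
have kgn' : asum (kq (mom g)) <= Cq * eta.
  by apply: le_trans kgn _; rewrite ler_wpM2l// ltW.
exists (g - kq (mom g)); split.
- exact: (am_supB (A := l1_model R d k)).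
- apply: le_trans (am_nuB (A := l1_model R d k) (l1_supK sg) (l1_supK skg)) _.
  by apply: lerD; [exact: le_trans g1 a1|exact: le_trans kgn' e2].
- rewrite l1_momB//; apply/eqP; rewrite subr_eq0; apply/eqP/esym; exact: kM.
- rewrite (balUB p1 kapP)// linearB opprB addrCA addrC (le_trans (ler_normD _ _))//.
  rewrite [leRHS]splitr lerD//; first by apply: le_trans gJ _; rewrite ge_min lexx.
  rewrite norm_to_completion (le_trans (norm_balU p1 kapP skg))//.
  by apply: le_trans e3; rewrite ler_wpM2l// ltW.
Qed.

Lemma ler_addM_gt0 (x r D : R) : (forall e, 0 < e -> x <= r + D * e) -> x <= r.
Proof.
move=> h; apply/ler_addgt0Pr => e e0; have D1 : 0 < `|D| + 1 by rewrite ltr_wpDl.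
have := h _ (divr_gt0 e0 D1) => /le_trans; apply; rewrite lerD2l.
rewrite mulrA ler_pdivrMr// mulrC ler_wpM2l ?ltW//.
by rewrite (le_lt_trans (ler_norm D))// ltrDl.
Qed.

Let JtL : {linear L1 R d -> U d k p1} := mk_linear (Jt_linear p1 d0 kapP).

(** Each atom is replaced by an l_1 function on the same cube, so packing and coefficients are
    unchanged; only the factor [1 + e] and small distances are lost. *)
Lemma chain_Jt b w : chain_repr p (@L1_atom R d k) b w -> `|Jt b| <= w.
Proof.
move=> bw; have w0 := chain_ge0 p1 bw.
move: bw => [n [Q [c [a [[cQ triv] aQ -> wE]]]]].
apply: (@ler_addM_gt0 _ w (w + \sum_i `|c i|)) => e e0.
have /choice[g gP] : forall i, exists g : T -> R, [/\ l1_sup (Q i) g, asum g <= 1 + e, mom g = 0 &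
    `|Jt (a i) - to_completion UN (balU g)| <= e].
  by move=> i; apply: atom_Jt => //; case: (cQ i).
have e1 : 0 < 1 + e by rewrite addr_gt0.
have sg i : summ (g i) by have [[]] := gP i.
have gK i : val (balU (g i)) = g i.
  by apply: val_balU0 => //; have [] := gP i.
have h : hull_le p1 (@l1_atom R d k) (\sum_i c i *: g i) ((1 + e) * w).
  have -> : \sum_i c i *: g i = (1 + e) *: \sum_i c i *: ((1 + e)^-1 *: g i).
    rewrite scaler_sumr; apply: eq_bigr => i _; rewrite !scalerA; congr (_ *: _).
    by rewrite mulrAC mulfV ?mul1r// gt_eqF.
  rewrite -[X in X * w]ger0_norm ?(ltW e1)//; apply: hull_leZ; apply: hull_le_chain.
  exists n, Q, c, (fun i => (1 + e)^-1 *: g i); split=> // i.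
  apply/(am_atomP (l1_model R d k)); first by case: (cQ i).
  have [b1 b2 b3 _] := gP i; split.
  - exact: (am_supZ (A := l1_model R d k)).
  - rewrite [am_nu _ _](asumZ _ (sg i)) gtr0_norm ?invr_gt0// mulrC ler_pdivrMr// mul1r.
    exact: b2.
  - by rewrite /= l1_momZ// b3 scaler0.
have -> : Jt (\sum_i c i *: a i) = \sum_i c i *: (Jt (a i) - to_completion UN (balU (g i))) +
    to_completion UN (\sum_i c i *: balU (g i)).
  rewrite -[Jt]/(JtL : _ -> _) linear_sum [to_completion _ _]linear_sum -big_split.
  apply: eq_bigr => i _; rewrite linearZ.
  transitivity (c i *: (JtL (a i) - to_completion UN (balU (g i))) + c i *: to_completion UN (balU (g i))).
    by rewrite -scalerDr subrK.
  by congr (_ + _); exact/esym/linearZ.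
rewrite (le_trans (ler_normD _ _))// addrC mulrDl addrA lerD//.
  rewrite norm_to_completion; have -> : w + w * e = (1 + e) * w by ring.
  apply: hull_leP; rewrite raddf_sum (_ : \sum_i _ = \sum_i c i *: g i)//.
  by apply: eq_bigr => i _; rewrite -[in RHS]gK; exact: GRing.valZ.
apply: le_trans (ler_norm_sum _ _ _) _; rewrite mulr_suml; apply: ler_sum => i _.
by rewrite normrZ ler_wpM2l//; case: (gP i).
Qed.

Lemma Jt_upper (f : hull (@L1_atom R d k)) : `|Jt (val f)| <= UIN f.
Proof.
apply/ler_addgt0Pr => e e0; have [m [b [w [bw fE wN]]]] := hull_presentation p1 f e0.
apply: le_trans wN; rewrite fE -[Jt]/(JtL : _ -> _) linear_sum.
apply: le_trans (ler_norm_sum _ _ _) _; apply: ler_sum => i _.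
exact: chain_Jt.
Qed.

Lemma Jt_norm (f : hull (@L1_atom R d k)) : `|Jt (val f)| = UIN f.
Proof. by apply/eqP; rewrite eq_le Jt_upper Jt_lower. Qed.

End Isometry.

(** * Duality of quotients *)

Section BoundedFunctional.
Context (R : realType) (X : normedModType R).
Implicit Types (x y : X).

Lemma linear_subr (f : X -> R) : linear f -> forall x y, f (x - y) = f x - f y.
Proof. by move=> lf x y; exact: (linearB (mk_linear lf : {linear X -> R^o}) x y). Qed.

Lemma bounded_continuous (f : X -> R) C : linear f -> (forall x, `|f x| <= C * `|x|) -> continuous f.
Proof.
move=> lf hC; have C1 : 0 < `|C| + 1 by rewrite ltr_wpDl.
move=> x; apply/cvgrPdist_le => e e0; near=> y.
have -> : f x - f y = f (x - y) by rewrite linear_subr.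
apply: le_trans (hC _) _; apply: (@le_trans _ _ ((`|C| + 1) * `|x - y|)).
  by rewrite ler_wpM2r// (le_trans (ler_norm C))// lerDl.
rewrite mulrC -ler_pdivlMr//; near: y.
by apply: cvgr_dist_le; [exact: cvg_id|rewrite divr_gt0].
Unshelve. all: by end_near. Qed.

Definition mk_dual (f : X -> R) C (lf : linear f) (hC : forall x, `|f x| <= C * `|x|) : dual X :=
  exist _ f (mem_set (conj lf (bounded_continuous lf hC))).

Lemma dual_linear (psi : dual X) : linear (val psi).
Proof. by have := valP psi; rewrite inE => -[]. Qed.

Lemma dual_lip (psi : dual X) : exists2 C, 0 <= C & forall x, `|val psi x| <= C * `|x|.
Proof.
have := valP psi; rewrite inE => -[lf cf].
have /linear_boundedP[M [_ /(_ (`|M| + 1))]] :=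
  @continuous_linear_bounded _ _ _ 0 (mk_linear lf : {linear X -> R^o}) (@cf 0).
rewrite (le_lt_trans (ler_norm M)) ?ltrDl// => /(_ isT) hM.
by exists (`|M| + 1) => //; exact: addr_ge0.
Qed.

Lemma dual_le (psi : dual X) x : `|val psi x| <= `|psi| * `|x|.
Proof.
have [C C0 hC] := dual_lip psi.
have psi0 : val psi 0 = 0.
  have := dual_linear psi 1 0 0; rewrite !scale1r addr0 => /eqP.
  by rewrite -subr_eq0 opprD addNKr oppr_eq0 => /eqP.
have [->|x0] := eqVneq x 0; first by rewrite psi0 !normr0 mulr0.
have nx : 0 < `|x| by rewrite normr_gt0.
have xE : x = `|x| *: (`|x|^-1 *: x) by rewrite scalerA mulfV ?scale1r// gt_eqF.
have h : `|val psi (`|x|^-1 *: x)| <= `|psi|.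
  apply: ub_le_sup; last first.
    by exists (`|x|^-1 *: x) => //=; rewrite normrZ normfV normr_id mulVf// gt_eqF.
  by exists C => _ [y /= y1 <-]; rewrite (le_trans (hC y))// ler_piMr.
rewrite {1}xE; have := dual_linear psi `|x| (`|x|^-1 *: x) 0; rewrite !addr0 psi0 addr0 => ->.
by rewrite normrM normr_id mulrC ler_wpM2r.
Qed.

Lemma dual_norm_le (psi : dual X) C : 0 <= C -> (forall x, `|val psi x| <= C * `|x|) -> `|psi| <= C.
Proof.
move=> C0 hC; apply: ge_sup; first by exists `|val psi 0|; exists 0 => //=; rewrite normr0.
by move=> _ [x /= x1 <-]; rewrite (le_trans (hC x))// ler_piMr.
Qed.

End BoundedFunctional.

Section QuotientDual.
Context (R : realType) (X : normedModType R) (W : closed_subspace X).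

Definition quot x : quotient W := to_sep (quotient_seminorm W) x.

Lemma quot_linear : linear quot.
Proof. by move=> a x y; exact: linearP. Qed.

Lemma norm_quot_le x w : cs_val W w -> `|quot x| <= `|x - w|.
Proof.
move=> Ww; have -> : `|quot x| = quotient_seminorm W x by exact: norm_to_sep.
apply: ge_inf; last by exists w.
by exists 0 => _ [w' _ <-].
Qed.

Lemma quot_lift (z : quotient W) e : 0 < e -> exists2 x, quot x = z & `|x| <= `|z| + e.
Proof.
rewrite -(to_sepK z); set x := repr z => e0.
have -> : `|to_sep (quotient_seminorm W) x : quotient W| = quotient_seminorm W x by exact: norm_to_sep.
have hi : has_inf [set `|x - w| | w in W].
  by split; [exists `|x - 0|; exists 0 => //; exact: cs0|exists 0 => _ [w' _ <-]].
have [_ [w Ww <-] /ltW h] := inf_adherent e0 hi.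
exists (x - w) => //; apply/to_sepP/eqP; rewrite eq_le sn_ge0 andbT.
have := @norm_quot_le (x - w - x) (- w); rewrite /quot norm_to_sep => /(_ _)/le_trans; apply.
  by have := cs_linear (-1) Ww (cs0 W); rewrite scaleN1r addr0.
by rewrite opprK [x - w - x]addrAC subrr add0r addNr normr0.
Qed.

Lemma quot_eq x y : cs_val W (x - y) -> quot x = quot y.
Proof.
move=> h; apply/to_sepP/eqP; rewrite eq_le sn_ge0 andbT.
by have := norm_quot_le (x - y) h; rewrite subrr normr0 /quot norm_to_sep.
Qed.

(** A bounded [f] vanishing on [W] is at most [C] times the distance to [W]; hence it is constant on
    classes and the bound passes to the quotient. *)
Lemma quot_dual (f : X -> R) C : 0 <= C -> linear f -> (forall x, `|f x| <= C * `|x|) ->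
  (forall w, cs_val W w -> f w = 0) -> exists psi : dual (quotient W), forall x, val psi (quot x) = f x.
Proof.
move=> C0 lf hC f0; pose g (z : quotient W) := f (repr z).
have f00 : f 0 = 0 by apply: f0; exact: cs0.
have fB := linear_subr lf.
have fq x y : quot x = quot y -> f x = f y.
  move=> /to_sepP xy; apply/eqP; rewrite -subr_eq0 -normr_le0 -fB; apply/ler_addgt0Pr => e e0.
  rewrite add0r; have C1 : 0 < C + 1 by rewrite ltr_wpDl.
  have hi : has_inf [set `|x - y - w| | w in W].
    by split; [exists `|x - y - 0|; exists 0 => //; exact: cs0|exists 0 => _ [w' _ <-]].
  have [_ [w Ww <-]] := inf_adherent (divr_gt0 e0 C1) hi.
  rewrite -[inf _]/(quotient_seminorm W (x - y)) xy add0r => /ltW h.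
  have -> : f (x - y) = f (x - y - w) by rewrite [RHS]fB (f0 _ Ww) subr0.
  apply: le_trans (hC _) _; apply: le_trans (ler_wpM2l C0 h) _.
  by rewrite mulrA ler_pdivrMr// mulrC ler_wpM2l ?(ltW e0)// lerDl.
have gq x : g (quot x) = f x by apply: fq; exact: to_sepK.
have lg : linear g.
  move=> a z z'; rewrite -(to_sepK z) -(to_sepK z') -[to_sep _ (repr z)]/(quot _) -[to_sep _ (repr z')]/(quot _).
  by rewrite -quot_linear !gq lf.
have hg z : `|g z| <= C * `|z|.
  apply/ler_addgt0Pr => e e0; have C1 : 0 < C + 1 by rewrite ltr_wpDl.
  have [x <- xz] := quot_lift z (divr_gt0 e0 C1).
  rewrite gq; apply: le_trans (hC _) _; apply: le_trans (ler_wpM2l C0 xz) _.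
  rewrite mulrDr lerD2l mulrA ler_pdivrMr// mulrC ler_wpM2l ?(ltW e0)// lerDl //.
by exists (mk_dual lg hg) => x; exact: gq.
Qed.

End QuotientDual.

(** * The space l_p(Q^d) through its finite sums *)

Section EllP.
Context (R : realType) (d : nat) (p : R) (p1 : 1 <= p).
Local Notation T := (unit_cube R d).
Implicit Types f : T -> R.

Lemma lp_bound f B : 0 <= B -> (forall s, uniq s -> \sum_(x <- s) `|f x| `^ p <= B `^ p) ->
  lp p f /\ lp_norm p f <= B.
Proof.
move=> B0 h; have p0 := p_gt0 p1.
have hm : (lp_mass p f <= (B `^ p)%:E)%E.
  apply: ub_ereal_sup => _ [A [fA _] <-].
  rewrite fsbig_finite//= sumEFin lee_fin; apply: h; exact: finmap.fset_uniq.
have m0 : (0 <= lp_mass p f)%E by apply: esum_ge0 => x _; rewrite lee_fin powR_ge0.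
have hf : (lp_mass p f < +oo)%E by apply: le_lt_trans hm _; exact: ltry.
split=> //; rewrite /lp_norm.
have -> : B = (B `^ p) `^ p^-1 by rewrite -powRrM (mulfV (lt0r_neq0 p0)) powRr1.
rewrite ge0_ler_powR ?nnegrE ?powR_ge0 ?fine_ge0 ?invr_ge0 ?(ltW p0)//.
by rewrite -lee_fin fineK// ge0_fin_numE.
Qed.

Lemma lp_sum f s : lp p f -> uniq s -> \sum_(x <- s) `|f x| `^ p <= lp_norm p f `^ p.
Proof.
move=> hf us; have p0 := p_gt0 p1.
have m0 : (0 <= lp_mass p f)%E by apply: esum_ge0 => x _; rewrite lee_fin powR_ge0.
rewrite /lp_norm -powRrM (mulVf (lt0r_neq0 p0)) powRr1 ?fine_ge0//.
rewrite -lee_fin fineK ?ge0_fin_numE// -sumEFin; apply: esum_ge.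
exists [set` s]; first by split => //; exact: finite_seq.
by rewrite -fsbig_seq.
Qed.

Lemma lp_norm_ge0 f : 0 <= lp_norm p f. Proof. exact: powR_ge0. Qed.

Lemma lp_le f x : lp p f -> `|f x| <= lp_norm p f.
Proof.
move=> hf; have p0 := p_gt0 p1; have := lp_sum (s := [:: x]) hf isT.
rewrite big_seq1 => h; rewrite leNgt; apply/negP => h'; move: h; apply/negP.
by rewrite -ltNge gt0_ltr_powR ?nnegrE ?lp_norm_ge0.
Qed.

End EllP.

(** * The annihilator *)

Section Final.
Context (R : realType) (d k : nat) (p : R) (p1 : 1 <= p) (d0 : (0 < d)%N).
Local Notation K := (unit_cube R d).
Local Notation T := (unit_cube R d).
Local Notation J N := {ffun 'I_d -> 'I_N}.
Local Notation M := #|{: mindex d k}|.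
Local Notation mom := (@l1_mom R d k).
Local Notation MOM := (@L1_mom R d k).
Local Notation A := (L1_model R d k).
Local Notation AL := (l1_model R d k).
Context (kap : 'rV[R]_M -> T -> R) (C : R) (kapP : corrector AL K kap C).
Context (kapI : 'rV[R]_M -> L1 R d) (CI : R) (kapIP : corrector A K kapI CI).
Local Notation U := (U d k p1).
Local Notation UN := (U0_norm d k p1).
Local Notation UIN := (atomic_seminorm (@L1_atom R d k) p1).
Local Notation balU := (balU kap).
Local Notation Jt := (Jt p1 d0 kapP).
Local Notation D := ((2 ^ d)%:R `^ p^-1 : R).
Local Notation tc := (to_completion UN).
Implicit Types (a b : L1 R d) (f g : T -> R) (x : T).

Lemma norm_Jt a : `|Jt a| <= Cp d k C * `|a|.
Proof.
apply/ler_addgt0Pr => e e0; have [n0 h] := Jt_disc p1 d0 kapP a e0.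
have := h n0 _ (leqnn _) (@nodes_znode R d (2 ^ n0)); set u := balU _ => hu.
rewrite -(subrK (tc u) (Jt a)) (le_trans (ler_normD _ _))// addrC lerD//.
rewrite norm_to_completion (le_trans (norm_balU p1 kapP (summ_disc _ _ a)))//.
by rewrite ler_wpM2l ?asum_disc ?expn2_gt0// ltW// (Cp_gt0 kapP).
Qed.

(** The point may lie on an upper face of the cube; moving the corner back by the minimum keeps the
    small box inside. *)
Let box_in c r x e : 0 < r -> cbox c r `<=` K -> cbox c r (set_val x) -> 0 < e ->
  exists y h, [/\ 0 < h, h <= e, cbox y h `<=` cbox c r & forall i, `|y 0 i - set_val x 0 i| <= e].
Proof.
move=> r0 cK xc e0; pose h := Num.min e (r / 2).
have h0 : 0 < h by rewrite lt_min e0 divr_gt0.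
have he : h <= e by rewrite ge_min lexx.
have hr : h <= r / 2 by rewrite ge_min lexx orbT.
exists (\row_i Num.min (set_val x 0 i) (c 0 i + r - h)), h; split=> //.
- move=> y yx i; have := yx i; have /andP[x0 x1] := xc i; rewrite mxE.
  case: (leP (set_val x 0 i) (c 0 i + r - h)) => hx /andP[a b]; apply/andP; split; lra.
- move=> i; rewrite mxE; have /andP[x0 x1] := xc i.
  case: (leP (set_val x 0 i) (c 0 i + r - h)) => hx; first by rewrite subrr normr0 ltW.
  rewrite ler_norml; apply/andP; split; lra.
Qed.

(** Small boxes near [x] have moments tending to those of the point mass, which are therefore
    attained inside the cube, by the closedness in [corrector]. Only the difference to a box that is
    already close is corrected, so the norm stays near 1. *)
Lemma local_density c r x e : 0 < r -> cbox c r `<=` K -> cbox c r (set_val x) -> 0 < e ->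
  exists a, [/\ L1_sup (cbox c r) a, `|a| <= 1 + e & MOM a = mom (delta R x)].
Proof.
move=> r0 cK xc e0.
have [kq [Cq [_ Cq0 kS _ kC]]] := corrector_ex A cK.
have near z : 0 < z -> exists a, [/\ L1_sup (cbox c r) a, `|a| <= 1 & mnorm (mom (delta R x) - MOM a) <= z].
  move=> z0; pose e2 := z / (2 * (M%:R * k%:R + 1)).
  have Mk : 0 < 2 * (M%:R * k%:R + 1) :> R by rewrite mulr_gt0// ltr_wpDl// mulr_ge0.
  have e20 : 0 < e2 by rewrite divr_gt0.
  have [y [h [h0 he yc yx]]] := box_in r0 cK xc e20.
  have yK := subset_trans yc cK.
  exists (ubox h y); split; [exact: ubox_sup|exact: norm_ubox|].
  rewrite l1_mom_delta -(subrKA (momvec k (fun al => monomial al y))).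
  have Ky : K y by apply: yK; apply: cbox_corner; exact: ltW.
  apply: le_trans (mnormD _ _) _.
  have b1 : mnorm (momvec k (fun al => monomial al (set_val x)) - momvec k (fun al => monomial al y)) <= M%:R * (k%:R * e2).
    rewrite momvecB; apply: mnorm_momvec => [|al alk]; first by rewrite mulr_ge0// ltW.
    apply: monomial_lip => //; [exact: ltW|exact: set_val_unit|].
    by move=> i; rewrite distrC.
  have b2 : mnorm (momvec k (fun al => monomial al y) - MOM (ubox h y)) <= M%:R * (k%:R * e2).
    rewrite -mnormN opprB (le_trans (ubox_mom _ h0 yK))//.
    by rewrite !ler_wpM2l.
  apply: le_trans (lerD b1 b2) _.
  have -> : M%:R * (k%:R * e2) + M%:R * (k%:R * e2) = z * (M%:R * k%:R / (M%:R * k%:R + 1)).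
    by rewrite /e2; field; rewrite gt_eqF// ltr_wpDl// mulr_ge0.
  by rewrite ler_piMr ?(ltW z0)// ler_pdivrMr ?ltr_wpDl ?mulr_ge0// mul1r lerDl.
have [b [bs b1 bm]] := near _ (divr_gt0 e0 Cq0).
set v := mom (delta R x) - MOM b in bm.
have [kvs kvn] := kS v.
have kv : MOM (kq v) = v.
  apply: kC => z z0; have [b' [b's _ b'm]] := near _ z0.
  exists (b' - b); first exact: (am_supB (A := A)).
  have -> : am_mom A (b' - b) = MOM b' - MOM b by exact: (am_momB (A := A) (L1_supK _) (L1_supK _)).
  by rewrite /v opprB addrA subrK.
exists (b + kq v); split.
- exact: (am_supD (A := A)).
- rewrite (le_trans (ler_normD _ _))// lerD// (le_trans kvn)//.
  by rewrite mulrC -ler_pdivlMr.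
- apply: (etrans (am_momD (A := A) (L1_supK _) (L1_supK _))).
  by rewrite /= kv /v addrCA subrr addr0.
Qed.

Lemma kapI_delta x : MOM (kapI (mom (delta R x))) = mom (delta R x).
Proof.
have KE : K = cbox 0 1 by rewrite unit_cubeE.
have [a [_ _ aE]] : exists a, [/\ L1_sup (cbox 0 1) a, `|a| <= 1 + 1 & MOM a = mom (delta R x)].
  by apply: local_density => //; rewrite -KE//; exact: set_val_unit.
have [_ _ _ h _] := kapIP; rewrite -aE; apply: h; exact: L1_supK.
Qed.

Lemma kapI_linear : linear kapI. Proof. by have [] := kapIP. Qed.

Lemma kapI_norm v : `|kapI v| <= CI * mnorm v.
Proof. by have [_ _ /(_ v)[]] := kapIP. Qed.

(** Formally [f] minus a density with the same moments: both terms contain the same balancing by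
    [kap], and it cancels. *)
Definition proj f : U := tc (balU f) - Jt (kapI (mom f)).

Lemma proj_linear c f g : summ f -> summ g -> proj (c *: f + g) = c *: proj f + proj g.
Proof.
move=> sf sg; rewrite /proj (balU_linear p1 kapP)// l1_momP// kapI_linear Jt_linear linearP.
by rewrite scalerBr opprD addrACA.
Qed.

Lemma norm_proj f : summ f -> `|proj f| <= Cp d k C * (1 + CI * M%:R) * asum f.
Proof.
move=> sf; have Cp0 := ltW (Cp_gt0 kapP).
have CI0 : 0 <= CI by have [_ /ltW] := kapIP.
rewrite (le_trans (ler_normB _ _))// mulrDr mulr1 mulrDl lerD//.
  by rewrite norm_to_completion norm_balU.
rewrite (le_trans (norm_Jt _))// -mulrA ler_wpM2l// (le_trans (kapI_norm _))// -mulrA ler_wpM2l//.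
exact: mnorm_l1_mom.
Qed.

Definition point x : U := proj (delta R x).

Lemma znode_inj N : (1 < N)%N -> injective (@znode R d N).
Proof.
move=> N1 j j' /(congr1 set_val); rewrite !znodeE => /rowP h; apply/ffunP => i.
have N0 : 0 < N.-1%:R :> R by rewrite ltr0n -ltnS prednK// ltnW.
have := h i; rewrite !mxE => /(mulIf (lt0r_neq0 _)) => /(_ _)/eqP.
by rewrite eqr_nat => /(_ _)/eqP/val_inj; apply; rewrite invr_gt0.
Qed.

Lemma lqnorm_small B e : 0 <= B -> 0 < e -> exists2 dl : R, 0 < dl &
  forall n (c : 'I_n -> R), (forall i, `|c i| <= dl) -> \sum_i `|c i| <= B ->
  lqnorm (hoelder_conjugate p%:E) c <= e.
Proof.
move=> B0 e0; have p0 := p_gt0 p1; set L := B `^ (1 - p^-1).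
have L0 : 0 <= L by exact: powR_ge0.
have L1 : 0 < L + 1 by rewrite ltr_wpDl.
exists ((e / (L + 1)) `^ p); first by rewrite powR_gt0// divr_gt0.
move=> n c hc hB; apply: le_trans (lqnorm_le p1 _ hc hB) _; first exact: powR_ge0.
rewrite -powRrM (mulfV (lt0r_neq0 p0)) powRr1 ?divr_ge0 ?(ltW e0) ?(ltW L1)//.
by rewrite mulrAC ler_pdivrMr// ler_wpM2l ?(ltW e0)// lerDl.
Qed.

(** Hoelder's inequality: the cell masses have bounded sum and small maximum, hence small l_{p'}
    norm, while [phi] is sampled at distinct nodes. *)
Lemma lp_disc_small (phi : T -> R) a e : lp p phi -> 0 < e -> exists n0, forall n, (n0 <= n)%N ->
  `|\sum_j pair (\1_(cell j)) a * phi (@znode R d (2 ^ n) j)| <= e.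
Proof.
move=> hphi e0; have p0 := p_gt0 p1; set B := lp_norm p phi.
have B0 : 0 <= B by exact: lp_norm_ge0.
have B1 : 0 < B + 1 by rewrite ltr_wpDl.
have [dl dl0 hdl] := lqnorm_small (normr_ge0 a) (divr_gt0 e0 B1).
have [n0 hn0] := cell_mass_small a d0 dl0.
exists n0.+1 => n n0n; have nN : (n0 <= 2 ^ n)%N.
  by apply: leq_trans (ltnW n0n) _; exact/ltnW/ltn_expl.
pose c (i : 'I_#|J (2 ^ n)|) := pair (\1_(@cell R d _ (enum_val i))) a.
pose b (i : 'I_#|J (2 ^ n)|) := phi (@znode R d _ (enum_val i)).
rewrite (reindex _ (onW_bij _ (enum_val_bij _))) -[X in `|X|]/(\sum_i c i * b i).
apply: le_trans (ler_norm_sum _ _ _) _; under eq_bigr do rewrite normrM.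
apply: le_trans (hoelder_lqnorm p1 _ _) _.
have cS : \sum_i `|c i| <= `|a|.
  rewrite -(mass_sum (@measurable_cell R d (2 ^ n)) (fun y : 'rV[R]_d => @cell_sum R d (2 ^ n) y (expn2_gt0 n)) a).
  rewrite [leRHS](reindex _ (onW_bij _ (enum_val_bij _))); apply: ler_sum => i _.
  exact: pair_cell_le.
have cM i : `|c i| <= dl by apply: le_trans (pair_cell_le _ _) _; exact: hn0.
have bS : (\sum_i `|b i| `^ p) `^ p^-1 <= B.
  have -> : B = (B `^ p) `^ p^-1 by rewrite -powRrM (mulfV (lt0r_neq0 p0)) powRr1.
  rewrite ge0_ler_powR ?invr_ge0 ?(ltW p0)// ?nnegrE ?powR_ge0 ?sumr_powR_ge0//.
  have us : uniq [seq @znode R d (2 ^ n) (enum_val i) | i <- index_enum 'I_#|J (2 ^ n)|].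
    rewrite map_inj_uniq ?index_enum_uniq// => i i' /znode_inj h; apply: enum_val_inj.
    apply: h; rewrite -[1%N](expn0 2) ltn_exp2l//; exact: leq_ltn_trans n0n.
  by have := lp_sum p1 hphi us; rewrite big_map.
have e1 : 0 <= e / (B + 1) by rewrite divr_ge0 ?(ltW e0) ?(ltW B1).
apply: le_trans (ler_pM _ _ (hdl _ _ cM cS) bS) _; [exact: lqnorm_ge0|exact: powR_ge0|].
by rewrite mulrAC ler_pdivrMr// ler_wpM2l ?(ltW e0)// lerDl.
Qed.

Lemma lp_functional (phi : T -> R) : lp p phi -> exists lam : {linear U -> R^o},
  [/\ forall u, `|lam u| <= D * lp_norm p phi * `|u|, forall x, lam (point x) = phi x,
      forall f : U0 R d k, lam (tc f) = lsum (fun x => phi x * val f x) &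
      forall a, MOM a = 0 -> lam (Jt a) = 0].
Proof.
move=> hphi; have p0 := p_gt0 p1; set B := lp_norm p phi.
have B0 : 0 <= B by exact: lp_norm_ge0.
pose lam0 f := lsum (fun x => phi x * f x).
have phiB x : `|phi x| <= B by exact: lp_le.
have lamB : l1_bounded lam0 B.
  split=> [c f g sf sg|f sf]; first exact: (lsumP c phiB).
  have sM := summM phiB sf; apply: le_trans (ler_norm_ssum sM) _.
  rewrite -[X in X * asum _]ger0_norm// -asumZ//; apply: le_nsum => [|x].
    exact/summ_norm/summZ.
  by rewrite normr_ge0/= !normrM ler_wpM2r// (ger0_norm B0).
have lamd x : lam0 (delta R x) = phi x by exact: (ssum_delta phi).
have lamU (f : U0 R d k) : `|lam0 (val f)| <= D * B * UN f.
  apply: (l1_bounded_hull p1 lamB lamd B0) => s us; exact: lp_sum.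
have sU (f : U0 R d k) : summ (val f) by have [[]] := hull_in AL f.
have lamL : linear (fun f : U0 R d k => lam0 (val f) : R^o).
  by move=> c f g; rewrite GRing.valD GRing.valZ; exact: (lamB.1 c _ _ (sU f) (sU g)).
have DB0 : 0 <= D * B by rewrite mulr_ge0// powR_ge0.
have Rc : complete_space R^o by move=> F FF cF; exact: cauchy_cvg.
have [lam [lamE lamn]] := completion_extend (j := mk_linear lamL) Rc DB0 lamU.
have lam0B f g : summ f -> summ g -> lam0 (f - g) = lam0 f - lam0 g.
  move=> sf sg; have := lamB.1 (-1) g f sg sf; rewrite scaleN1r mulN1r addrC => ->.
  by rewrite addrC.
have skap v : summ (kap v) by exact: (kap_summ kapP).
have lamb f : summ f -> lam (tc (balU f)) = lam0 f - lam0 (kap (mom f)).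
  by move=> sf; rewrite lamE /= (val_balU p1 kapP)// lam0B.
(* The sums of [phi] against discretisations tend to 0, so only the balancing term survives. It
   vanishes for moment-free [a] and cancels in [lam (point x)]. *)
have lamJ a : lam (Jt a) = - lam0 (kap (MOM a)).
  apply/eqP; rewrite -subr_eq0 opprK -normr_le0.
  apply: (@ler_addM_gt0 _ _ _ (D * B + 1 + B * C)) => e e0; rewrite add0r.
  have C0 := C_ge0 kapP.
  have [n1 h1] := Jt_disc p1 d0 kapP a e0.
  have [n2 h2] := lp_disc_small a hphi e0.
  pose Z : R := M%:R * k%:R * `|a|; have Z0 : 0 <= Z by rewrite !mulr_ge0.
  have [n3 _ h3] := near_infty_natSinv_lt (PosNum (divr_gt0 e0 (ltr_pwDr ltr01 Z0))).
  pose n := maxn (maxn n1 n2) n3.+1; pose dz := disc (@znode R d (2 ^ n)) a.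
  have n1n : (n1 <= n)%N by rewrite !leq_max leqnn.
  have n2n : (n2 <= n)%N by rewrite !leq_max leqnn orbT.
  have n3n : (n3 < n)%N by rewrite !leq_max leqnn !orbT.
  have sdz : summ dz by exact: summ_disc.
  have hm : mnorm (MOM a - mom dz) <= e.
    rewrite -mnormN opprB; apply: le_trans (disc_mom _ a (expn2_gt0 n) (@nodes_znode R d _)) _.
    have lh : (n3 <= (2 ^ n).-1)%N.
      by rewrite -ltnS prednK ?expn2_gt0//; apply: ltn_trans n3n _; exact: ltn_expl.
    have := h3 _ lh; rewrite /= prednK ?expn2_gt0// => hh.
    have -> : M%:R * (k%:R / (2 ^ n)%:R) * `|a| = Z * (2 ^ n)%:R^-1.
      by rewrite /Z; field; rewrite gt_eqF// ltr0n expn2_gt0.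
    rewrite (le_trans (ler_wpM2l Z0 (ltW hh)))//.
    by rewrite mulrA ler_pdivrMr ?ltr_wpDl// mulrDr mulr1 mulrC lerDl ltW.
  have -> : lam (Jt a) + lam0 (kap (MOM a)) =
      lam (Jt a - tc (balU dz)) + lam0 dz + lam0 (kap (MOM a - mom dz)).
    rewrite linearB lamb//.
    have -> : kap (MOM a - mom dz) = kap (MOM a) - kap (mom dz).
      exact: (linearB (mk_linear (kap_linear kapP))).
    rewrite lam0B//; set u1 := lam _; set u2 := lam0 dz; set u3 := lam0 _; set u4 := lam0 _.
    have alg (s t u v : R) : s + u = s - (t - v) + t + (u - v) by ring.
    exact: alg.
  rewrite !mulrDl mul1r; apply: le_trans (ler_normD _ _) _; apply: lerD.
    apply: le_trans (ler_normD _ _) _; apply: lerD.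
      by apply: le_trans (lamn _) _; rewrite ler_wpM2l// h1//; exact: nodes_znode.
    rewrite [lam0 dz](l1_bounded_sum lamB) => [|j]; last exact: summ_delta.
    under eq_bigr do rewrite lamd.
    exact: h2.
  apply: le_trans (lamB.2 _ (skap _)) _; rewrite -mulrA ler_wpM2l//.
  by apply: le_trans (kap_asum kapP _) _; rewrite ler_wpM2l.
exists lam; split=> //.
- move=> x; rewrite /point /proj linearB lamb; last exact: summ_delta.
  by rewrite lamd lamJ kapI_delta opprK subrK.
- move=> a a0; rewrite lamJ a0.
  rewrite (kap0 kapP); have := lamB.1 (-1) 0 0 (summ0 R T) (summ0 R T).
  by rewrite scaler0 addr0 mulN1r addNr => ->; rewrite oppr0.
Qed.

(** A point mass minus a density with equal moments is close to a moment-free l_1 function on the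
    small cube. Each of the two contributes mass about 1, the origin of the factor 2 in
    [dual_point_bound]. *)
Lemma local_point c r x e : 0 < r -> cbox c r `<=` K -> cbox c r (set_val x) -> 0 < e ->
  exists a g, [/\ MOM a = mom (delta R x), l1_sup (cbox c r) g, asum g <= 2 + e, mom g = 0 &
    `|tc (balU (delta R x)) - Jt a - tc (balU g)| <= e].
Proof.
move=> r0 cK xc e0; have e2 : 0 < e / 2 by rewrite divr_gt0.
have [kq [Cq [_ Cq0 kS kM _]]] := corrector_ex AL cK.
have [a [aQ a1 aM]] := local_density r0 cK xc e2.
pose Cpp := Cp d k C; have Cp0 : 0 < Cpp by exact: (Cp_gt0 kapP).
pose eta := Num.min (e / 2) (Num.min (e / 2 / Cq) (e / 2 / (Cpp * Cq))).
have eta0 : 0 < eta by rewrite !lt_min !divr_gt0// mulr_gt0.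
have [g [gQ g1 gm gJ]] := Jt_approx p1 d0 kapP aQ eta0.
have sg : summ g by case: gQ.
have sd := summ_delta R x.
pose f1 := delta R x - g; have sf1 : summ f1 by exact: summB.
have f1Q : l1_sup (cbox c r) f1 by apply: (am_supB (A := AL)) => //; exact: delta_sup.
have f1m : mnorm (mom f1) <= eta by rewrite l1_momB// -aM -mnormN opprB.
have [kgQ kgn] := kS (mom f1).
have skg : summ (kq (mom f1)) by case: kgQ.
have eta1 : Cq * eta <= e / 2 by rewrite mulrC -ler_pdivlMr// !ge_min lexx orbT.
have eta2 : Cpp * (Cq * eta) <= e / 2.
  by rewrite mulrA mulrC -ler_pdivlMr ?mulr_gt0// !ge_min lexx !orbT.
have kgn' : asum (kq (mom f1)) <= Cq * eta.
  by apply: le_trans kgn _; rewrite ler_wpM2l// ltW.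
exists a, (f1 - kq (mom f1)); split=> //.
- exact: (am_supB (A := AL)).
- apply: le_trans (am_nuB (A := AL) (l1_supK sf1) (l1_supK skg)) _.
  have h1 : asum f1 <= 1 + (1 + e / 2).
    apply: le_trans (am_nuB (A := AL) (l1_supK sd) (l1_supK sg)) _.
    by rewrite [am_nu AL (delta R x)]asum_delta lerD2l; exact: le_trans g1 a1.
  have -> : 2 + e = 1 + (1 + e / 2) + e / 2 by lra.
  by apply: lerD => //; exact: le_trans kgn' eta1.
- rewrite l1_momB//; apply/eqP; rewrite subr_eq0; apply/eqP/esym; exact: kM.
- have -> : tc (balU (delta R x)) - Jt a - tc (balU (f1 - kq (mom f1))) =
     tc (balU (kq (mom f1))) - (Jt a - tc (balU g)).
    have tcB u v : tc (u - v) = tc u - tc v by exact: linearB.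
    rewrite (balUB p1 kapP sf1 skg) tcB (balUB p1 kapP sd sg) tcB.
    move: (tc (balU (delta R x))) (Jt a) (tc (balU g)) (tc (balU (kq _))) => u1 u2 u3 u4.
    by rewrite -[u1 - u3 - u4]addrA -opprD opprB addrC subrKA [u3 + u4]addrC -addrA [in RHS]opprB.
  rewrite (le_trans (ler_normB _ _))// [leRHS]splitr lerD//.
    by rewrite norm_to_completion (le_trans (norm_balU p1 kapP skg))// (le_trans _ eta2)// ler_wpM2l// ltW.
  by apply: le_trans gJ _; rewrite ge_min lexx.
Qed.

Lemma dual_linear_sum (X : normedModType R) (psi : dual X) n (c : 'I_n -> R) (F : 'I_n -> X) :
  val psi (\sum_i c i *: F i) = \sum_i c i * val psi (F i).
Proof.
rewrite [LHS](linear_sum (mk_linear (dual_linear psi) : {linear X -> R^o})).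
apply: eq_bigr => i _; exact: (linearZ_LR (mk_linear (dual_linear psi) : {linear X -> R^o})).
Qed.

(** Two points of one cell are at l_1 distance at most [d / N], and [N] exceeds [d] times the sum of
    all inverse distances. Diagonal terms contribute [0^-1 = 0]. *)
Lemma separating_cells n (x : 'I_n -> T) : injective x ->
  exists N (j : 'I_n -> J N), [/\ (0 < N)%N, injective j & forall i, cell (j i) (set_val (x i))].
Proof.
move=> xi; pose dist i i' := mnorm (set_val (x i) - set_val (x i')).
pose S : R := d%:R * \sum_i \sum_i' (dist i i')^-1.
pose N := (Num.truncn S).+1; have hN : S < N%:R by exact: truncnS_gt.
have N0 : 0 < N%:R :> R by rewrite ltr0n.
have /choice[j jP] : forall i, exists j : J N, cell j (set_val (x i)).
  move=> i; have Kx := set_val_unit (x i).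
  have /choice[f fP] : forall l, exists q : 'I_N, icell N q (set_val (x i) 0 l).
    by move=> l; apply: icell_ex => //; exact: Kx.
  by exists (finfun f); split=> // l; rewrite ffunE.
exists N, j; split=> // i i' jj; apply: contrapT => /eqP ii.
have xx : 0 < dist i i'.
  rewrite lt_neqAle mnorm_ge0 andbT eq_sym; apply: contra ii => /eqP/mnorm_eq0/subr0_eq h.
  by apply/eqP/xi/val_inj.
have hd : dist i i' <= d%:R / N%:R.
  rewrite /dist /mnorm -[d in d%:R]card_ord -sumr_const mulr_suml; apply: ler_sum => l _.
  have /cell_ccube/(_ l) := jP i; have /cell_ccube/(_ l) := jP i'; rewrite jj !mxE mul1r => /andP[a b] /andP[a' b'].
  by rewrite ler_norml; apply/andP; split; lra.
have : S < S.
  apply: lt_le_trans hN _; apply: (@le_trans _ _ (d%:R * (dist i i')^-1)).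
    by rewrite ler_pdivlMr// mulrC -ler_pdivlMr.
  rewrite ler_wpM2l// (bigD1 i)//= (bigD1 i')//= -addrA lerDl addr_ge0//.
    by apply: sumr_ge0 => q _; rewrite invr_ge0 mnorm_ge0.
  by apply: sumr_ge0 => q _; apply: sumr_ge0 => q' _; rewrite invr_ge0 mnorm_ge0.
by rewrite ltxx.
Qed.

Section Annihilator.
Context (W : closed_subspace U) (WJ : forall a, MOM a = 0 -> cs_val W (Jt a)).

Let JtB a b : Jt (a - b) = Jt a - Jt b.
Proof. exact: (linearB (mk_linear (Jt_linear p1 d0 kapP))). Qed.

Lemma quot_point x a : MOM a = mom (delta R x) ->
  quot W (point x) = quot W (tc (balU (delta R x)) - Jt a).
Proof.
move=> aM; apply: quot_eq; rewrite /point /proj opprB addrC subrKA -JtB; apply: WJ.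
apply: (etrans (am_momB (A := A) (L1_supK _) (L1_supK _))).
by rewrite /= aM kapI_delta subrr.
Qed.

(* Modulo [W] the density in [point x] can be concentrated near [x]; for distinct
   points this gives a chain over disjoint cubes with coefficients near [2 c]. *)
Lemma dual_point_bound (psi : dual (quotient W)) s : uniq s ->
  \sum_(x <- s) `|val psi (quot W (point x))| `^ p <= (2 * `|psi|) `^ p.
Proof.
case: s => [|x0 s] us; first by rewrite big_nil powR_ge0.
set s0 := x0 :: s in us *; pose n := size s0; pose z (i : 'I_n) := nth x0 s0 i.
have zi : injective z.
  by move=> i i' /eqP; rewrite nth_uniq// => /eqP/val_inj.
pose b i := val psi (quot W (point (z i))).
have -> : \sum_(x <- s0) `|val psi (quot W (point x))| `^ p = \sum_i `|b i| `^ p.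
  by rewrite (big_nth x0) big_mkord.
apply: (lqnorm_dual p1); first by rewrite mulr_ge0.
move=> c; set w := lqnorm _ c; have w0 : 0 <= w by exact: lqnorm_ge0.
have [N [j [N0 ji jz]]] := separating_cells zi.
apply: (@ler_addM_gt0 _ _ _ (`|psi| * (w + \sum_i `|c i|))) => e e0.
have N1 : 0 < N%:R^-1 :> R by rewrite invr_gt0 ltr0n.
have /choice[ag agP] : forall i, exists ag : L1 R d * (T -> R), [/\ MOM ag.1 = mom (delta R (z i)),
    l1_sup (ccube (j i)) ag.2, asum ag.2 <= 2 + e, mom ag.2 = 0 &
    `|tc (balU (delta R (z i))) - Jt ag.1 - tc (balU ag.2)| <= e].
  move=> i; have [a [g h]] := local_point N1 (@ccube_unit R d N (j i)) (cell_ccube (jz i)) e0.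
  by exists (a, g).
pose g i := (ag i).2; have sg i : summ (g i) by have [_ []] := agP i.
have gK i : val (balU (g i)) = g i.
  by apply: (val_balU0 p1 kapP) => //; have [] := agP i.
have e2 : 0 < 2 + e by rewrite addr_gt0.
have h : hull_le p1 (@l1_atom R d k) (\sum_i c i *: g i) ((2 + e) * w).
  have -> : \sum_i c i *: g i = (2 + e) *: \sum_i c i *: ((2 + e)^-1 *: g i).
    rewrite scaler_sumr; apply: eq_bigr => i _; rewrite !scalerA; congr (_ *: _).
    by rewrite mulrAC mulfV ?mul1r// gt_eqF.
  rewrite -[X in X * w]ger0_norm ?(ltW e2)//; apply: hull_leZ; apply: hull_le_chain.
  have [cQ triv] := fpacking_ccube R d N0.
  exists n, (fun i => ccube (j i)), c, (fun i => (2 + e)^-1 *: g i); split=> //.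
    split=> [i|i i' _ _ ii]; first exact: cQ.
    by apply: ji; apply: triv.
  move=> i; apply/(am_atomP AL); first exact: ccube_unit.
  have [_ b1 b2 b3 _] := agP i; split.
  - exact: (am_supZ (A := AL)).
  - rewrite [am_nu _ _](asumZ _ (sg i)) gtr0_norm ?invr_gt0// mulrC ler_pdivrMr// mul1r.
    exact: b2.
  - by rewrite /= l1_momZ// b3 scaler0.
have Ng : UN (\sum_i c i *: balU (g i)) <= (2 + e) * w.
  apply: hull_leP; rewrite raddf_sum (_ : \sum_i _ = \sum_i c i *: g i)//.
  by apply: eq_bigr => i _; rewrite -[in RHS]gK; exact: GRing.valZ.
pose y := \sum_i c i *: (tc (balU (delta R (z i))) - Jt (ag i).1).
have -> : \sum_i c i * b i = val psi (quot W y).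
  have -> : quot W y = \sum_i c i *: quot W (point (z i)).
    rewrite /y [LHS](linear_sum (mk_linear (@quot_linear _ _ W))); apply: eq_bigr => i _.
    rewrite [LHS](linearZ_LR (mk_linear (@quot_linear _ _ W))); congr (_ *: _).
    by apply/esym/quot_point; have [] := agP i.
  by rewrite dual_linear_sum.
apply: le_trans (ler_norm _) _; apply: le_trans (dual_le _ _) _.
have hy : `|y| <= (2 + e) * w + e * \sum_i `|c i|.
  have -> : y = tc (\sum_i c i *: balU (g i)) +
      \sum_i c i *: (tc (balU (delta R (z i))) - Jt (ag i).1 - tc (balU (g i))).
    rewrite [tc _]linear_sum -big_split; apply: eq_bigr => i _ /=.
    transitivity (c i *: tc (balU (g i)) + c i *: (tc (balU (delta R (z i))) - Jt (ag i).1 - tc (balU (g i)))).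
      by rewrite -scalerDr [tc (balU (g i)) + _]addrC subrK.
    by congr (_ + _); exact/esym/linearZ.
  apply: le_trans (ler_normD _ _) _; apply: lerD; first by rewrite norm_to_completion.
  apply: le_trans (ler_norm_sum _ _ _) _; rewrite mulr_sumr; apply: ler_sum => i _.
  by rewrite normrZ mulrC ler_wpM2r//; have [] := agP i.
have hq : `|quot W y| <= `|y| by have := norm_quot_le y (cs0 W); rewrite subr0.
apply: le_trans (ler_wpM2l (normr_ge0 psi) (le_trans hq hy)) _.
by rewrite le_eqVlt; apply/orP; left; apply/eqP; ring.
Qed.

(** Composing [psi] with [proj] gives a bounded functional on l_1 whose values at point masses are
    those assumed small, and [proj] is the inclusion on the hull. So [l1_bounded_hull] applies;
    density and lifting reach the quotient. *)
Lemma dual_norm_bound (psi : dual (quotient W)) B : 0 <= B ->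
  (forall s, uniq s -> \sum_(x <- s) `|val psi (quot W (point x))| `^ p <= B `^ p) ->
  `|psi| <= D * B.
Proof.
move=> B0 hB; have DB0 : 0 <= D * B by rewrite mulr_ge0// powR_ge0.
pose lam f := val psi (quot W (proj f)).
have lamB : l1_bounded lam (`|psi| * (Cp d k C * (1 + CI * M%:R))).
  split=> [c f g sf sg|f sf].
    by rewrite /lam proj_linear// quot_linear (dual_linear psi).
  apply: le_trans (dual_le _ _) _; rewrite -mulrA ler_wpM2l//.
  apply: le_trans (norm_proj sf).
  by have := norm_quot_le (proj f) (cs0 W); rewrite subr0.
have kI0 : kapI 0 = 0.
  exact: (linear0 (mk_linear kapI_linear)).
have Jt0 : Jt 0 = 0 by exact: (linear0 (mk_linear (Jt_linear p1 d0 kapP))).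
have hU (u : U0 R d k) : `|val psi (quot W (tc u))| <= D * B * UN u.
  have -> : tc u = proj (val u).
    rewrite /proj (balU_id p1 kapP) (_ : mom (val u) = 0) ?kI0 ?Jt0 ?subr0//.
    by have [] := hull_in AL u.
  exact: (l1_bounded_hull p1 lamB (phi := fun x => val psi (quot W (point x))) _ B0 hB).
have hX (y : U) : `|val psi (quot W y)| <= D * B * `|y|.
  apply: (@ler_addM_gt0 _ _ _ (`|psi| + D * B)) => e e0.
  have [u hu] := completion_dense y e0.
  have -> : val psi (quot W y) = val psi (quot W (tc u)) + val psi (quot W (y - tc u)).
    have yE : y = 1 *: tc u + (y - tc u) by rewrite scale1r addrC subrK.
    by rewrite {1}yE quot_linear (dual_linear psi) scale1r.
  apply: le_trans (ler_normD _ _) _; apply: le_trans (lerD (hU u) (dual_le _ _)) _.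
  have hq : `|quot W (y - tc u)| <= e.
    by have := norm_quot_le (y - tc u) (cs0 W); rewrite subr0 => /le_trans; apply.
  have hu2 : UN u <= `|y| + e.
    rewrite -norm_to_completion -(subrK y (tc u)) (le_trans (ler_normD _ _))// addrC lerD2l.
    by rewrite distrC.
  have a1 := ler_wpM2l DB0 hu2; have a2 := ler_wpM2l (normr_ge0 psi) hq.
  apply: le_trans (lerD a1 a2) _; rewrite le_eqVlt; apply/orP; left; apply/eqP; ring.
apply: dual_norm_le => // q; apply: (@ler_addM_gt0 _ _ _ (D * B)) => e e0.
have [y <- hy] := quot_lift q e0.
by apply: le_trans (hX y) _; rewrite -mulrDr ler_wpM2l.
Qed.

Definition dual_trace (psi : dual (quotient W)) : T -> R := fun x => val psi (quot W (point x)).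

Lemma dual_trace_linear : linear dual_trace.
Proof. by move=> c f g; apply/funext => x; rewrite /dual_trace GRing.valD GRing.valZ. Qed.

(** The constants [D^-1] and 2 are those of [dual_norm_bound] and [dual_point_bound]. For
    surjectivity, [W0] lets the functional of [lp_functional] vanish on all of [W] by continuity. *)
Lemma dual_isomorphic (W0 : forall w, cs_val W w -> forall e, 0 < e ->
    exists2 a, MOM a = 0 & `|w - Jt a| <= e) : isomorphic_lp d p (dual (quotient W)).
Proof.
have D0 : 0 < D by rewrite powR_gt0// ltr0n expn2_gt0.
have up psi : lp p (dual_trace psi) /\ lp_norm p (dual_trace psi) <= 2 * `|psi|.
  by apply: (lp_bound p1) => [|s]; [exact: mulr_ge0|exact: dual_point_bound].
exists (mk_linear dual_trace_linear); split.
  apply/seteqP; split=> [_ [psi _ <-]|phi hphi]; first by case: (up psi).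
  have [lam [lamn lamp _ lamJ]] := lp_functional hphi.
  have DB0 : 0 <= D * lp_norm p phi by rewrite mulr_ge0 ?lp_norm_ge0// ltW.
  have lamW w : cs_val W w -> lam w = 0.
    move=> Ww; apply/eqP; rewrite -normr_le0.
    apply: (@ler_addM_gt0 _ _ _ (D * lp_norm p phi)) => e e0; rewrite add0r.
    have [a a0 ha] := W0 _ Ww _ e0.
    have -> : lam w = lam (w - Jt a) by rewrite linearB lamJ// subr0.
    by apply: le_trans (lamn _) _; rewrite ler_wpM2l.
  have lamL : @GRing.linear_for R U R *%R lam by move=> c u v; exact: linearP.
  have [psi hpsi] := quot_dual DB0 lamL lamn lamW.
  by exists psi => //; apply/funext => x; rewrite -lamp; exact: hpsi.
exists D^-1, 2; split; first by rewrite invr_gt0.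
move=> psi; have [h1 h2] := up psi; rewrite h2 andbT mulrC ler_pdivrMr// mulrC.
apply: dual_norm_bound => [|s us]; first exact: lp_norm_ge0.
exact: (lp_sum p1 h1 us).
Qed.

End Annihilator.

End Final.

(** * Separability and the unit ball *)

Section Separability.
Context (R : realType) (X : normedModType R).
Implicit Types (S W : set X).

Lemma closure_normP S (x : X) : closure S x <-> forall e, 0 < e -> exists2 y, S y & `|x - y| <= e.
Proof.
split=> [cx e e0|h B /nbhs_normP[e /= e0 eB]].
  have [y [Sy xy]] := cx _ (nbhsx_ballx x e e0).
  by exists y => //; apply: ltW; move: xy; rewrite -ball_normE.
have [y Sy xy] := h (e / 2) (divr_gt0 e0 (ltr0n _ 2)).
exists y; split=> //; apply: eB => /=.
by apply: le_lt_trans xy _; rewrite ltr_pdivrMr// mulr2n mulrDr mulr1 ltrDl.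
Qed.

(** The countable set [S] may lie outside [W]. For each [s] and [n] a point of [W] within [1/(n+1)]
    of [s] is chosen if there is one, and these points are dense. *)
Lemma separable_approx S W w0 : W w0 -> countable S ->
  (forall w, W w -> forall e, 0 < e -> exists2 s, S s & `|w - s| <= e) -> separable W.
Proof.
move=> Ww0 cS h.
have /choice[g gP] : forall sn : X * nat, exists w, W w /\
    ((exists2 w', W w' & `|w' - sn.1| <= sn.2.+1%:R^-1) -> `|w - sn.1| <= sn.2.+1%:R^-1).
  move=> sn; have [[w' Ww' hw']|nw] := pselect (exists2 w', W w' & `|w' - sn.1| <= sn.2.+1%:R^-1).
    by exists w'.
  by exists w0.
exists (g @` (S `*` setT)); split.
- apply: sub_countable (card_image_le _ _) _; exact: countableX.
- by move=> _ [sn _ <-]; case: (gP sn).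
- move=> w Ww; apply/closure_normP => e e0.
  have [n _ /(_ n (leqnn n)) /= hn] := near_infty_natSinv_lt (PosNum (divr_gt0 e0 (ltr0n _ 2))).
  have n0 : 0 < n.+1%:R^-1 :> R by rewrite invr_gt0.
  have [s Ss ws] := h _ Ww _ n0.
  exists (g (s, n)); first by exists (s, n).
  have /(_ _)/le_trans hg := (gP (s, n)).2.
  rewrite -(subrKA s) (le_trans (ler_normD _ _))// [leRHS]splitr; apply: lerD.
    by apply: le_trans ws (ltW hn).
  by rewrite distrC; apply: hg (ltW hn); exists w.
Qed.

End Separability.

Section UnitBall.
Context (R : realType) (d k : nat) (p : R) (p1 : 1 <= p).
Local Notation UN := (U0_norm d k p1).
Local Notation tc := (to_completion UN).

Lemma empty_packing : packing (fun i : 'I_0 => set0 : set 'rV[R]_d).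
Proof. by split=> [[]|[]]. Qed.

Lemma unit_chains0 : unit_chains d k p (0 : U0 R d k).
Proof.
exists (@lqnorm R (hoelder_conjugate p%:E) 0 (fun=> 0)); last first.
  have := @lqnorm_le R p p1 0 (fun=> 0) 0 0 (lexx 0).
  rewrite big_ord0 => /(_ _ (lexx 0))/le_trans; apply; first by case.
  by rewrite powR0 ?mul0r// gt_eqF// invr_gt0 (p_gt0 p1).
exists 0%N, (fun i : 'I_0 => set0), (fun=> 0), (fun=> 0).
by split=> //; [exact: empty_packing|case|rewrite big_ord0].
Qed.

Lemma convex_hull_le1 (u : U d k p1) :
  sym_convex_hull [set tc b | b in unit_chains d k p] u -> `|u| <= 1.
Proof.
move=> [n [t [a [ta t1 ->]]]]; apply: le_trans (ler_norm_sum _ _ _) _.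
rewrite -t1; apply: ler_sum => i _; have [t0 h] := ta i.
rewrite normrZ ger0_norm// ler_piMr//.
have h1 b : unit_chains d k p b -> `|tc b| <= 1.
  move=> [w bw w1]; rewrite norm_to_completion; apply: le_trans w1.
  exact: (hull_leP (hull_le_chain p1 bw)).
by case: h => [[b hb <-]|[_ [b hb <-] <-]]; rewrite ?normrN h1.
Qed.

Lemma lqnormZ n t (c : 'I_n -> R) : lqnorm (hoelder_conjugate p%:E) (fun i => t * c i) =
  `|t| * lqnorm (hoelder_conjugate p%:E) c.
Proof.
case: (conj_exponent p1) => [[_ ->]|[r [-> _ r1 _ _]]] /=.
  elim/big_rec2: _ => [|i x y _ ->]; first by rewrite mulr0.
  by rewrite maxr_pMr// normrM.
have r0 : r != 0 by rewrite gt_eqF// (lt_trans ltr01).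
under eq_bigr do rewrite normrM powRM//.
by rewrite -mulr_sumr powRM ?powR_ge0 ?sumr_powR_ge0// -powRrM (mulfV r0) powRr1.
Qed.

(** In a nearly optimal presentation each chain is divided by its own norm and weighted by its share
    of [UN f + e]. Adding [del] avoids division by 0. *)
Lemma hull_scaled (f : U0 R d k) e : 0 < e ->
  sym_convex_hull [set tc b | b in unit_chains d k p] (tc ((UN f + e)^-1 *: f)).
Proof.
move=> e0; have e2 : 0 < e / 2 by rewrite divr_gt0.
have [m [b [w [bw fE wN]]]] := hull_presentation p1 f e2.
have wN' : \sum_i w i <= UN f + e / 2 by exact: wN.
have w0 i : 0 <= w i by exact: (chain_ge0 p1 (bw i)).
pose S := UN f + e; have S0 : 0 < S by rewrite ltr_wpDl// sn_ge0.
have /choice[g gP] : forall i, exists g : U0 R d k, val g = b i.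
  by move=> i; have [g gb _] := hull_le_chain p1 (bw i); exists g.
have fg : f = \sum_i g i.
  apply: val_inj; rewrite fE [RHS](raddf_sum (val : U0 R d k -> _)).
  by apply: eq_bigr => i _; exact/esym/gP.
pose del := e / 2 / m.+1%:R; have del0 : 0 < del by rewrite divr_gt0.
have wd i : 0 < w i + del by rewrite ltr_wpDl.
have sumw : \sum_i (w i + del) <= S.
  rewrite big_split /= sumr_const card_ord -[_ *+ m]mulr_natl /S [in leRHS](splitr e) addrA lerD//.
  by rewrite /del mulrCA ler_piMr ?(ltW e2)// ler_pdivrMr// mul1r ler_nat.
(* The shares sum to at most 1; index 0 gives the missing weight to the zero chain. *)
pose t (i : 'I_m.+1) := if unlift ord0 i is Some j then (w j + del) / S
  else 1 - \sum_j (w j + del) / S.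
pose a (i : 'I_m.+1) : U d k p1 := if unlift ord0 i is Some j then tc ((w j + del)^-1 *: g j) else tc 0.
have t0 : t ord0 = 1 - \sum_j (w j + del) / S by rewrite /t unlift_none.
have tl j : t (lift ord0 j) = (w j + del) / S by rewrite /t liftK.
have a0 : a ord0 = tc 0 by rewrite /a unlift_none.
have al j : a (lift ord0 j) = tc ((w j + del)^-1 *: g j) by rewrite /a liftK.
exists m.+1, t, a; split.
- move=> i; rewrite /t /a; case: (unlift ord0 i) => [j|].
    split; first by rewrite divr_ge0 ?(ltW S0) ?(ltW (wd j)).
    left; exists ((w j + del)^-1 *: g j) => //.
    exists (w j / (w j + del)); last by rewrite ler_pdivrMr// mul1r lerDl ltW.
    move: (bw j) => [n [Q [c [a' [pQ aQ bE wE]]]]].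
    exists n, Q, (fun i => (w j + del)^-1 * c i), a'; split=> //.
      rewrite GRing.valZ gP bE scaler_sumr; apply: eq_bigr => l _.
      by rewrite scalerA.
    rewrite lqnormZ -wE ger0_norm ?invr_ge0; first exact: mulrC.
    exact: ltW (wd j).
  split; last by left; exists 0 => //; exact: unit_chains0.
  by rewrite subr_ge0 -mulr_suml ler_pdivrMr// mul1r.
- by rewrite big_ord_recl; under eq_bigr do rewrite tl; rewrite t0 subrK.
- rewrite big_ord_recl a0 linear0 scaler0 add0r {2}fg scaler_sumr linear_sum.
  apply: eq_bigr => i _; rewrite tl al.
  transitivity (S^-1 *: tc (g i)); first exact: linearZ.
  have -> : tc ((w i + del)^-1 *: g i) = (w i + del)^-1 *: tc (g i) by exact: linearZ.
  by rewrite scalerA mulrAC mulfV ?mul1r// gt_eqF.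
Qed.

Lemma unit_ball_closure : [set x : U d k p1 | `|x| <= 1] =
  closure (sym_convex_hull [set tc b | b in unit_chains d k p]).
Proof.
apply/seteqP; split=> x /=; last first.
  move=> /closure_normP h; apply/ler_addgt0Pr => e /h[y /convex_hull_le1 y1 xy].
  by rewrite -(subrK y x) (le_trans (ler_normD _ _))// addrC lerD.
move=> x1; apply/closure_normP => e e0; have e3 : 0 < e / 3 by rewrite divr_gt0.
have [f xf] := completion_dense x e3.
have f1 : UN f <= 1 + e / 3.
  rewrite -norm_to_completion -(subrK x (tc f)) (le_trans (ler_normD _ _))// addrC lerD//.
  by rewrite distrC.
(* One third keeps [s] strictly above [UN f], as [hull_scaled] needs; rescaling by [1/s] then moves
   [f] by at most [s - 1]. *)
pose s := 1 + e / 3 + e / 3; have s0 : 0 < s by rewrite !addr_gt0.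
have e' : 0 < s - UN f by rewrite subr_gt0; apply: le_lt_trans f1 _; rewrite ltrDl.
exists (tc (s^-1 *: f)).
  by have := hull_scaled f e'; rewrite [UN f + _]addrC subrK.
rewrite -(subrKA (tc f)) (le_trans (ler_normD _ _))//.
have -> : e = e / 3 + (s - 1) by rewrite /s; lra.
apply: lerD => //.
have -> : tc (s^-1 *: f) = s^-1 *: tc f by exact: linearZ.
have -> : tc f - s^-1 *: tc f = (1 - s^-1) *: tc f by rewrite scalerBl scale1r.
have s1 : 1 - s^-1 = (s - 1) / s by rewrite mulrBl mulfV ?mul1r// gt_eqF.
have s2 : 0 <= s - 1 by rewrite /s; lra.
rewrite s1 normrZ ger0_norm ?divr_ge0 ?(ltW s0)// norm_to_completion.
rewrite -mulrA ler_piMr// mulrC ler_pdivrMr// mul1r (le_trans f1)//.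
by rewrite lerDl ltW.
Qed.

End UnitBall.

(** * Nonseparability and the separable subspace *)

Section Structure.
Context (R : realType) (d k : nat) (p : R) (p1 : 1 <= p) (d0 : (0 < d)%N).
Local Notation K := (unit_cube R d).
Local Notation T := (unit_cube R d).
Local Notation J N := {ffun 'I_d -> 'I_N}.
Local Notation M := #|{: mindex d k}|.
Local Notation mom := (@l1_mom R d k).
Local Notation MOM := (@L1_mom R d k).
Local Notation A := (L1_model R d k).
Local Notation AL := (l1_model R d k).
Context (kap : 'rV[R]_M -> T -> R) (C : R) (kapP : corrector AL K kap C).
Context (kapI : 'rV[R]_M -> L1 R d) (CI : R) (kapIP : corrector A K kapI CI).
Local Notation U := (U d k p1).
Local Notation UN := (U0_norm d k p1).
Local Notation UIN := (atomic_seminorm (@L1_atom R d k) p1).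
Local Notation balU := (balU kap).
Local Notation Jt := (Jt p1 d0 kapP).
Local Notation D := ((2 ^ d)%:R `^ p^-1 : R).
Local Notation tc := (to_completion UN).
Local Notation point := (point p1 d0 kapP kapI).

Lemma lp_delta x : lp p (@delta R T x) /\ lp_norm p (@delta R T x) <= 1.
Proof.
have p0 := p_gt0 p1; apply: (lp_bound p1) => // s us; rewrite powR1.
rewrite -(asum_delta R x); apply: le_trans (sum_le_asum us (summ_delta R x)).
rewrite le_eqVlt; apply/orP; left; apply/eqP; apply: eq_bigr => y _; rewrite /delta.
by case: (y == x); rewrite ?normr1 ?normr0 ?powR1// powR0// gt_eqF.
Qed.

Let D0 : 0 < D. Proof. by rewrite powR_gt0// ltr0n expn2_gt0. Qed.

Lemma delta_functional x : exists lam : {linear U -> R^o},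
  [/\ forall u, `|lam u| <= D * `|u|, forall y, lam (point y) = delta R x y &
      forall f : U0 R d k, lam (tc f) = val f x].
Proof.
have [h1 h2] := lp_delta x.
have [lam [lamn lamp lamE _]] := lp_functional p1 d0 kapP kapIP h1.
exists lam; split=> // [u|f].
  apply: le_trans (lamn u) _; rewrite ler_wpM2r// ler_piMr//; exact: ltW.
rewrite lamE -(ssum_delta (val f) x); congr (@ssum R T _).
by apply/funext => y; rewrite mulrC.
Qed.

Lemma U0_norm_eq0 (f : U0 R d k) : UN f = 0 -> f = 0.
Proof.
move=> f0; apply/val_inj/funext => x /=; have [lam [lamn _ lamE]] := delta_functional x.
apply/eqP; rewrite -normr_le0 -lamE (le_trans (lamn _))//.
by rewrite norm_to_completion f0 mulr0.
Qed.

(** The diagonal embeds [[0, 1]], which has positive Lebesgue measure; injectivity needs a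
    coordinate to read off. *)
Lemma unit_cube_uncountable : ~ countable [set: T].
Proof.
move=> /countable_injP[f finj].
have cK (t : R) : (0 <= t <= 1) -> K (const_mx t) by move=> h i; rewrite mxE.
have /choice[g gP] : forall t : R, exists x : T, 0 <= t <= 1 -> set_val x = const_mx t.
  move=> t; have [t01|t01] := boolP (0 <= t <= 1).
    by exists (SigSub (mem_set (cK t t01))).
  have h : 0 <= (0 : R) <= 1 by rewrite lexx ler01.
  by exists (SigSub (mem_set (cK 0 h))).
have : countable ([set` `[0, 1]] : set R).
  apply/countable_injP; exists (f \o g) => s t; rewrite !inE /= !in_itv /= => hs ht fst.
  have /(congr1 set_val) : g s = g t by apply: finj; rewrite ?inE.
  by rewrite (gP _ hs) (gP _ ht) => /rowP/(_ (Ordinal d0)); rewrite !mxE.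
move=> /countable_lebesgue_measure0 /eqP; rewrite lebesgue_measure_itv /= lte01 oppr0 adde0.
by rewrite eqe oner_eq0.
Qed.

Lemma U_nonseparable : ~ separable [set: U].
Proof.
move=> [S [cS _ dS]]; apply: unit_cube_uncountable.
(* Distinct points are at distance at least [1 / D], so they cannot both be within [1 / (3 D)] of
   one element. *)
pose e : R := (3 * D)^-1; have e0 : 0 < e by rewrite invr_gt0 mulr_gt0.
have /choice[s sP] : forall x, exists s, S s /\ `|point x - s| <= e.
  by move=> x; have /closure_normP/(_ _ e0)[s Ss h] := dS (point x) I; exists s.
have sinj : injective s.
  move=> x y sxy; apply: contrapT => /eqP xy.
  have [lam [lamn lamp _]] := delta_functional x.
  have hxy : `|point x - point y| <= e + e.
    rewrite -(subrKA (s x)) (le_trans (ler_normD _ _))// lerD//; first by case: (sP x).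
    by rewrite sxy distrC; case: (sP y).
  have lx : lam (point x) = 1 by rewrite lamp /delta eqxx.
  have ly : lam (point y) = 0 by rewrite lamp /delta eq_sym (negbTE xy).
  have := lamn (point x - point y); move: (point x) (point y) lx ly hxy => u v lx ly hxy.
  have -> : lam (u - v) = 1 by rewrite linearB lx ly subr0.
  rewrite normr1.
  move=> /le_trans/(_ (ler_wpM2l (ltW D0) hxy)).
  have -> : D * (e + e) = 2 / 3 by rewrite /e; field; rewrite gt_eqF.
  by apply/negP; rewrite -ltNge; lra.
have /countable_injP[f finj] := cS.
apply/countable_injP; exists (f \o s) => x y _ _ /= /finj h; apply: sinj; apply: h.
- by rewrite inE; case: (sP x).
- by rewrite inE; case: (sP y).
Qed.

(** Rational masses on dyadic nodes, a countable family near the range of [Jt]. Its members need not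
    lie in the subspace, whence the form of [separable_approx]. *)
Definition dyadic_comb (q : {n : nat & {ffun J (2 ^ n) -> rat}}) : U :=
  tc (balU (\sum_j (ratr (projT2 q j) : R) *: delta R (@znode R d (2 ^ (projT1 q)) j))).

Lemma rat_near (x e : R) : 0 < e -> exists q : rat, `|x - ratr q| <= e.
Proof.
move=> e0; have [q] : exists q : rat, ratr q \in `]x - e, x + e[.
  by apply: rat_in_itvoo; rewrite ltrBlDr -addrA ltrDl addr_gt0.
rewrite in_itv /= => /andP[h1 h2]; exists q; rewrite ler_norml; apply/andP; split; lra.
Qed.

Lemma dyadic_dense a e : 0 < e -> exists q, `|Jt a - dyadic_comb q| <= e.
Proof.
move=> e0; have e2 : 0 < e / 2 by rewrite divr_gt0.
have [n h] := Jt_disc p1 d0 kapP a e2.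
have Cp0 := Cp_gt0 kapP; set B := Cp d k C in Cp0.
pose m := #|J (2 ^ n)|; pose et : R := e / 2 / (B * m.+1%:R).
have et0 : 0 < et by rewrite divr_gt0// mulr_gt0.
have /choice[f fP] : forall j : J (2 ^ n), exists q : rat, `|pair (\1_(cell j)) a - ratr q| <= et.
  by move=> j; exact: rat_near.
exists (existT _ n (finfun f)).
pose g := \sum_j (ratr (f j) : R) *: delta R (@znode R d (2 ^ n) j).
have -> : dyadic_comb (existT _ n (finfun f)) = tc (balU g).
  by congr (tc (balU _)); apply: eq_bigr => j _; rewrite ffunE.
have sg : summ g.
  by rewrite /g; elim/big_ind: _ => [|u v|j _]; [exact: summ0|exact: summD|exact/summZ/summ_delta].
pose dz := disc (@znode R d (2 ^ n)) a; have sd : summ dz by exact: summ_disc.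
rewrite -(subrKA (tc (balU dz))) (le_trans (ler_normD _ _))// [leRHS]splitr lerD//.
  by apply: h => //; exact: nodes_znode.
have -> : tc (balU dz) - tc (balU g) = tc (balU (dz - g)).
  by rewrite (balUB p1 kapP sd sg); exact/esym/linearB.
rewrite norm_to_completion (le_trans (norm_balU p1 kapP (summB _ sd sg)))//.
have -> : dz - g = \sum_j (pair (\1_(cell j)) a - ratr (f j)) *: delta R (@znode R d (2 ^ n) j).
  by rewrite /dz /g -sumrB; apply: eq_bigr => j _; rewrite scalerBl.
rewrite (@le_trans _ _ (B * \sum_(j : J (2 ^ n)) et))//.
  rewrite -/B; apply: ler_wpM2l; first exact: ltW.
  apply: (@le_trans _ _ (\sum_j asum ((pair (\1_(cell j)) a - ratr (f j)) *: delta R (@znode R d (2 ^ n) j)))).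
    by apply: asum_sum => // j; exact/summZ/summ_delta.
  apply: ler_sum => j _; rewrite [asum _](asumZ _ (summ_delta R _)) asum_delta mulr1.
  exact: fP.
rewrite sumr_const -/m -[_ *+ m]mulr_natl /et.
have m0 : 0 < m.+1%:R :> R by rewrite ltr0n.
have -> : B * (m%:R * (e / 2 / (B * m.+1%:R))) = e / 2 * (m%:R / m.+1%:R).
  by field; rewrite !gt_eqF.
by rewrite ler_piMr ?(ltW e2)// ler_pdivrMr// mul1r ler_nat.
Qed.

Lemma hull_of_moment0 a : MOM a = 0 -> exists f : hull (@L1_atom R d k), val f = a.
Proof. by move=> a0; have [f fa _] := @hull_le_nu _ _ _ _ p1 _ _ A _ (L1_supK a) a0; exists f. Qed.

Lemma structure : exists W : closed_subspace U,
  [/\ separable (W : set U), isometric_onto (Uinf d k p1) (W : set U) &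
      isomorphic_lp d p (dual (quotient W))].
Proof.
have cU : complete_space U by exact: completion_complete.
have lJ : linear (fun f : hull (@L1_atom R d k) => Jt (val f)).
  by move=> c f g; rewrite GRing.valD GRing.valZ; exact: Jt_linear.
have nJ f : `|mk_linear lJ f| = UIN f by exact: Jt_norm.
have [F [FE Fn]] := completion_extend_isometry cU nJ.
have Fcl : closed (range F).
  by apply: isometry_range_closed => //; exact: completion_complete.
have F0 : range F 0 by exists 0 => //; rewrite linear0.
have FL (c : R) x y : range F x -> range F y -> range F (c *: x + y).
  by move=> [u _ <-] [v _ <-]; exists (c *: u + v) => //; rewrite linearP.
pose W := ClosedSubspace F0 FL Fcl; exists W.
have WJ a : MOM a = 0 -> cs_val W (Jt a).
  by move=> /hull_of_moment0[f <-]; exists (to_completion UIN f) => //; rewrite FE.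
have Wap w : cs_val W w -> forall e, 0 < e -> exists2 a, MOM a = 0 & `|w - Jt a| <= e.
  move=> [x _ <-] e e0; have [f xf] := completion_dense x e0.
  exists (val f); first by have [] := hull_in A f.
  have -> : Jt (val f) = F (to_completion UIN f) by rewrite FE.
  by rewrite -linearB Fn.
split.
- apply: (@separable_approx _ _ (range dyadic_comb) _ 0) => //.
    by apply: sub_countable (card_image_le _ _) _; exact: countableP.
  move=> w Ww e e0; have e2 : 0 < e / 2 by rewrite divr_gt0.
  have [a _ wa] := Wap _ Ww _ e2; have [q aq] := dyadic_dense a e2.
  exists (dyadic_comb q); first by exists q.
  by rewrite -(subrKA (Jt a)) (le_trans (ler_normD _ _))// [leRHS]splitr lerD.
- by exists F.
- exact: (dual_isomorphic kapIP WJ Wap).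
Qed.

End Structure.

Theorem theorem2p24 (R : realType) (d k : nat) (p : R) (d_gt0 : (0 < d)%N)
    (k_gt0 : (0 < k)%N) (p1 : 1 <= p) (dpk : d%:R / p <= k%:R) :
  [/\ (* (a) *)
      (forall F : set_system (U d k p1),
         ProperFilter F -> cauchy F -> cvg F) /\
      (forall f : U0 R d k, U0_norm d k p1 f = 0 -> f = 0),
      (* (b) *)
      [set x : U d k p1 | `|x| <= 1] =
      closure (sym_convex_hull
        [set to_completion (U0_norm d k p1) b | b in unit_chains d k p]) &
      (* (c) *)
      ~ separable [set: U d k p1] /\
      exists W : closed_subspace (U d k p1),
        [/\ separable (W : set (U d k p1)),
            isometric_onto (Uinf d k p1) (W : set (U d k p1)) &
            isomorphic_lp d p (dual (quotient W))]].
Proof.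
(* One corrector on the whole cube for each model: [kap] balances discretisations, [kapI]
   compensates point masses by densities. *)
have [kap [C kapP]] := corrector_ex (l1_model R d k) (@subset_refl _ (unit_cube R d)).
have [kapI [CI kapIP]] := corrector_ex (L1_model R d k) (@subset_refl _ (unit_cube R d)).
split.
- split; first exact: completion_complete.
  exact: (U0_norm_eq0 d_gt0 kapP kapIP).
- exact: unit_ball_closure.
- split; first exact: (U_nonseparable d_gt0 kapP kapIP).
  exact: (structure p1 d_gt0 kapP kapIP).
Qed.
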